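(* Let $\theta\in\mathbb{R}$ and let $(p_n,q_n)_{n\ge 0}$ be the sequence of best approximation vectors of $\theta$. (1) For all $n\ge 0$ (such that $(p_n,q_n)$ and $(p_{n+1},q_{n+1})$ both exist), at least one of the best approximation vectors $(p_n,q_n)$ and $(p_{n+1},q_{n+1})$ is a Hermite best approximation vector of $\theta$. (2) For (Lebesgue-)almost all $\theta\in\mathbb{R}$, $$\lim_{n\to\infty}\frac1n\,\operatorname{card}\{0\le k<n : (p_k,q_k)\text{ is a Hermite best approximation vector of }\theta\}=\frac{\ln 3}{\ln 4}.$$ (3) Let $(g_n,h_n)$ be the $n$-th Hermite best approximation vector of $\theta$. Then $$\lim_{n\to\infty}\frac1n\ln h_n=\frac{\pi^2}{6\ln 3}$$ for almost all $\theta\in\mathbb{R}$.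
   Context: $\mathbb{N}$ contains $0$ and $\mathbb{N}^*=\mathbb{N}\setminus\{0\}$. A pair $(p,q)\in\mathbb{Z}\times\mathbb{N}^*$ is a best approximation vector of $\theta$ if for all $(a,b)\in\mathbb{Z}^2$: $0<|b|<|q|$ implies $|p-q\theta|<|a-b\theta|$, and $0<|b|\le|q|$ implies $|p-q\theta|\le|a-b\theta|$. The sequence $(p_n,q_n)_{n\ge0}$ of best approximation vectors lists them by strictly increasing $q_n$, with one vector chosen for each value of $q$ that occurs (so $q_0=1$); it is infinite when $\theta$ is irrational and finite when $\theta$ is rational. A nonzero vector $(p,q)\in\mathbb{Z}\times\mathbb{N}$ is a Hermite best approximation vector of $\theta$ if there exists $\Delta>0$ such that $(p-q\theta)^2+q^2/\Delta\le (a-b\theta)^2+b^2/\Delta$ for all nonzero $(a,b)\in\mathbb{Z}^2$. The Hermite best approximation vectors $(g_n,h_n)$, $n\ge 0$, are listed by strictly increasing second coordinate $h_n$, with one vector for each value of the second coordinate that occurs. *)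

(* Defs.v *)
From HB Require Import structures.
From mathcomp Require Import all_boot all_order all_algebra.
From mathcomp Require Import all_classical all_reals all_analysis.
Import Order.TTheory GRing.Theory Num.Theory.
Import numFieldNormedType.Exports.

Set Implicit Arguments.
Unset Strict Implicit.
Unset Printing Implicit Defensive.

Local Open Scope classical_set_scope.
Local Open Scope ring_scope.

(* An integer vector (p, q) in Z x N is a pair v : int * nat. *)

Definition best_approx (R : realType) (theta : R) (v : int * nat) : Prop :=
  [/\ (0 < v.2)%N,
      forall a b : int, 0 < `|b| < v.2%:Z ->
        `|v.1%:~R - v.2%:R * theta| < `|a%:~R - b%:~R * theta|
    & forall a b : int, 0 < `|b| <= v.2%:Z ->
        `|v.1%:~R - v.2%:R * theta| <= `|a%:~R - b%:~R * theta|].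

Definition hermite_best_approx (R : realType) (theta : R) (v : int * nat) :
    Prop :=
  v != (0, 0%N) /\
  exists2 Delta : R, 0 < Delta &
    forall a b : int, (a, b) != (0, 0) ->
      (v.1%:~R - v.2%:R * theta) ^+ 2 + v.2%:R ^+ 2 / Delta <=
      (a%:~R - b%:~R * theta) ^+ 2 + b%:~R ^+ 2 / Delta.

(* u is a finite or infinite sequence listing P by strictly increasing second
   coordinate, with exactly one vector of P for each second coordinate that
   occurs in P; u n = None means that the sequence has no term of index n.  The
   choice of the vector is left open: (p, 1) and (p + 1, 1) are both best
   approximation vectors of p + 1/2, and (1, 0) and (-1, 0) are both Hermite
   best approximation vectors of every theta. *)
Definition lists (P : set (int * nat)) (u : nat -> option (int * nat)) : Prop :=
  [/\ forall n, u n = None -> u n.+1 = None,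
      forall n v, u n = Some v -> P v,
      forall n v w, u n = Some v -> u n.+1 = Some w -> (v.2 < w.2)%N
    & forall v, P v -> exists n w, u n = Some w /\ w.2 = v.2].

Lemma exists_lists (P : set (int * nat)) : exists u, lists P u.
Proof.
have next m : exists o : option (int * nat),
    if o is Some v then
      [/\ P v, (m <= v.2)%N & forall w, P w -> (m <= w.2)%N -> (v.2 <= w.2)%N]
    else forall w, P w -> ~~ (m <= w.2)%N.
  pose D q := (m <= q)%N && `[< exists p, P (p, q) >].
  have [exD|nD] := pselect (exists q, D q); last first.
    exists None => -[p q] Pw; apply/negP => /= mq; apply: nD; exists q.
    by rewrite /D mq; apply/asboolP; exists p.
  case: (ex_minnP exD) => q /andP[mq /asboolP[p Pp]] qmin.
  exists (Some (p, q)); split => // -[p' q'] Pw /= mq'; apply: qmin.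
  by rewrite /D mq'; apply/asboolP; exists p'.
have [f fP] := choice next.
pose u := fix u n :=
  if n is n'.+1 then obind (fun v : int * nat => f v.2.+1) (u n') else f 0%N.
have uS n : u n.+1 = obind (fun v : int * nat => f v.2.+1) (u n) by [].
exists u; split.
- by move=> n; rewrite uS => ->.
- case=> [|n] v.
    by move=> /= fv; have := fP 0%N; rewrite fv => -[].
  by rewrite uS; case: (u n) => //= w fv; have := fP w.2.+1; rewrite fv => -[].
- move=> n v w; rewrite uS => -> /= fw.
  by have := fP v.2.+1; rewrite fw => -[].
move=> v Pv.
have P0 : exists w, u 0%N = Some w /\ (w.2 <= v.2)%N.
  move: (fP 0%N) => /=; case: (f 0%N) => [w [_ _ wP]|/(_ v Pv)//].
  by exists w; split=> //; apply: wP.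
suff [n [w [un wv]]] : exists n w, u n = Some w /\ w.2 = v.2.
  by exists n, w.
have step d : (exists n w, u n = Some w /\ w.2 = v.2) \/
    (exists n w, [/\ u n = Some w, (w.2 < v.2)%N & (d <= w.2)%N]).
  elim: d => [|d [|[n [w [un wv dw]]]]]; [|by left|].
    have [w [uw]] := P0; rewrite leq_eqVlt => /orP[/eqP e|l].
      by left; exists 0%N, w.
    by right; exists 0%N, w.
  move: (fP w.2.+1); case E: (f w.2.+1) => [x|]; last first.
    by move=> /(_ v Pv); rewrite wv.
  case=> _ wx /(_ v Pv wv); rewrite leq_eqVlt => /orP[/eqP e|l].
    by left; exists n.+1, x; rewrite uS un.
  right; exists n.+1, x; split => //; first by rewrite uS un.
  exact: leq_ltn_trans dw wx.
have [//|[n [w [_ wv]]]] := step v.2.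
by rewrite leqNgt wv.
Qed.

(* Main.v *)
Require Import Defs.
From mathcomp Require Import all_boot all_order all_algebra.
From mathcomp Require Import all_classical all_reals all_analysis.
From mathcomp Require Import measurable_realfun ring lra zify.
Import Order.TTheory GRing.Theory Num.Theory.
Import numFieldNormedType.Exports.

Set Implicit Arguments.
Unset Strict Implicit.
Unset Printing Implicit Defensive.

Local Open Scope classical_set_scope.
Local Open Scope ring_scope.

(** A Hermite best approximation vector minimizes, for some [Delta], the
    positive form [N (a, b) = (a - b theta)^2 + b^2 / Delta] on the nonzero
    lattice points [(a, b)].  The number [a - b theta] is called the defect of
    [(a, b)].

    The algebra.  Two consecutive best approximation vectors [u], [v] form a
    basis of the lattice with defects of opposite signs ([reduced_pair]).  The
    form for which [u] and [u + v] have the same norm is the most favourable one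
    for [v], and eliminating [Delta] leaves a test that no longer mentions it
    ([hermite_reduced], [hermite_reduced_conv]): if [q'], [q] are the denominators
    of [u], [v] and [r'], [r] the absolute values of their defects, then [v] is a
    Hermite vector exactly when [3 q r <= (2 q' + q) (2 r' - r)].  This test
    cannot fail for two consecutive vectors ([hermite_alternative]).

    The dynamics.  In terms of [x = q' / q] and [t = r / r'] the passage to the
    next vector is the map that sends [(x, t)] to [(1 / (a + x), 1 / t - a)], where
    [a] is the integer part of [1 / t]; the orbit starts at [x = 0] and
    [t] equal to the distance from [theta] to the nearest integer.  The test
    becomes [t <= (2 x + 1) / (x + 2)], and the logarithm of the denominator of
    index [n] is the sum of [ln (a + x)] along the orbit.  Both the frequency of
    Hermite vectors and the growth of denominators are thus averages along the
    orbit of an explicit function, which is nonnegative.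

    The averages.  Attach to [x] the law with density [(1 + x) / (1 + x t)^2] on
    the unit interval, which is the Lebesgue measure for [x = 0].  If [t] follows
    the law attached to [x], then, given the digit [a], the next [t]
    follows the law attached to the next [x] ([expect_one_step]).  So the values
    of [x] form a Markov chain, whose transition operator contracts
    Lipschitz constants ([transfer_lipschitz]) and preserves the integral for the
    Gauss measure ([gauss_invariance]).  Hence the expectation of the n-th
    term tends to the Gauss mean [c] at a geometric rate.  With a bound on the
    correlation between a term and the later ones, the variance
    of the sum of [n] terms is at most linear in [n] ([second_moment]), and the
    averages converge almost everywhere, first along squares and then for all [n]
    because the terms are nonnegative ([strong_law]).  The correlation bound is
    immediate for [ln (a + x)], which depends on [t] through its digit only; for the
    test it follows from its monotonicity in [t] ([correlation]).

    The constants.  The Gauss integral of the mean of the test is [ln 3 / 2], and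
    division by the total mass [ln 2] gives [ln 3 / ln 4]
    ([hermite_mean_integral]).  That of [ln (a + x)] equals, by invariance, the
    integral of [- ln y / (1 + y)], which is [pi^2 / 12] by the sum of the inverse
    squares ([basel], [integral_log_gauss]).

    The Hermite vectors are [(1, 0)], up to sign, and the best approximation vectors
    that pass the test.  If the Hermite vector of index [n] is the best approximation
    vector of index [k], then [n / k] tends to [ln 3 / ln 4] while
    [ln h / k] tends to [pi^2 / (12 ln 2)], and the quotient is
    [pi^2 / (6 ln 3)] ([hermite_growth]). *)


(** * A test for Hermite vectors in reduced bases *)

Definition defect (R : realType) (theta : R) (v : int * nat) : R :=
  v.1%:~R - v.2%:R * theta.

(** The shape of two consecutive best approximation vectors: a basis of the
    lattice whose defects have opposite signs, with increasing denominators
    and decreasing defects.  Such a basis is nearly reduced for every form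
    [(a - b theta) ^+ 2 + b ^+ 2 / Delta]. *)
Record reduced_pair (R : realType) (theta : R) (u v : int * nat) : Prop := {
  rp_det : `|u.1 * v.2%:Z - v.1 * u.2%:Z| = 1;
  rp_sign : defect theta u * defect theta v <= 0;
  rp_lt : `|defect theta v| < `|defect theta u|;
  rp_le : (u.2 <= v.2)%N;
  rp_gt0 : (0 < v.2)%N }.

Lemma reduced_pair_coord (R : realType) (theta : R) (u v : int * nat) (a b : int) :
  reduced_pair theta u v ->
  exists m n : int, a = m * u.1 + n * v.1 /\ b = m * u.2%:Z + n * v.2%:Z.
Proof.
move=> [+ _ _ _ _]; set D := (X in `|X|) => D1.
have DD : D * D = 1.
  by rewrite -expr2 -[D ^+ 2]ger0_norm ?sqr_ge0// normrX D1 expr1n.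
exists (D * (a * v.2%:Z - b * v.1)), (D * (b * u.1 - a * u.2%:Z)).
split.
- rewrite -[LHS]mulr1 -DD {2}/D; ring.
- rewrite -[LHS]mulr1 -DD {2}/D; ring.
Qed.

Lemma opposite_signs (R : realDomainType) (x y : R) : x * y <= 0 ->
  exists2 e : R, e = 1 \/ e = -1 & x = e * `|x| /\ y = - (e * `|y|).
Proof.
move=> xy; have [x0|x0|x0] := ltgtP 0 x.
- exists 1; first by left.
  have y0 : y <= 0 by move: xy; rewrite pmulr_rle0.
  by rewrite gtr0_norm// ler0_norm// !mul1r opprK.
- exists (-1); first by right.
  have y0 : 0 <= y by move: xy; rewrite nmulr_rle0.
  by rewrite ltr0_norm// ger0_norm// !mulN1r !opprK.
- subst x; have [y0|y0] := lerP y 0.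
    exists 1; first by left.
    by rewrite normr0 mulr0 ler0_norm// mul1r opprK.
  exists (-1); first by right.
  by rewrite normr0 mulr0 gtr0_norm// mulN1r opprK.
Qed.

(** For a basis [u], [v] in which [u] and [u + v] have the same norm
    [N u >= N v], the norm of [m u + n v] is at least
    [N v * (m ^+ 2 - m * n + n ^+ 2)]. *)
Lemma hexagonal_form_ge1 (m n : int) : ~ (m = 0 /\ n = 0) ->
  1 <= m * m - m * n + n * n.
Proof.
move=> mn0; suff : 0 < 2 * (m * m - m * n + n * n).
  by rewrite pmulr_rgt0.
rewrite (_ : 2 * _ = (m - n) ^+ 2 + (m ^+ 2 + n ^+ 2)); last by ring.
rewrite ltr_wpDl ?sqr_ge0// lt_neqAle addr_ge0 ?sqr_ge0// andbT eq_sym.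
apply/negP; rewrite paddr_eq0 ?sqr_ge0// !sqrf_eq0.
by move=> /andP[/eqP m0 /eqP n0]; apply: mn0.
Qed.

(** If any [Delta] works, so does the one for which [u] and [u + v] have the
    same norm, that is [2 * <u, v> = - N v].  The hypothesis says exactly that
    [N v <= N u] for this [Delta]; then the basis is reduced and the hexagonal
    form bounds all other norms from below. *)
Lemma hermite_reduced (R : realType) (theta : R) (u v : int * nat) :
  reduced_pair theta u v -> 0 < `|defect theta v| ->
  3 * (v.2%:R * `|defect theta v|) <=
    (2 * u.2%:R + v.2%:R) * (2 * `|defect theta u| - `|defect theta v|) ->
  hermite_best_approx theta v.
Proof.
move=> uv rv0 cond.
have [Duv sg rlt qle qv0] := uv.
have [e e1 [Xu Xv]] := opposite_signs sg.
have ee : e * e = 1 by case: e1 => ->; rewrite ?mulr1// mulrNN mulr1.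
set ru := `|defect theta u| in cond rlt Xu *.
set rv := `|defect theta v| in cond rlt rv0 Xv *.
pose qu : R := u.2%:R; pose qv : R := v.2%:R.
rewrite -/qu -/qv in cond.
have qv_gt0 : 0 < qv by rewrite ltr0n.
have qu_ge0 : 0 <= qu by rewrite ler0n.
have quv : qu <= qv by rewrite ler_nat.
pose ep := (rv * (2 * ru - rv)) / (qv * (2 * qu + qv)).
have num0 : 0 < rv * (2 * ru - rv) by apply: mulr_gt0 => //; lra.
have den0 : 0 < qv * (2 * qu + qv) by apply: mulr_gt0 => //; lra.
have ep0 : 0 < ep by apply: divr_gt0.
have epE : ep * (qv * (2 * qu + qv)) = rv * (2 * ru - rv).
  by rewrite divfK// gt_eqF.
(* The hypothesis is [N v <= N u]: the difference is a multiple of that of its two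
   sides by a positive factor. *)
have Nuv : rv ^+ 2 + ep * qv ^+ 2 <= ru ^+ 2 + ep * qu ^+ 2.
  rewrite -subr_ge0 -(pmulr_rge0 _ den0).
  rewrite [X in 0 <= X](_ : _ = qv * (2 * qu + qv) * (ru ^+ 2 - rv ^+ 2) -
    ep * (qv * (2 * qu + qv)) * (qv ^+ 2 - qu ^+ 2)); last by ring.
  rewrite epE.
  pose Y := 2 * ru - rv; pose X := 2 * qu + qv.
  have YX : 3 * (qv * rv) <= X * Y by [].
  have -> : qv * (2 * qu + qv) * (ru ^+ 2 - rv ^+ 2) -
       rv * (2 * ru - rv) * (qv ^+ 2 - qu ^+ 2) =
      (X * Y - 3 * (qv * rv)) * (qv * Y + rv * X) / 4.
    by rewrite /X /Y; field.
  apply: divr_ge0; last by lra.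
  apply: mulr_ge0; first by rewrite subr_ge0.
  by apply: addr_ge0; apply: mulr_ge0; rewrite /X /Y; lra.
split.
  by apply/eqP => v0; move: qv0; rewrite v0.
exists ep^-1; first by rewrite invr_gt0.
move=> a b ab; rewrite invrK.
have [m [n [aE bE]]] := reduced_pair_coord a b uv.
have mn : 1 <= m * m - m * n + n * n.
  have : ~ (m = 0 /\ n = 0).
    move=> [m0 n0]; move: ab; rewrite aE bE m0 n0 !mul0r !addr0.
    by rewrite eqxx.
  exact: hexagonal_form_ge1.
have mnR : (1:R) <= m%:~R * m%:~R - m%:~R * n%:~R + n%:~R * n%:~R.
  by rewrite -!rmorphM -rmorphB -rmorphD ler1z.
have -> : a%:~R - b%:~R * theta = m%:~R * defect theta u + n%:~R * defect theta v.
  rewrite aE bE /defect !rmorphD !rmorphM /= -!pmulrn; ring.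
have -> : (b%:~R : R) = m%:~R * qu + n%:~R * qv.
  rewrite bE rmorphD !rmorphM /= -!pmulrn. done.
rewrite -/(defect theta v) -/qv.
rewrite [in X in _ <= X]Xu [in X in _ <= X]Xv.
set M := m%:~R in mnR *; set N := n%:~R in mnR *.
rewrite -[defect theta v ^+ 2]ger0_norm ?sqr_ge0// normrX -/rv.
have -> : (M * (e * ru) + N * - (e * rv)) ^+ 2 = e * e * (M * ru - N * rv) ^+ 2.
  by ring.
rewrite ee mul1r.
have -> : (M * ru - N * rv) ^+ 2 + (M * qu + N * qv) ^+ 2 * ep =
  M ^+ 2 * (ru ^+ 2 + ep * qu ^+ 2) + N ^+ 2 * (rv ^+ 2 + ep * qv ^+ 2)
  + M * N * (ep * (qv * (2 * qu + qv)) - ep * qv ^+ 2 - 2 * (ru * rv)) by ring.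
rewrite epE.
set Nu := ru ^+ 2 + _ in Nuv *; set Nv := rv ^+ 2 + _ in Nuv *.
have Nv0 : 0 <= Nv.
  by apply: addr_ge0; rewrite ?sqr_ge0// mulr_ge0 ?sqr_ge0// ltW.
have -> : rv ^+ 2 + qv ^+ 2 * ep = Nv by rewrite mulrC.
have -> : rv * (2 * ru - rv) - ep * qv ^+ 2 - 2 * (ru * rv) = - Nv.
  by rewrite /Nv; ring.
apply: (@le_trans _ _ (Nv * (M * M - M * N + N * N))).
  by rewrite ler_peMr.
rewrite -subr_ge0.
rewrite [X in 0 <= X](_ : _ = M ^+ 2 * (Nu - Nv)); last by ring.
by rewrite mulr_ge0 ?sqr_ge0// subr_ge0.
Qed.

(** Only two competitors matter: the inequalities [N v <= N u] and
    [N v <= N (u + v)] bound [1 / Delta] from above and from below, and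
    eliminating it leaves a product whose second factor is positive. *)
Lemma hermite_reduced_conv (R : realType) (theta : R) (u v : int * nat) :
  reduced_pair theta u v -> hermite_best_approx theta v ->
  3 * (v.2%:R * `|defect theta v|) <=
    (2 * u.2%:R + v.2%:R) * (2 * `|defect theta u| - `|defect theta v|).
Proof.
move=> uv [_ [D D0 H]].
have [Duv sg rlt qle qv0] := uv.
have u0 : (u.1, u.2%:Z) != (0, 0).
  apply/eqP => -[u1 u2]; move: Duv; rewrite u1 u2 mul0r mulr0 subr0 normr0.
  by [].
have w0 : (u.1 + v.1, u.2%:Z + v.2%:Z) != (0, 0).
  by apply/eqP => -[_ w2]; lia.
have [e e1 [Xu Xv]] := opposite_signs sg.
have ee : e * e = 1 by case: e1 => ->; rewrite ?mulr1// mulrNN mulr1.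
move: (H _ _ u0) (H _ _ w0) => {H}.
rewrite -/(defect theta v) -[u.2%:Z%:~R]/(u.2%:R) -/(defect theta u).
have -> : (u.1 + v.1)%:~R - (u.2%:Z + v.2%:Z)%:~R * theta =
    defect theta u + defect theta v.
  by rewrite /defect !rmorphD /=; ring.
rewrite rmorphD /= -[u.2%:Z%:~R]/(u.2%:R) -[v.2%:Z%:~R]/(v.2%:R).
set ru := `|defect theta u| in rlt Xu *.
set rv := `|defect theta v| in rlt Xv *.
rewrite Xu Xv.
have -> : (e * ru + - (e * rv)) ^+ 2 = e * e * (ru - rv) ^+ 2 by ring.
have -> : (- (e * rv)) ^+ 2 = e * e * rv ^+ 2 by ring.
have -> : (e * ru) ^+ 2 = e * e * ru ^+ 2 by ring.
rewrite ee !mul1r.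
have rv0 : 0 <= rv by apply: normr_ge0.
clearbody ru rv.
set qu : R := u.2%:R; set qv : R := v.2%:R.
have qv_gt0 : 0 < qv by rewrite ltr0n.
have qu_ge0 : 0 <= qu by rewrite ler0n.
have quv : qu <= qv by rewrite ler_nat.
clearbody qu qv.
set ep := D^-1.
have ep0 : 0 < ep by rewrite invr_gt0.
clearbody ep => {Xu Xv}.
move=> H1 H2.
have L1 : ep * (qv ^+ 2 - qu ^+ 2) <= ru ^+ 2 - rv ^+ 2.
  by move: H1; lra.
have L2 : rv ^+ 2 - (ru - rv) ^+ 2 <= ep * (qu * (2 * qv + qu)).
  move: H2; have -> : (qu + qv) ^+ 2 * ep = ep * (qu * (2 * qv + qu)) + qv ^+ 2 * ep
    by ring.
  by lra.
have [h|h] := lerP (2 * rv) ru.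
  apply: (@le_trans _ _ (qv * (2 * ru - rv))).
    by rewrite mulrCA ler_wpM2l//; lra.
  by apply: ler_wpM2r; lra.
have A0 : 0 < rv ^+ 2 - (ru - rv) ^+ 2.
  have -> : rv ^+ 2 - (ru - rv) ^+ 2 = ru * (2 * rv - ru) by ring.
  by apply: mulr_gt0; lra.
have B0 : 0 <= qv ^+ 2 - qu ^+ 2.
  by rewrite subr_ge0 ler_sqr ?nnegrE//; lra.
have C0 : 0 <= qu * (2 * qv + qu) by apply: mulr_ge0 => //; lra.
(* Eliminate [ep] between the upper bound [L1] and the lower bound [L2]. *)
have P : (rv ^+ 2 - (ru - rv) ^+ 2) * (qv ^+ 2 - qu ^+ 2) <=
         (qu * (2 * qv + qu)) * (ru ^+ 2 - rv ^+ 2).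
  apply: (@le_trans _ _ (ep * (qu * (2 * qv + qu)) * (qv ^+ 2 - qu ^+ 2))).
    exact: ler_wpM2r.
  have -> : ep * (qu * (2 * qv + qu)) * (qv ^+ 2 - qu ^+ 2) =
    (qu * (2 * qv + qu)) * (ep * (qv ^+ 2 - qu ^+ 2)) by ring.
  exact: ler_wpM2l.
pose Y := 2 * ru - rv; pose X := 2 * qu + qv.
have E : (qu * (2 * qv + qu)) * (ru ^+ 2 - rv ^+ 2) -
   (rv ^+ 2 - (ru - rv) ^+ 2) * (qv ^+ 2 - qu ^+ 2) =
   (X * Y - 3 * (qv * rv)) * (qu * rv + ru * qv) / 2.
  by rewrite /X /Y; field.
have F0 : 0 < qu * rv + ru * qv.
  by apply: ltr_wpDl; [apply: mulr_ge0 | apply: mulr_gt0 => //; lra].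
have : 0 <= (X * Y - 3 * (qv * rv)) * (qu * rv + ru * qv) / 2.
  by rewrite -E subr_ge0.
by rewrite pmulr_lge0 ?invr_gt0// pmulr_lge0// subr_ge0.
Qed.

(** * The continued fraction algorithm *)

(** One step of the continued fraction algorithm: add to [u] the largest
    multiple of [v] that leaves the sign of the defect unchanged. *)
Definition next_vector (R : realType) (theta : R) (u v : int * nat) : int * nat :=
  let a := Num.truncn (`|defect theta u| / `|defect theta v|) in
  (u.1 + a%:Z * v.1, (u.2 + a * v.2)%N).

Section reduced_pair_next.
Variables (R : realType) (theta : R) (u v : int * nat).
Hypothesis uv : reduced_pair theta u v.
Hypothesis rv0 : 0 < `|defect theta v|.
Let a := Num.truncn (`|defect theta u| / `|defect theta v|).

Lemma digit_bounds :
  a%:R * `|defect theta v| <= `|defect theta u| < a.+1%:R * `|defect theta v|.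
Proof.
have q0 : 0 <= `|defect theta u| / `|defect theta v| by rewrite divr_ge0// ltW.
have /andP[h1 h2] := truncn_itv q0.
by rewrite -ler_pdivlMr// h1 /= -ltr_pdivrMr.
Qed.

Lemma digit_gt0 : (0 < a)%N.
Proof.
have [_ _ ruv _ _] := uv.
have /andP[_] := digit_bounds.
by case: (a) => // ; rewrite mul1r => /(lt_trans ruv); rewrite ltxx.
Qed.

Lemma defect_next : defect theta (next_vector theta u v) =
  defect theta u + a%:R * defect theta v.
Proof.
rewrite /next_vector -/a /defect /= rmorphD rmorphM /= natrD natrM -pmulrn; ring.
Qed.

Lemma norm_defect_next : `|defect theta (next_vector theta u v)| =
  `|defect theta u| - a%:R * `|defect theta v|.
Proof.
have [_ sg _ _ _] := uv.
have [e e1 [Xu Xv]] := opposite_signs sg.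
rewrite defect_next.
set ru := `|defect theta u| in Xu *; set rv := `|defect theta v| in Xv *.
rewrite Xu Xv.
have -> : e * ru + a%:R * - (e * rv) = e * (ru - a%:R * rv) by ring.
rewrite normrM; have -> : `|e| = 1 by case: e1 => ->; rewrite ?normrN normr1.
rewrite mul1r ger0_norm// subr_ge0.
by have /andP[] := digit_bounds.
Qed.

Lemma reduced_pair_next : reduced_pair theta v (next_vector theta u v).
Proof.
have [D sg ruv quv qv] := uv.
have /andP[b1 b2] := digit_bounds.
have a0 := digit_gt0.
split=> //.
- rewrite /next_vector -/a /= PoszD PoszM -D -normrN; congr `|_|; ring.
- have [e e1 [Xu Xv]] := opposite_signs sg.
  rewrite defect_next.
  set ru := `|defect theta u| in b1 Xu *; set rv := `|defect theta v| in b1 Xv *.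
  rewrite Xv Xu.
  have -> : - (e * rv) * (e * ru + a%:R * - (e * rv)) =
    - (e * e * (rv * (ru - a%:R * rv))) by ring.
  have -> : e * e = 1 by case: e1 => ->; rewrite ?mulr1// mulrNN mulr1.
  by rewrite mul1r oppr_le0 mulr_ge0 ?normr_ge0 ?subr_ge0.
- rewrite norm_defect_next ltrBlDr.
  by move: b2; rewrite -natr1 mulrDl mul1r addrC.
- by rewrite /= -/a; nia.
- by rewrite /= -/a; nia.
Qed.

(** In the basis [u], [v] with defects of opposite signs, a lattice vector
    [m u + n v] with defect smaller than that of [v] must have [m] and [n] of the
    same sign and [n] at least [m] times the digit, so its denominator is at
    least that of the next vector. *)
Lemma reduced_pair_void (b c : int) : (b, c) != (0, 0) ->
  `|b%:~R - c%:~R * theta| < `|defect theta v| ->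
  (next_vector theta u v).2%:Z <= `|c| /\
  (`|c| = (next_vector theta u v).2%:Z ->
   exists s : int, [/\ s = 1 \/ s = -1, b = s * (next_vector theta u v).1 &
                       c = s * (next_vector theta u v).2%:Z]).
Proof.
have [D sg ruv quv qv] := uv.
have /andP[b1 b2] := digit_bounds.
have a0 := digit_gt0.
have [m [n [bE cE]]] := reduced_pair_coord b c uv.
wlog m0 : b c m n bE cE / 0 <= m.
  move=> H bc X; have [m0|m0] := lerP 0 m; first exact: (H b c m n).
  have [|||||h1 h2] := H (- b) (- c) (- m) (- n).
  - by rewrite bE opprD !mulNr.
  - by rewrite cE opprD !mulNr.
  - by rewrite oppr_ge0 ltW.
  - by apply: contra bc => /eqP[/eqP + /eqP +]; rewrite !oppr_eq0 => /eqP -> /eqP ->.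
  - by move: X; rewrite -normrN !rmorphN opprD /= mulNr.
  rewrite normrN in h1 h2; split=> // /h2 [s [s1 bs cs]].
  exists (- s); split; first by case: s1 => ->; [right|left; rewrite opprK].
  - by rewrite mulNr -bs opprK.
  - by rewrite mulNr -cs opprK.
move=> bc.
have -> : b%:~R - c%:~R * theta = m%:~R * defect theta u + n%:~R * defect theta v.
  rewrite bE cE /defect !rmorphD !rmorphM /= -!pmulrn; ring.
have [e e1 [Xu Xv]] := opposite_signs sg.
set ru := `|defect theta u| in Xu ruv b1 b2 *.
set rv := `|defect theta v| in Xv ruv b1 b2 *.
have rvp : 0 < rv := rv0.
rewrite Xu Xv.
have -> : m%:~R * (e * ru) + n%:~R * - (e * rv) = e * (m%:~R * ru - n%:~R * rv) by ring.
rewrite normrM; have -> : `|e| = 1 by case: e1 => ->; rewrite ?normrN normr1.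
rewrite mul1r => /ltr_normlP [X1 X2].
have m1 : 1 <= m.
  rewrite -gtz0_ge1 lt_neqAle m0 andbT eq_sym; apply/negP => /eqP me.
  move: X1 X2; rewrite me mul0r sub0r opprK => X1 X2.
  have n1 : n < 1 by rewrite -(ltrz1 R) -(ltr_pM2r rvp) mul1r.
  have n2 : -1 < n.
    rewrite -ltrN2 opprK -(ltrz1 R) -(ltr_pM2r rvp) mul1r.
    by rewrite rmorphN /= mulNr.
  move: bc; have n0 : n = 0 by lia.
  by rewrite bE cE me n0 !mul0r !addr0 eqxx.
have nma : m * a%:Z <= n.
  suff : m * a%:Z < n + 1 by rewrite ltzD1.
  rewrite -(ltr_int R) -(ltr_pM2r rvp) rmorphD rmorphM /= mulrDl mul1r -pmulrn.
  apply: (@le_lt_trans _ _ (m%:~R * ru)).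
    by rewrite -mulrA ler_wpM2l// ler0z.
  by move: X2; rewrite ltrBlDr addrC.
have na : a%:Z <= n by apply: le_trans nma; rewrite ler_peMl.
rewrite /next_vector -/a /= cE ger0_norm; last first.
  by rewrite addr_ge0// mulr_ge0//; lia.
rewrite PoszD PoszM; move: qv quv a0 m1 nma na bE; clear.
case: u v => pu qu [pv qv] /= qv0 quv a0 m1 nma na bE.
split; first by apply: lerD; [rewrite ler_peMl | rewrite ler_wpM2r].
move=> E; exists 1.
have na' : n = a.
  apply/eqP; rewrite eq_le na andbT leNgt; apply/negP => an.
  have : a%:Z * qv%:Z < n * qv%:Z by rewrite ltr_pM2r// ltz_nat.
  have : qu%:Z <= m * qu by rewrite ler_peMl.
  by move: E; lia.
have m1' : m = 1.
  apply/eqP; rewrite eq_le m1 andbT.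
  by rewrite -(@ler_pM2r _ a%:Z) ?ltz_nat// mul1r -{2}na'.
by split; [left| rewrite bE m1' na' !mul1r|rewrite mul1r E].
Qed.

End reduced_pair_next.

Lemma next_vector_best (R : realType) (theta : R) (u v : int * nat) :
  reduced_pair theta u v -> best_approx theta v -> 0 < `|defect theta v| ->
  best_approx theta (next_vector theta u v) /\ (v.2 < (next_vector theta u v).2)%N.
Proof.
move=> uv [_ _ vmin] rv0.
set c := next_vector theta u v.
have vc : reduced_pair theta v c by exact: reduced_pair_next.
have [_ _ rcv _ qc0] := vc.
have void := reduced_pair_void uv rv0; rewrite -/c in void.
have nz (p q : int) : 0 < `|q| -> (p, q) != (0, 0).
  by move=> q0; apply/eqP => -[_ q1]; move: q0; rewrite q1 normr0.
split; last first.
  rewrite ltnNge; apply/negP => cv2.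
  suff le_vc : `|defect theta v| <= `|defect theta c| by move: rcv; rewrite ltNge le_vc.
  by apply: (vmin c.1 c.2%:Z); rewrite ger0_norm// ltz_nat qc0 lez_nat cv2.
split=> // p q /andP[q0 qc]; rewrite -/(defect theta c).
  rewrite ltNge; apply/negP => /le_lt_trans /(_ rcv) h.
  have [h1 _] := void p q (nz p q q0) h.
  by move: qc; rewrite ltNge h1.
rewrite leNgt; apply/negP => h.
have [h1 h2] := void p q (nz p q q0) (lt_trans h rcv).
have [|s [s1 ps qs]] := h2; first by apply/eqP; rewrite eq_le h1 qc.
move: h; rewrite ps qs !rmorphM /= -mulrA -mulrBr normrM -/(defect theta c).
by case: s1 => ->; rewrite ?rmorphN ?normrN normr1 mul1r ltxx.
Qed.

(** The algorithm never skips a best approximation vector: the next one has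
    a smaller defect than [v], so its denominator is at least that of
    [next_vector], which is itself a best approximation vector. *)
Lemma next_best_approx (R : realType) (theta : R) (u v w : int * nat) :
  reduced_pair theta u v -> best_approx theta v -> best_approx theta w ->
  (v.2 < w.2)%N ->
  (forall z, best_approx theta z -> (v.2 < z.2)%N -> (w.2 <= z.2)%N) ->
  0 < `|defect theta v| /\ w = next_vector theta u v.
Proof.
move=> uv vB [w0 wlt wmin] vw wnext.
have [_ _ _ _ qv0] := uv.
have rwv : `|defect theta w| < `|defect theta v|.
  by apply: (wlt v.1 v.2%:Z); rewrite ger0_norm// !ltz_nat qv0.
have rv0 : 0 < `|defect theta v| by apply: le_lt_trans rwv.
split=> //.
have [c_best vc2] := next_vector_best uv vB rv0.
set c := next_vector theta u v in c_best vc2 *.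
have void := reduced_pair_void uv rv0; rewrite -/c in void.
have nz (p q : int) : 0 < `|q| -> (p, q) != (0, 0).
  by move=> q0; apply/eqP => -[_ q1]; move: q0; rewrite q1 normr0.
have wc : (w.2 <= c.2)%N by exact: wnext.
have wz : (w.1, w.2%:Z) != (0, 0) by apply: nz; rewrite ger0_norm// ltz_nat.
have [wc3 wc4] := void w.1 w.2%:Z wz rwv.
move: wc3; rewrite ger0_norm// lez_nat => cw.
have ecw : w.2 = c.2 by apply/eqP; rewrite eqn_leq wc cw.
have [|s [s1 ps qs]] := wc4; first by rewrite ger0_norm// ecw.
move: ps qs ecw w0; case: (w) (c) => w1 w2 [c1 c2] /=.
case: s1 => -> -> + <- ; first by rewrite !mul1r.
by move=> ? ?; lia.
Qed.

(** * Sequences of best approximation vectors *)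

Lemma lists_Some (P : set (int * nat)) u i j w : lists P u -> (i <= j)%N ->
  u j = Some w -> exists v, u i = Some v.
Proof.
move=> [uN _ _ _] ij uj; case E : (u i) => [v|]; first by exists v.
suff H k : u (i + k)%N = None by move: uj; rewrite -(subnKC ij) H.
by elim: k => [|k IH]; rewrite ?addn0// addnS; apply: uN.
Qed.

Lemma lists_lt (P : set (int * nat)) u i j v w : lists P u -> (i < j)%N ->
  u i = Some v -> u j = Some w -> (v.2 < w.2)%N.
Proof.
move=> uP; have [_ _ ult _] := uP.
elim: j w => // j IH w; rewrite ltnS leq_eqVlt => /orP[/eqP <-|ij] ui uj.
  exact: ult uj.
have [x ux] := lists_Some uP (leqnSn j) uj.
exact: ltn_trans (IH _ ij ui ux) (ult _ _ _ ux uj).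
Qed.

Lemma lists_next (P : set (int * nat)) u n v w : lists P u ->
  u n = Some v -> u n.+1 = Some w ->
  forall z, P z -> (v.2 < z.2)%N -> (w.2 <= z.2)%N.
Proof.
move=> uP un un1 z Pz vz; have [_ _ _ /(_ z Pz) [k [x [uk xz]]]] := uP.
rewrite -xz in vz *; have [kn|nk|kn] := ltngtP k n.
- by have := lists_lt uP kn uk un; lia.
- move: nk; rewrite leq_eqVlt => /orP[/eqP nk|nk].
    by move: un1; rewrite nk uk => -[->].
  by apply: ltnW; apply: lists_lt uP nk un1 uk.
- by move: vz; move: uk; rewrite kn un => -[->]; rewrite ltnn.
Qed.

Lemma lists_nonempty (P : set (int * nat)) u z : lists P u -> P z ->
  exists v, u 0%N = Some v /\ (v.2 <= z.2)%N.
Proof.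
move=> uP Pz; have [_ _ _ /(_ z Pz) [k [x [uk <-]]]] := uP.
have [v u0] := lists_Some uP (leq0n k) uk; exists v; split=> //.
case: k uk => [|k] uk; first by move: uk; rewrite u0 => -[->].
by apply: ltnW; apply: lists_lt uP _ u0 uk.
Qed.

Lemma nearest_integer (R : realType) (theta : R) (a : int) :
  `|(Num.floor (theta + 2^-1))%:~R - theta| <= `|a%:~R - theta| /\
  `|(Num.floor (theta + 2^-1))%:~R - theta| <= 2^-1.
Proof.
set p := Num.floor _.
have p2 : `|p%:~R - theta| <= 2^-1.
  have /andP[h1 h2] := floor_itv (theta + 2^-1).
  by move: h2; rewrite -/p rmorphD /= ler_norml => h2; apply/andP; split; move: h1; rewrite -/p; lra.
split=> //.
have [->//|ap] := eqVneq a p.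
have : (1 : R) <= `|a%:~R - p%:~R|.
  rewrite -rmorphB /= -intr_norm ler1z -gtz0_ge1 normr_gt0 subr_eq0//.
have := ler_normD (a%:~R - theta) (theta - p%:~R).
rewrite addrA subrK [`|theta - _|]distrC; lra.
Qed.

Lemma nearest_best (R : realType) (theta : R) :
  best_approx theta (Num.floor (theta + 2^-1), 1%N).
Proof.
split=> //= a b.
  by move=> /andP[b0 b1]; lia.
move=> b1; rewrite mul1r.
have [->|->] : b = 1 \/ b = -1 by lia.
  by rewrite mul1r; have [] := nearest_integer theta a.
have [+ _] := nearest_integer theta (- a); rewrite rmorphN /= mulN1r opprK.
by rewrite -[`|a%:~R + _|]normrN opprD.
Qed.

Lemma first_best_approx (R : realType) (theta : R) u :
  lists (best_approx theta) u -> exists p : int,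
  [/\ u 0%N = Some (p, 1%N), `|p%:~R - theta| <= 2^-1 &
     `|p%:~R - theta| = `|(Num.floor (theta + 2^-1))%:~R - theta|].
Proof.
move=> uP; have [_ uB _ _] := uP.
have [[p q] [u0 /= q1]] := lists_nonempty uP (nearest_best theta).
have [q0 _ qmin] := uB _ _ u0; rewrite /= in q0 qmin.
have E : q = 1%N by lia.
subst q; exists p.
have [l1 l2] := nearest_integer theta p.
have h : `|p%:~R - theta| <= `|(Num.floor (theta + 2^-1))%:~R - theta|.
  by have := qmin (Num.floor (theta + 2^-1)) 1 isT; rewrite !mul1r.
split=> //; first exact: le_trans h l2.
by apply/eqP; rewrite eq_le h l1.
Qed.

(** The vector [(1, 0)] or [(-1, 0)], with the sign that makes its defect
    opposite to that of [v]; it plays the role of a vector of index [-1]. *)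
Definition unit_vector (R : realType) (theta : R) (v : int * nat) : int * nat :=
  (if 0 < defect theta v then -1 else 1, 0%N).

Lemma reduced_pair_unit (R : realType) (theta : R) (p : int) :
  `|p%:~R - theta| <= 2^-1 ->
  reduced_pair theta (unit_vector theta (p, 1%N)) (p, 1%N).
Proof.
rewrite /unit_vector => h; set e := if _ then _ else _.
have e1 : e = 1 \/ e = -1 by rewrite /e; case: ifP; [right|left].
split=> //=.
- by rewrite mulr0 subr0 mulr1; case: e1 => ->.
- rewrite {1}/defect /= mul0r subr0 /e; case: ltrP => H.
    by rewrite mulN1r oppr_le0 ltW.
  by rewrite mul1r.
- rewrite /defect /= mul1r mul0r subr0.
  suff -> : `|e%:~R : R| = 1 by apply: le_lt_trans h _; lra.
  by case: e1 => ->; rewrite ?normrN normr1.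
Qed.

Definition pred_vector (R : realType) (theta : R) (u : nat -> option (int * nat))
    (n : nat) (v : int * nat) : int * nat :=
  if n is m.+1 then odflt v (u m) else unit_vector theta v.

Lemma lists_reduced (R : realType) (theta : R) u n v :
  lists (best_approx theta) u -> u n = Some v ->
  reduced_pair theta (pred_vector theta u n v) v.
Proof.
move=> uP; have [_ uB ult _] := uP.
elim: n v => [|n IH] v un.
  have [p [u0 hp _]] := first_best_approx uP.
  by move: un; rewrite u0 => -[<-]; apply: reduced_pair_unit.
have [x ux] := lists_Some uP (leqnSn n) un.
rewrite /= ux /=.
have rx := IH x ux.
have [rx0 ->] := next_best_approx rx (uB _ _ ux) (uB _ _ un) (ult _ _ _ ux un)
  (lists_next uP ux un).
exact: reduced_pair_next.
Qed.

Lemma lists_succ (R : realType) (theta : R) u n v w :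
  lists (best_approx theta) u -> u n = Some v -> u n.+1 = Some w ->
  0 < `|defect theta v| /\ w = next_vector theta (pred_vector theta u n v) v.
Proof.
move=> uP uv uw; have [_ uB ult _] := uP.
exact: next_best_approx (lists_reduced uP uv) (uB _ _ uv) (uB _ _ uw)
  (ult _ _ _ uv uw) (lists_next uP uv uw).
Qed.

Lemma sqr_int_ge1 (R : realDomainType) (m : int) : m != 0 -> 1 <= (m%:~R : R) ^+ 2.
Proof.
move=> m0; rewrite -rmorphXn /= ler1z -gtz0_ge1.
by rewrite lt_neqAle sqr_ge0 andbT eq_sym sqrf_eq0.
Qed.

(** For rational [theta] the last vector has defect 0.  With
    [Delta = q ^+ 4] its norm [1 / q ^+ 2] is minimal, because
    the defects of vectors of smaller denominator are nonzero multiples of [1 / q]. *)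
Lemma hermite_defect0 (R : realType) (theta : R) (v : int * nat) :
  best_approx theta v -> defect theta v = 0 -> hermite_best_approx theta v.
Proof.
move=> [v0 vlt _]; rewrite -/(defect theta v) => r0; rewrite -/(defect theta v) r0 in vlt.
split; first by apply/eqP => e; move: v0; rewrite e.
have q0 : 0 < v.2%:R :> R by rewrite ltr0n.
have q1 : 1 <= v.2%:R :> R by rewrite ler1n.
exists (v.2%:R ^+ 4); first by rewrite exprn_gt0.
move=> a b ab.
rewrite -/(defect theta v) r0 expr0n /= add0r.
have -> : v.2%:R ^+ 2 / v.2%:R ^+ 4 = (v.2%:R ^+ 2)^-1 :> R.
  by rewrite -[4%N]/(2 + 2)%N exprD invfM mulrA mulfV ?mul1r// gt_eqF// exprn_gt0.
have qi : (v.2%:R ^+ 2)^-1 <= 1 :> R by rewrite invf_le1 ?exprn_gt0// expr_ge1// ltW.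
have [b0|b0] := eqVneq b 0.
  rewrite b0 mul0r subr0 expr0n mul0r addr0.
  apply: le_trans qi _.
  have a0 : a != 0 by apply: contra ab => /eqP ->; rewrite b0.
  exact: sqr_int_ge1.
have [bq|bq] := ltP `|b| v.2%:Z.
  apply: ler_wpDr; first by rewrite mulr_ge0 ?sqr_ge0// invr_ge0 exprn_ge0// ltW.
  have X0 : 0 < `|a%:~R - b%:~R * theta|.
    by move: (vlt a b); rewrite normr0 bq normr_gt0 b0 => /(_ isT).
  rewrite -div1r ler_pdivrMr ?exprn_gt0// -exprMn.
  have E : (a%:~R - b%:~R * theta) * v.2%:R = (a * v.2%:Z - b * v.1)%:~R.
    rewrite rmorphB !rmorphM /= -pmulrn mulrBl; congr (_ - _).
    rewrite -mulrA; congr (_ * _).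
    by move/eqP: r0; rewrite /defect subr_eq0 mulrC => /eqP.
  rewrite E; apply: sqr_int_ge1.
  rewrite -(@intr_eq0 R) -E; apply: mulf_neq0; last by rewrite gt_eqF.
  by rewrite -normr_gt0.
apply: ler_wpDl; first exact: sqr_ge0.
rewrite ler_pdivlMr ?exprn_gt0//.
rewrite -[4%N]/(2 + 2)%N exprD mulKf ?gt_eqF ?exprn_gt0//.
rewrite -[leRHS]ger0_norm ?sqr_ge0// normrX lerXn2r ?nnegrE//.
by rewrite -intr_norm pmulrn ler_int.
Qed.

(** Write the test of [hermite_reduced] for [v] with predecessor [u], and for
    [w = u + a v] with predecessor [v].  The first can fail only if [a = 1],
    since otherwise [2 r_v <= r_u].  If [a = 1], the failure of both tests
    contradicts [q_v r_w <= q_w r_v]. *)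
Lemma hermite_alternative (R : realType) (theta : R) u n v w :
  lists (best_approx theta) u -> u n = Some v -> u n.+1 = Some w ->
  hermite_best_approx theta v \/ hermite_best_approx theta w.
Proof.
move=> uP uv uw; have [_ uB _ _] := uP.
have [rv0 wE] := lists_succ uP uv uw.
have rw := lists_reduced uP uw; rewrite /= uv /= in rw.
have rv := lists_reduced uP uv; set z := pred_vector theta u n v in wE rv.
have [w0|w0] := eqVneq (defect theta w) 0.
  by right; apply: hermite_defect0 => //; apply: uB uw.
rewrite -normr_gt0 in w0.
have [/(hermite_reduced rv rv0)|Hv] := lerP (3 * (v.2%:R * `|defect theta v|))
  ((2 * z.2%:R + v.2%:R) * (2 * `|defect theta z| - `|defect theta v|)); first by left.
have [/(hermite_reduced rw w0)|Hw] := lerP (3 * (w.2%:R * `|defect theta w|))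
  ((2 * v.2%:R + w.2%:R) * (2 * `|defect theta v| - `|defect theta w|)); first by right.
exfalso.
have a0 := digit_gt0 rv rv0.
have := norm_defect_next rv rv0; rewrite -wE.
have := digit_bounds z rv0.
have : w.2 = (z.2 + Num.truncn (`|defect theta z| / `|defect theta v|) * v.2)%N.
  by rewrite wE.
have [_ _ lt_wv qvw q0] := rw; have [_ _ _ qzv qv0] := rv.
move: a0; set a := Num.truncn _ => a0 qE /andP[b1 b2].
set rV := `|defect theta v| in lt_wv rv0 Hv Hw b1 b2 *.
set rW := `|defect theta w| in lt_wv w0 Hw *.
set rZ := `|defect theta z| in Hv b1 b2 *.
move=> rE.
have : (v.2%:R : R) <= w.2%:R by rewrite ler_nat.
have : (0 : R) < v.2%:R by rewrite ltr0n.
have : (0 : R) <= z.2%:R by rewrite ler0n.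
have : w.2%:R = z.2%:R + a%:R * v.2%:R :> R by rewrite qE natrD natrM.
move: Hv Hw; move: (v.2%:R : R) (w.2%:R : R) (z.2%:R : R) => qv qw qz Hv Hw qwE qz0 qv_gt0 qvw'.
clearbody rV rW rZ a.
clear uP uB uv uw wE rw rv z qE qvw q0 qzv qv0.
have [a1|a2] := leqP a 1.
  have aE : a%:R = 1 :> R by have -> : a = 1%N by apply/eqP; rewrite eqn_leq a1 a0.
  rewrite aE !mul1r in qwE rE.
  have hz : rZ = rW + rV by rewrite rE subrK.
  have hq : qz = qw - qv by rewrite qwE addrK.
  have key : qv * rW <= qw * rV.
    by apply: ler_pM => //; exact: ltW.
  by rewrite hz hq in Hv; nra.
have a2' : 2 * rV <= rZ.
  by apply: le_trans b1; apply: ler_wpM2r; [exact: ltW|rewrite ler_nat].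
move: Hv; apply/negP; rewrite -leNgt.
apply: (@le_trans _ _ (qv * (2 * rZ - rV))).
  by rewrite mulrCA; apply: ler_wpM2l; lra.
by apply: ler_wpM2r; lra.
Qed.

(** * Conditional law of the tail given the past *)

Section measurability.
Variable R : realType.

(** Away from zero the inverse is [x / `|x| ^+ 2], a product with a real power,
    and this formula is also right at zero. *)
Lemma measurable_inv : measurable_fun [set: R] (@GRing.inv R).
Proof.
have -> : @GRing.inv R = (fun x => x * powR `|x| (- 2%:R)).
  apply/funext => x; rewrite powR_invn// -normrX ger0_norm ?sqr_ge0//.
  have [->|x0] := eqVneq x 0; first by rewrite invr0 mul0r.
  by rewrite expr2 invfM mulrA mulfV// mul1r.
apply: measurable_funM => //.
exact: (measurableT_comp (measurable_powR (- 2%:R))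
  (@normr_measurable R setT)).
Qed.

Lemma measurable_funV d (T : measurableType d) (D : set T) (f : T -> R) :
  measurable_fun D f -> measurable_fun D (fun x => (f x)^-1).
Proof. by move=> mf; exact: measurableT_comp measurable_inv mf. Qed.

Lemma measurable_truncn : measurable_fun [set: R] (fun x : R => (Num.truncn x)%:R : R).
Proof.
apply: nondecreasing_measurable => // x y xy.
by rewrite ler_nat; apply: le_truncn.
Qed.

End measurability.

(** The codomain is the alias of the real line that carries the structure of a
    measurable type, so that [affine b k] can be used to push measures forward. *)
Definition affine (R : realType) (b k : R) (v : R) : measurableTypeR R := b + k * v.

Section affine.
Variable R : realType.
Local Notation mu := (@lebesgue_measure R).

Lemma measurable_affine (b k : R) : measurable_fun [set: R] (affine b k).
Proof. by apply: measurable_funD => //; apply: mulrl_measurable. Qed.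

Definition affine_image (b k : R) : {measure set (measurableTypeR R) -> \bar R} :=
  measure_function_pushforward__canonical__measure_function_Measure mu
    (measurable_affine b k).

(** The measure [A |-> `|k| * mu (affine b k @^-1` A)] agrees with the Lebesgue
    measure on half-open intervals, hence everywhere. *)
Lemma lebesgue_affine (b k : R) (k0 : 0 < `|k|) (A : set R) : measurable A ->
  (mu A = `|k|%:E * mu (affine b k @^-1` A))%E.
Proof.
move=> mA.
have k0' := ltW k0.
transitivity (mscale (NngNum k0') (affine_image b k) A); last by [].
apply: lebesgue_measure_unique => //= _ [[p q]] /= _ <-.
rewrite /mscale/= /affine_image/= /pushforward.
have [pq|qp] := ltP p q; last first.
  rewrite set_itv_ge -?leNgt ?bnd_simp//.
  by rewrite preimage_set0 !measure0 mule0.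
have [kp|kn|kz] := ltgtP 0 k; last by move: k0; rewrite -kz normr0 ltxx.
- have -> : affine b k @^-1` `]p, q]%classic = `](p - b) / k, (q - b) / k]%classic.
    apply/seteqP; split=> v /=; rewrite !in_itv/= /affine;
    by rewrite ltr_pdivrMr// ler_pdivlMr// ltrBlDl lerBrDl mulrC.
  rewrite !lebesgue_measure_itv/= !lte_fin pq ltr_pM2r ?invr_gt0// ltrD2r pq.
  by rewrite -!EFinD -EFinM -mulrBl gtr0_norm// opprB addrA subrK mulrC divfK// gt_eqF.
- have -> : affine b k @^-1` `]p, q]%classic = `[(q - b) / k, (p - b) / k[%classic.
    apply/seteqP; split=> v /=; rewrite !in_itv/= /affine;
    by rewrite ler_ndivrMr// ltr_ndivlMr// ltrBlDl lerBrDl mulrC andbC.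
  rewrite !lebesgue_measure_itv/= !lte_fin pq ltr_nM2r ?invr_lt0// ltrD2r pq.
  rewrite -!EFinD -EFinM -mulrBl ltr0_norm// opprB addrA subrK mulrC mulrN.
  by rewrite divfK ?lt_eqF// opprB.
Qed.

Lemma ge0_integral_affine (b k : R) (D : set R) (f : R -> \bar R) : k != 0 ->
  measurable D -> measurable_fun D f -> (forall x, D x -> 0 <= f x)%E ->
  (\int[mu]_(x in D) f x =
   `|k|%:E * \int[mu]_(v in affine b k @^-1` D) f (affine b k v))%E.
Proof.
move=> kz mD mf f0.
have k0 : 0 < `|k| by rewrite normr_gt0.
have f0D : {in D, forall x, 0 <= f x}%E by move=> x; rewrite inE; apply: f0.
have <- := @ge0_integral_pushforward _ _ (measurableTypeR R) (measurableTypeR R) R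
  (affine b k) (measurable_affine b k) mu D f mD mf f0D.
rewrite -(@ge0_integral_mscale _ _ _ (affine_image b k) D mD (NngNum (ltW k0)) f mf f0).
apply: eq_measure_integral => A mA _.
exact: lebesgue_affine.
Qed.

Lemma negligible_affine (b k : R) (N : set R) : k != 0 ->
  mu.-negligible N -> mu.-negligible (affine b k @^-1` N).
Proof.
move=> kz [A [mA A0 NA]].
have k0 : 0 < `|k| by rewrite normr_gt0.
exists (affine b k @^-1` A); split.
- by rewrite -[X in measurable X]setTI; apply: measurable_affine.
- have := lebesgue_affine b k0 mA; rewrite A0 => /esym/eqP.
  by rewrite mule_eq0 eqe gt_eqF//= => /eqP.
- by move=> x /NA.
Qed.

End affine.

Section one_step.
Variable R : realType.
Local Notation mu := (@lebesgue_measure R).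

(** Quantile function of the law with density [(1 + x) / (1 + x * t) ^+ 2] on
    [`]0, 1[].  This is the law of the tail of a continued fraction, given that its
    past is [x]. *)
Definition quantile (x u : R) : R := u / (1 + x - x * u).
Definition branch (i : nat) (t : R) : R := (i.+1%:R + t)^-1.
(** Probability that the next digit is [i.+1] when the past is [x]. *)
Definition weight (i : nat) (x : R) : R :=
  (1 + x) / ((i.+1%:R + x) * (i.+2%:R + x)).
(** The quantile function at [cutpoint i x] is [1 / i.+1], so the
    intervals between cutpoints are the values of [u] with a given digit. *)
Definition cutpoint (i : nat) (x : R) : R := (1 + x) / (i.+1%:R + x).

(** Expectation of [F t] when [t] follows the law attached to [x].  Integrating
    the quantile function against the Lebesgue measure reduces every change of
    variables below to affine ones. *)
Definition expect (x : R) (F : R -> R) : \bar R :=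
  (\int[mu]_(u in `]0%R, 1%R[) (F (quantile x u))%:E)%E.

Lemma measurable_quantile x : measurable_fun [set: R] (quantile x).
Proof.
apply: measurable_funM => //.
apply: measurable_funV.
by apply: measurable_funB => //; apply: mulrl_measurable.
Qed.

Lemma measurable_branch i : measurable_fun [set: R] (branch i).
Proof.
apply: measurable_funV.
exact: measurable_funD.
Qed.

Lemma natSD_gt0 i (x : R) : 0 <= x -> 0 < i.+1%:R + x.
Proof. by move=> x0; rewrite ltr_wpDr. Qed.

(** After the digit [i.+1] is removed, the law attached to [x] becomes the law
    attached to [branch i x]: within the interval of cutpoints, quantiles
    correspond by an affine map. *)
Lemma quantile_branch i x v : 0 <= x <= 1 -> 0 < v < 1 ->
  quantile x (cutpoint i x - weight i x * v) = branch i (quantile (branch i x) v).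
Proof.
move=> /andP[x0 x1] /andP[v0 v1].
have h1 := natSD_gt0 i x0; have h2 := natSD_gt0 i.+1 x0.
have i0 : 0 <= i%:R :> R by [].
rewrite /quantile /branch /cutpoint /weight -[i.+2]addn1 -[i.+1]addn1 !natrD in h1 h2 *.
set a := i%:R in i0 h1 h2 *.
have d1 : a + 1 + 1 + x - v != 0 by rewrite gt_eqF//; lra.
have xv : 0 <= x * v by rewrite mulr_ge0// ltW.
have d2 : (a + 1) * (a + 1 + 1 + x) + x * v != 0.
  by rewrite gt_eqF// ltr_wpDr// mulr_gt0//; lra.
have d3 : 1 + x != 0 by rewrite gt_eqF//; lra.
have d4 : a + 1 + x != 0 by rewrite gt_eqF//; lra.
have d5 : a + 1 + 1 + x != 0 by rewrite gt_eqF//; lra.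
have -> : (1 + x) / (a + 1 + x) - (1 + x) / ((a + 1 + x) * (a + 1 + 1 + x)) * v =
  (1 + x) * (a + 1 + 1 + x - v) / ((a + 1 + x) * (a + 1 + 1 + x)).
  by field; rewrite d4 d5.
have -> : 1 + x - x * ((1 + x) * (a + 1 + 1 + x - v) / ((a + 1 + x) * (a + 1 + 1 + x))) =
  (1 + x) * ((a + 1) * (a + 1 + 1 + x) + x * v) / ((a + 1 + x) * (a + 1 + 1 + x)).
  by field; rewrite d4 d5.
have -> : v / (1 + (a + 1 + x)^-1 - (a + 1 + x)^-1 * v) =
    v * (a + 1 + x) / (a + 1 + 1 + x - v).
  have e : 1 + (a + 1 + x)^-1 - (a + 1 + x)^-1 * v =
    (a + 1 + 1 + x - v) / (a + 1 + x) by field.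
  by rewrite e invf_div mulrA.
have -> : a + 1 + v * (a + 1 + x) / (a + 1 + 1 + x - v) =
  ((a + 1) * (a + 1 + 1 + x) + x * v) / (a + 1 + 1 + x - v) by field.
by rewrite invf_div; field; rewrite d1 d2 d3 d4 d5.
Qed.

Lemma cutpointB i x : 0 <= x -> cutpoint i x - cutpoint i.+1 x = weight i x.
Proof.
move=> x0; have h1 := natSD_gt0 i x0; have h2 := natSD_gt0 i.+1 x0.
rewrite /cutpoint /weight -[i.+2]addn1 -[i.+1]addn1 !natrD in h1 h2 *.
by field; rewrite !gt_eqF.
Qed.

Lemma cutpoint0 x : 0 <= x -> cutpoint 0 x = 1.
Proof. by move=> x0; rewrite /cutpoint mulfV// gt_eqF// ltr_wpDr. Qed.

Lemma cutpoint_gt0 i x : 0 <= x -> 0 < cutpoint i x.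
Proof. by move=> x0; rewrite divr_gt0 ?natSD_gt0//; rewrite ltr_wpDr. Qed.

Lemma weight_gt0 i x : 0 <= x -> 0 < weight i x.
Proof.
by move=> x0; rewrite divr_gt0 ?mulr_gt0 ?natSD_gt0//; rewrite ltr_wpDr.
Qed.

Lemma weight_ge0 i x : 0 <= x -> 0 <= weight i x.
Proof. by move=> /(weight_gt0 i)/ltW. Qed.

Lemma branch01 i x : 0 <= x -> 0 <= branch i x <= 1.
Proof.
move=> x0; rewrite invr_ge0 (ltW (natSD_gt0 i x0))/= invf_le1 ?natSD_gt0//.
by rewrite ler_wpDr// ler1n.
Qed.

Lemma cutpoint_bigcup x : 0 <= x ->
  `]0, 1]%classic = \bigcup_i `](cutpoint i.+1 x), (cutpoint i x)]%classic.
Proof.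
move=> x0; have x1 : 0 < 1 + x by rewrite ltr_wpDr.
apply/seteqP; split=> u /=; rewrite in_itv/=.
  move=> /andP[u0 u1].
  pose y := (1 + x) / u - x.
  have y1 : 1 <= y by rewrite lerBrDr ler_pdivlMr// ler_piMr// ltW.
  have y0 : 0 <= y by apply: le_trans y1.
  have /andP[t1 t2] := truncn_itv y0.
  have : (0 < Num.truncn y)%N by rewrite truncn_gt0.
  move: t1 t2; case: (Num.truncn y) => // i t1 t2 _.
  exists i => //=; rewrite in_itv/= /cutpoint.
  rewrite (ltr_pdivrMr _ _ (natSD_gt0 i.+1 x0)) (ler_pdivlMr _ _ (natSD_gt0 i x0)).
  have c1 : (1 + x) / u < i.+2%:R + x by rewrite -ltrBlDr.
  have c2 : i.+1%:R + x <= (1 + x) / u by rewrite -lerBrDr.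
  by rewrite ltr_pdivrMr// in c1; rewrite ler_pdivlMr// in c2; rewrite ![u * _]mulrC c1 c2.
move=> [i _ /=]; rewrite !in_itv/= => /andP[u0 u1].
rewrite (lt_trans (cutpoint_gt0 i.+1 x0) u0)/= (le_trans u1)//.
by rewrite /cutpoint ler_pdivrMr ?natSD_gt0// mul1r lerD2r ler1n.
Qed.

Lemma cutpoint_trivIset x : 0 <= x ->
  trivIset setT (fun i => `](cutpoint i.+1 x), (cutpoint i x)]%classic).
Proof.
move=> x0; apply: ltn_trivIset => j i ij; apply/seteqP; split=> // u /= [].
rewrite !in_itv/= => /andP[u1 _] /andP[_ u2].
have : cutpoint j x <= cutpoint i.+1 x.
  apply: ler_wpM2l; first by rewrite addr_ge0.
  by rewrite lef_pV2 ?posrE ?natSD_gt0// lerD2r ler_nat.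
lra.
Qed.

(** The Markov property: the digit is drawn with the probabilities
    [weight i x], and what remains follows the law attached to the new past. *)
Lemma expect_one_step (x : R) (F : R -> R) : 0 <= x <= 1 -> measurable_fun setT F ->
  (forall t, 0 <= F t) ->
  (expect x F = \sum_(i <oo) (weight i x)%:E * expect (branch i x) (F \o branch i))%E.
Proof.
move=> x01 mF F0; have /andP[x0 x1] := x01.
have mFQ y : measurable_fun setT (fun u => (F (quantile y u))%:E).
  by apply/measurable_EFinP; exact: measurableT_comp mF (measurable_quantile y).
rewrite /expect integral_itv_bndo_bndc; last exact: measurable_funTS.
rewrite (cutpoint_bigcup x0) ge0_integral_bigcup//; last 3 first.
- exact: (measurable_funTS (mFQ x)).
- by move=> u _; rewrite lee_fin.
- exact: cutpoint_trivIset.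
apply: eq_eseriesr => i _.
rewrite -integral_itv_bndo_bndc; last exact: measurable_funTS.
have w0 := weight_gt0 i x0.
have wN0 : - weight i x != 0 by rewrite oppr_eq0 gt_eqF.
rewrite (@ge0_integral_affine R (cutpoint i x) (- weight i x))//; last 2 first.
- exact: measurable_funTS.
- by move=> u _; rewrite lee_fin.
rewrite normrN gtr0_norm//; congr (_ * _)%E.
have -> : affine (cutpoint i x) (- weight i x) @^-1` `](cutpoint i.+1 x), (cutpoint i x)[%classic =
    `]0, 1[%classic.
  apply/seteqP; split=> v /=; rewrite !in_itv/= /affine -(cutpointB i x0).
    by move: w0; rewrite -(cutpointB i x0); set a := cutpoint i x; set b := cutpoint i.+1 x; nra.
  by move: w0; rewrite -(cutpointB i x0); set a := cutpoint i x; set b := cutpoint i.+1 x; nra.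
apply: eq_integral => v; rewrite inE /= in_itv/= => v01.
congr (F _)%:E; rewrite /affine mulNr quantile_branch//.
Qed.

End one_step.

(** * Contraction of the transition operator *)

Section transfer.
Variable R : realType.

Lemma sum_weight N (x : R) : 0 <= x -> \sum_(i < N) weight i x = 1 - cutpoint N x.
Proof.
move=> x0; elim: N => [|N IH]; first by rewrite big_ord0 cutpoint0// subrr.
by rewrite big_ord_recr /= IH -cutpointB// addrA subrK.
Qed.

Lemma cutpoint_diff i (x y : R) : 0 <= x -> 0 <= y ->
  cutpoint i x - cutpoint i y = (x - y) * (i%:R / ((i.+1%:R + x) * (i.+1%:R + y))).
Proof.
move=> x0 y0; have := natSD_gt0 i x0; have := natSD_gt0 i y0.
rewrite /cutpoint -natr1; move: (i%:R : R) => a h1 h2.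
by field; rewrite (gt_eqF h1) (gt_eqF h2).
Qed.

Lemma abel_summation (e psi : nat -> R) N : e 0%N = 0 ->
  \sum_(i < N) (e i - e i.+1) * psi i =
  \sum_(i < N) e i.+1 * (psi i.+1 - psi i) - e N * psi N.
Proof.
move=> e0; elim: N => [|N IH]; first by rewrite !big_ord0 e0 mul0r subrr.
by rewrite !big_ord_recr /= IH; ring.
Qed.

(** The difference of two averages splits into the variation of [psi] and
    that of the weights.  The weights are differences of cutpoints, so a summation
    by parts moves the second variation onto the successive differences of [psi]; the
    last term is the boundary term. *)
Lemma weighted_sum_diff (psi : nat -> R -> R) (alpha beta : nat -> R) N (x y : R) :
  0 <= x <= 1 -> 0 <= y <= 1 ->
  (forall i, `|psi i x - psi i y| <= alpha i * `|x - y|) ->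
  (forall i, `|psi i.+1 y - psi i y| <= beta i) ->
  `|\sum_(i < N) weight i x * psi i x - \sum_(i < N) weight i y * psi i y| <=
  `|x - y| * (\sum_(i < N) (weight i x * alpha i + i.+1%:R / i.+2%:R ^+ 2 * beta i) +
              `|psi N y| / N.+1%:R).
Proof.
move=> /andP[x0 x1] /andP[y0 y1] ha hb.
pose e i := i%:R / ((i.+1%:R + x) * (i.+1%:R + y)).
have E : \sum_(i < N) weight i x * psi i x - \sum_(i < N) weight i y * psi i y =
   \sum_(i < N) weight i x * (psi i x - psi i y) +
   (x - y) * (\sum_(i < N) e i.+1 * (psi i.+1 y - psi i y) - e N * psi N y).
  rewrite -(abel_summation (fun i => psi i y)); last by rewrite /e mul0r.
  rewrite -sumrB mulr_sumr -big_split /=; apply: eq_bigr => i _.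
  have -> : (x - y) * ((e i - e i.+1) * psi i y) =
    ((x - y) * e i - (x - y) * e i.+1) * psi i y by ring.
  rewrite /e -(cutpoint_diff i x0 y0) -(cutpoint_diff i.+1 x0 y0).
  by rewrite -(cutpointB i x0) -(cutpointB i y0); ring.
have e_ge0 i : 0 <= e i.
  by apply: divr_ge0 => //; apply: mulr_ge0; rewrite addr_ge0.
have e_le i : e i <= i%:R / i.+1%:R ^+ 2.
  apply: ler_wpM2l => //; rewrite lef_pV2 ?posrE ?exprn_gt0//; last first.
    by rewrite mulr_gt0 ?natSD_gt0.
  by rewrite expr2; apply: ler_pM => //; rewrite lerDl.
have eN : e N <= N.+1%:R^-1.
  apply: le_trans (e_le N) _; rewrite expr2 invfM mulrA ler_piMl// ler_pdivrMr//.
  by rewrite mul1r ler_nat.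
rewrite E; apply: le_trans (ler_normD _ _) _.
rewrite big_split /= -[in leRHS]addrA [in leRHS]mulrDr; apply: lerD.
  apply: le_trans (ler_norm_sum _ _ _) _; rewrite mulr_sumr; apply: ler_sum => i _.
  rewrite normrM ger0_norm ?weight_ge0// mulrCA ler_wpM2l ?weight_ge0//.
  by rewrite mulrC.
rewrite normrM ler_wpM2l//; apply: le_trans (ler_normB _ _) _; apply: lerD.
  apply: le_trans (ler_norm_sum _ _ _) _; apply: ler_sum => i _.
  by rewrite normrM ger0_norm//; apply: ler_pM.
by rewrite normrM ger0_norm// mulrC ler_wpM2l.
Qed.

Definition lipschitz01 (L : R) (phi : R -> R) :=
  forall x y, 0 <= x <= 1 -> 0 <= y <= 1 -> `|phi x - phi y| <= L * `|x - y|.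

(** The transition operator of the Markov chain of pasts. *)
Definition transfer (phi : R -> R) (x : R) : R :=
  limn (series (fun i => weight i x * phi (branch i x))).

Lemma branchB i (x y : R) : 0 <= x -> 0 <= y ->
  `|branch i x - branch i y| = `|x - y| / ((i.+1%:R + x) * (i.+1%:R + y)).
Proof.
move=> x0 y0; have h1 := natSD_gt0 i x0; have h2 := natSD_gt0 i y0.
have -> : branch i x - branch i y = (y - x) / ((i.+1%:R + x) * (i.+1%:R + y)).
  rewrite /branch; move: h1 h2; move: (i.+1%:R : R) => a h1 h2.
  by field; rewrite (gt_eqF h1) (gt_eqF h2).
by rewrite normrM distrC normfV [`|_ * _|]gtr0_norm ?mulr_gt0.
Qed.

Lemma branch_succB i (y : R) : 0 <= y ->
  `|branch i.+1 y - branch i y| <= (i.+1%:R * i.+2%:R)^-1.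
Proof.
move=> y0; have h1 := natSD_gt0 i y0; have h2 := natSD_gt0 i.+1 y0.
have -> : branch i.+1 y - branch i y = - ((i.+1%:R + y) * (i.+2%:R + y))^-1.
  move: h1 h2; rewrite /branch -[i.+2]addn1 natrD; move: (i.+1%:R : R) => a h1 h2.
  by field; rewrite (gt_eqF h1) (gt_eqF h2).
rewrite normrN ger0_norm; last by rewrite invr_ge0 mulr_ge0 ?ltW.
rewrite lef_pV2 ?posrE ?mulr_gt0//.
by apply: ler_pM => //; rewrite lerDl.
Qed.

(** Bounds for the two parts of [weighted_sum_diff] relative to the Lipschitz
    constant; the sum telescopes, and its limit [15 / 16] is below one. *)
Lemma contraction_majorant N :
  \sum_(i < N) ((if (i == 0 :> nat) then 2^-1 else 3 / (8 * (i.+1%:R * i.+2%:R))) +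
     (i.+1%:R * i.+2%:R * i.+3%:R)^-1) <= 15 / 16 :> R.
Proof.
case: N => [|N]; first by rewrite big_ord0; lra.
suff -> : \sum_(i < N.+1) ((if (i == 0 :> nat) then 2^-1 else 3 / (8 * (i.+1%:R * i.+2%:R))) +
     (i.+1%:R * i.+2%:R * i.+3%:R)^-1) =
   15 / 16 - 3 / (8 * N.+2%:R) - (2 * N.+2%:R * N.+3%:R)^-1 :> R.
  rewrite -addrA -opprD lerBlDr lerDl addr_ge0// ?invr_ge0 ?divr_ge0//.
elim: N => [|N IH].
  by rewrite big_ord_recr big_ord0 /=; field.
rewrite big_ord_recr /= IH -[N.+4]addn1 -[N.+3]addn1 -[N.+2]addn1 !natrD -natr1.
have n0 : 0 <= N%:R :> R by [].
field; rewrite !gt_eqF//; lra.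
Qed.

Lemma transfer_diff L M (phi : R -> R) N x y : 0 <= L ->
  lipschitz01 L phi -> (forall t, 0 <= t <= 1 -> `|phi t| <= M) ->
  0 <= x <= 1 -> 0 <= y <= 1 ->
  `|\sum_(i < N) weight i x * phi (branch i x) -
    \sum_(i < N) weight i y * phi (branch i y)| <=
   15 / 16 * L * `|x - y| + M * `|x - y| / N.+1%:R.
Proof.
move=> L0 Lphi Mphi x01 y01; have /andP[x0 x1] := x01; have /andP[y0 y1] := y01.
have bx i : 0 <= branch i x <= 1 by exact: branch01.
have bY i : 0 <= branch i y <= 1 by exact: branch01.
pose alpha i := L / ((i.+1%:R + x) * (i.+1%:R + y)).
pose beta i := L / (i.+1%:R * i.+2%:R).
have ha i : `|phi (branch i x) - phi (branch i y)| <= alpha i * `|x - y|.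
  apply: le_trans (Lphi _ _ (bx i) (bY i)) _.
  by rewrite branchB// /alpha mulrA mulrAC.
have hb i : `|phi (branch i.+1 y) - phi (branch i y)| <= beta i.
  by apply: le_trans (Lphi _ _ (bY _) (bY _)) _; rewrite ler_wpM2l// branch_succB.
apply: le_trans (@weighted_sum_diff (fun i t => phi (branch i t)) alpha beta N x y x01 y01 ha hb) _.
rewrite [in leLHS]mulrDr; apply: lerD; last first.
  by rewrite [M * _]mulrC -mulrA ler_wpM2l// ler_wpM2r ?invr_ge0// Mphi.
rewrite mulrC; apply: ler_wpM2r => //.
apply: le_trans (ler_wpM2r L0 (contraction_majorant N)).
rewrite mulr_suml; apply: ler_sum => i _; rewrite mulrDl; apply: lerD.
  rewrite /alpha mulrCA [_ * L]mulrC; apply: ler_wpM2l => //.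
  have h1 := natSD_gt0 i x0; have h2 := natSD_gt0 i y0; have h3 := natSD_gt0 i.+1 x0.
  rewrite /weight -mulrA -invfM.
  rewrite ler_pdivrMr; last by rewrite !mulr_gt0.
  case: (i : nat) h1 h2 h3 => [|k] h1 h2 h3.
    rewrite eqxx -[1%:R]/(1:R) -[2%:R]/(1 + 1 : R) in h1 h2 h3 *.
    apply: (@le_trans _ _ ((1 + x) * (2^-1 * (2 * (1 * 1))))).
      by rewrite !mulr1 mulVf ?mulr1 ?pnatr_eq0.
    rewrite -mulrA [leRHS]mulrCA; apply: ler_wpM2l; first exact: ltW.
    apply: ler_wpM2l; first by rewrite invr_ge0.
    apply: ler_pM => //; first by lra.
    by apply: ler_pM => //; lra.
  rewrite (_ : (k.+1 == 0)%N = false)//.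
  have k2 : 2 <= k.+2%:R :> R by rewrite ler_nat.
  move: h1 h2 h3 k2; rewrite -[k.+3]addn1 natrD; move: (k.+2%:R : R) => a h1 h2 h3 k2.
  have sq : 8 * (1 + x) <= 3 * ((a + x) * (a + x)).
    have : (2 + x) * (2 + x) <= (a + x) * (a + x) by apply: ler_pM; lra.
    by nra.
  have YZ : a * (a + 1) <= (a + y) * (a + 1 + x) by apply: ler_pM; lra.
  rewrite mulrAC ler_pdivlMr; last by rewrite !mulr_gt0//; lra.
  have a0 : 0 <= a * (a + 1) by rewrite mulr_ge0; lra.
  have := ler_pM _ a0 sq YZ.
  have -> : 0 <= 8 * (1 + x) by lra.
  move=> /(_ isT); set A := (X in X <= _); set B := (X in _ <= X) => AB.
  set C := (X in X <= _); set D := (X in _ <= X).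
  have -> : C = A by rewrite /C /A; ring.
  by have -> : D = B by rewrite /D /B; ring.
rewrite /beta.
have -> : i.+1%:R / i.+2%:R ^+ 2 * (L / (i.+1%:R * i.+2%:R)) = (i.+2%:R ^+ 3)^-1 * L :> R.
  have : i.+1%:R != 0 :> R by rewrite pnatr_eq0.
  have : i.+2%:R != 0 :> R by rewrite pnatr_eq0.
  move: (i.+1%:R : R) (i.+2%:R : R) => a b a0 b0.
  by field; rewrite a0 b0.
apply: ler_wpM2r => //; rewrite lef_pV2 ?posrE ?exprn_gt0 ?mulr_gt0//.
rewrite -[i.+3]addn1 -[i.+2]addn1 -[i.+1]addn1 !natrD.
have : 0 <= i%:R :> R by [].
nra.
Qed.

Lemma nneseries_EFin (u : nat -> R) (B : R) : (forall i, 0 <= u i) ->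
  (forall N, \sum_(i < N) u i <= B) ->
  [/\ cvgn (series u), 0 <= limn (series u) <= B &
      (\sum_(i <oo) (u i)%:E = (limn (series u))%:E)%E].
Proof.
move=> u0 uB.
have nd : nondecreasing_seq (series u).
  by apply/nondecreasing_seqP => n; rewrite /series /= big_nat_recr//= lerDl.
have cv : cvgn (series u).
  apply: nondecreasing_is_cvgn => //; exists B => _ [n _ <-].
  by rewrite /series /= big_mkord.
split=> //.
- apply/andP; split.
    by apply: limr_ge => //; apply: nearW => n; rewrite /series /= sumr_ge0.
  by apply: limr_le => //; apply: nearW => n; rewrite /series /= big_mkord.
- rewrite -EFin_lim//; congr (limn _); apply/funext => n.
  by rewrite /series /= -sumEFin.
Qed.

Lemma transfer_spec M (phi : R -> R) x : (forall t, 0 <= t <= 1 -> 0 <= phi t <= M) ->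
  0 <= x <= 1 ->
  [/\ cvgn (series (fun i => weight i x * phi (branch i x))),
      0 <= transfer phi x <= M &
      (\sum_(i <oo) (weight i x)%:E * (phi (branch i x))%:E = (transfer phi x)%:E)%E].
Proof.
move=> phiM /andP[x0 x1].
have b01 i : 0 <= branch i x <= 1 by exact: branch01.
have M0 : 0 <= M by have /andP[] := phiM _ (b01 0%N); exact: le_trans.
have := @nneseries_EFin (fun i => weight i x * phi (branch i x)) M.
case.
- by move=> i; rewrite mulr_ge0 ?weight_ge0//; have /andP[] := phiM _ (b01 i).
- move=> N; apply: (@le_trans _ _ (\sum_(i < N) weight i x * M)).
    apply: ler_sum => i _; rewrite ler_wpM2l ?weight_ge0//.
    by have /andP[] := phiM _ (b01 i).
  rewrite -mulr_suml sum_weight// ler_piMl// lerBlDr lerDl.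
  exact/ltW/cutpoint_gt0.
- by move=> h1 h2 h3; split.
Qed.

Lemma limit_difference_le (a b : nat -> R) (c d : R) : 0 <= d ->
  cvgn (series a) -> cvgn (series b) ->
  (forall N, `|\sum_(i < N) a i - \sum_(i < N) b i| <= c + d / N.+1%:R) ->
  `|limn (series a) - limn (series b)| <= c.
Proof.
move=> d0 ca cb H.
have h1 : `|series a n - series b n| @[n --> \oo] --> `|limn (series a) - limn (series b)|.
  by apply: cvg_norm; apply: cvgB.
have h2 : c + d * harmonic n @[n --> \oo] --> c + d * 0.
  by apply: cvgD; [exact: cvg_cst|apply: cvgM; [exact: cvg_cst|exact: cvg_harmonic]].
rewrite mulr0 addr0 in h2.
apply: (ler_cvg_to h1 h2); apply: nearW => n.
by rewrite /series /= !big_mkord; apply: H.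
Qed.

(** All averages rest on this contraction: the transition operator flattens
    functions of the past at a geometric rate. *)
Lemma transfer_lipschitz L M (phi : R -> R) : 0 <= L ->
  lipschitz01 L phi -> (forall t, 0 <= t <= 1 -> 0 <= phi t <= M) ->
  lipschitz01 (15 / 16 * L) (transfer phi).
Proof.
move=> L0 Lphi phiM x y x01 y01.
have [cx _ _] := transfer_spec phiM x01; have [cy _ _] := transfer_spec phiM y01.
have M0 : 0 <= M by have /andP[] := phiM _ x01; exact: le_trans.
apply: (@limit_difference_le _ _ _ (M * `|x - y|)) => //; first by rewrite mulr_ge0.
move=> N; apply: transfer_diff => // t t01.
by have /andP[p0 pM] := phiM _ t01; rewrite ger0_norm.
Qed.

End transfer.

(** * Invariance of the Gauss measure *)

Section calculus.
Variable R : realType.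
Local Notation mu := (@lebesgue_measure R).

Lemma is_derive_continuous (F : R -> R) (x d : R) : is_derive x 1 F d ->
  {for x, continuous F}.
Proof.
by move=> [dF _]; apply: differentiable_continuous; rewrite -derivable1_diffP.
Qed.

Lemma is_derive_LRcontinuous (F f : R -> R) (a b : R) : a <= b ->
  (forall x, a <= x <= b -> is_derive x 1 F (f x)) ->
  derivable_oo_LRcontinuous F a b.
Proof.
move=> ab dF; split.
- move=> x; rewrite in_itv/= => /andP[ax xb].
  by have [] := dF x; rewrite ?ltW.
- by apply: cvg_at_right_filter; apply: (is_derive_continuous (dF a _)); rewrite lexx.
- by apply: cvg_at_left_filter; apply: (is_derive_continuous (dF b _)); rewrite lexx andbT.
Qed.

Lemma FTC2_is_derive (F f : R -> R) (a b : R) : a < b ->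
  {within `[a, b], continuous f} ->
  (forall x, a <= x <= b -> is_derive x 1 F (f x)) ->
  (\int[mu]_(x in `[a, b]) (f x)%:E = (F b)%:E - (F a)%:E)%E.
Proof.
move=> ab cf dF; apply: continuous_FTC2 => //.
  exact: is_derive_LRcontinuous (ltW ab) dF.
move=> x; rewrite in_itv/= => /andP[ax xb].
by rewrite derive1E; have [] := dF x; rewrite ?ltW.
Qed.

Lemma branch_derive i (x : R) : 0 < i.+1%:R + x ->
  is_derive x 1 (@branch R i) (- (i.+1%:R + x) ^- 2).
Proof.
move=> h.
have h0 : i.+1%:R + x != 0 by rewrite gt_eqF.
have d : is_derive x (1:R) (fun y : R => i.+1%:R + y) 1.
  rewrite -[X in is_derive _ _ _ X]add0r.
  exact: (@is_deriveD _ _ _ (cst (i.+1%:R : R)) id).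
have := @is_deriveV R (fun y : R => i.+1%:R + y) x 1 1 h0 d.
by rewrite /GRing.scale /= mulr1.
Qed.

Lemma lipschitz_within L (phi : R -> R) : lipschitz01 L phi ->
  {within `[0, 1], continuous phi}.
Proof.
move=> Lphi; apply/subspace_continuousP => x /= x01.
apply/cvgrPdist_le => e e0; rewrite near_withinE; near=> t => t01.
have L1 : 0 < `|L| + 1 by rewrite ltr_wpDl.
apply: le_trans (Lphi _ _ x01 t01) _.
apply: (@le_trans _ _ ((`|L| + 1) * `|x - t|)).
  by apply: ler_wpM2r => //; apply: le_trans (ler_norm L) _; rewrite lerDl.
rewrite mulrC -ler_pdivlMr//; apply: ltW; near: t.
by apply: (@nbhsx_ballx _ R x (e / (`|L| + 1))); rewrite divr_gt0.
Unshelve. all: by end_near. Qed.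

Definition gauss_density (y : R) : R := (1 + y)^-1.

Lemma gauss_density_continuous (y : R) : 0 <= y -> {for y, continuous gauss_density}.
Proof.
move=> y0; apply: (@is_derive_continuous _ _ (- (1 + y) ^- 2)).
by apply: (@branch_derive 0); rewrite ltr_wpDr.
Qed.

(** The Jacobian of the inverse branch turns the Gauss density into a
    weight, which is what makes the Gauss measure invariant. *)
Lemma gauss_branch i (x : R) : 0 <= x ->
  gauss_density (branch i x) * (i.+1%:R + x) ^- 2 = weight i x * gauss_density x.
Proof.
move=> x0; have h1 := natSD_gt0 i x0; have h2 := natSD_gt0 i.+1 x0.
rewrite /gauss_density /branch /weight.
move: h1 h2; rewrite -[i.+2]addn1 natrD; move: (i.+1%:R : R) => a h1 h2.
have h3 : 0 < 1 + x by rewrite ltr_wpDr.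
have h4 : 0 < 1 + a + x by lra.
have h5 : 0 < a + x + 1 by lra.
field; rewrite ?(gt_eqF h1) ?(gt_eqF h2) ?(gt_eqF h3) ?(gt_eqF h4) ?(gt_eqF h5)//.
Qed.

(** Cut [`]0, 1]] at the points [1 / i.+1] and substitute
    [y = branch i x] on each piece.  The function may be unbounded at 0, as the
    logarithm is; only continuity away from 0 is used. *)
Lemma gauss_invariance (phi : R -> R) :
  measurable_fun `](0:R), (1:R)] phi ->
  (forall y : R, 0 < y <= 1 -> 0 <= phi y) ->
  (forall e : R, 0 < e -> {within `[e, 1], continuous phi}) ->
  (\int[mu]_(y in `]0%R, 1%R]) (phi y * gauss_density y)%:E =
   \int[mu]_(x in `[0%R, 1%R])
     ((\sum_(i <oo) (weight i x)%:E * (phi (branch i x))%:E) * (gauss_density x)%:E))%E.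
Proof.
move=> mphi phi0 cphi.
have cb0 i : cutpoint i 0 = branch i 0 :> R.
  by rewrite /cutpoint /branch !addr0 div1r.
have cb1 i : cutpoint i.+1 0 = branch i 1 :> R.
  by rewrite cb0 /branch addr0 natr1.
have mgauss : measurable_fun [set: R] gauss_density.
  by apply: measurable_funV; apply: measurable_funD.
have mG : measurable_fun `](0:R), (1:R)] (fun y => phi y * gauss_density y).
  by apply: measurable_funM => //; exact: measurable_funTS.
have g0 (y : R) : 0 <= y -> 0 <= gauss_density y by move=> y0; rewrite invr_ge0 addr_ge0.
rewrite (cutpoint_bigcup (lexx 0)) ge0_integral_bigcup//; last 3 first.
- by rewrite -(cutpoint_bigcup (lexx 0)); apply/measurable_EFinP.
- move=> y; rewrite -(cutpoint_bigcup (lexx 0)) /= in_itv/= => /andP[y0 y1].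
  by rewrite lee_fin; apply: mulr_ge0; [apply: phi0; rewrite y0|exact: g0 (ltW y0)].
- exact: (cutpoint_trivIset (lexx 0)).
have mbr i : measurable_fun `[(0:R), (1:R)] (fun x => phi (branch i x)).
  apply: (measurable_comp _ _ mphi) => //.
    by move=> _ /= [x + <-]; rewrite !in_itv/= => /andP[x0 x1]; have /andP[_ ->] := branch01 i x0;
      rewrite invr_gt0 natSD_gt0.
  exact: measurable_funTS (measurable_branch i).
have b01 i (x : R) : 0 <= x -> 0 < branch i x <= 1.
  by move=> x0; have /andP[_ ->] := branch01 i x0; rewrite invr_gt0 natSD_gt0.
transitivity (\sum_(i <oo) \int[mu]_(x in `[0%R, 1%R])
   ((gauss_density x)%:E * ((weight i x)%:E * (phi (branch i x))%:E)))%E; last first.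
  rewrite -integral_nneseries//; last 2 first.
  - move=> i; apply/measurable_EFinP; apply: measurable_funM; first exact: measurable_funTS.
    apply: measurable_funM; last exact: mbr.
    apply: measurable_funTS.
    apply: measurable_funM; first exact: measurable_funD.
    by apply: measurable_funV; apply: measurable_funM; apply: measurable_funD.
  - move=> i x; rewrite /= in_itv/= => /andP[x0 x1].
    rewrite -!EFinM lee_fin; apply: mulr_ge0; first exact: g0.
    apply: mulr_ge0; first exact: weight_ge0.
    exact: (phi0 _ (b01 i x x0)).
  apply: eq_integral => x; rewrite inE/= in_itv/= => /andP[x0 x1].
  rewrite nneseriesZl 1?muleC// => i _.
  rewrite -!EFinM lee_fin; apply: mulr_ge0; first exact: weight_ge0.
  exact: (phi0 _ (b01 i x x0)).
apply: eq_eseriesr => i _; rewrite cb1 cb0.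
have b1_gt0 : 0 < branch i 1 :> R by have /andP[] := b01 i 1 ler01.
have b0_le1 : branch i 0 <= 1 :> R by have /andP[] := b01 i 0 (lexx 0).
rewrite integral_itv_obnd_cbnd; last first.
  apply/measurable_EFinP; apply: measurable_funS mG => //.
  by apply: subset_itv; rewrite bnd_simp// ltW.
have Dbr (x : R) : 0 <= x -> is_derive x 1 (@branch R i) (- (i.+1%:R + x) ^- 2).
  by move=> x0; apply: branch_derive; apply: natSD_gt0.
have cdbr (x : R) : 0 <= x -> {for x, continuous (derive1 (@branch R i))}.
  move=> x0.
  have cb : branch i y @[y --> x] --> branch i x := is_derive_continuous (Dbr x x0).
  have c2 : - (branch i y * branch i y) @[y --> x] --> - (branch i x * branch i x).
    exact: cvgN (cvgM cb cb).
  have near_eq : \forall y \near x, - (branch i y * branch i y) = (derive1 (@branch R i)) y.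
    near=> y; rewrite derive1E.
    have xy : ball x 1 y by near: y; exact: nbhsx_ballx.
    have y0 : 0 < i.+1%:R + y.
      move: xy; rewrite /ball /= => /ltr_normlP[_]; rewrite -natr1.
      by have : 0 <= i%:R :> R by []; lra.
    have [_ ->] := branch_derive y0.
    by rewrite /branch expr2 invfM.
  rewrite /prop_for /continuous_at -(nbhs_singleton near_eq).
  apply: cvg_trans c2; apply: near_eq_cvg; exact: near_eq.
rewrite (@integration_by_substitution_decreasing _ (@branch R i) (fun y => phi y * gauss_density y) 0 1)//.
- apply: eq_integral => x; rewrite inE/= in_itv/= => /andP[x0 x1].
  rewrite -!EFinM; congr (_%:E); rewrite /=.
  transitivity (phi (branch i x) * gauss_density (branch i x) *
    (- derive1 (@branch R i) x)); first by [].
  rewrite derive1E.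
  have [_ ->] := Dbr x x0.
  by rewrite opprK -mulrA gauss_branch//; ring.
- move=> x y; rewrite !in_itv/= => /andP[x0 x1] /andP[y0 y1] xy.
  by rewrite ltf_pV2 ?posrE ?natSD_gt0// ltrD2l.
- move=> x; rewrite in_itv/= => /andP[x0 _]; exact/cdbr/ltW.
- by apply/cvg_ex; exists ((derive1 (@branch R i)) 0); apply: cvg_at_right_filter; apply: cdbr.
- by apply/cvg_ex; exists ((derive1 (@branch R i)) 1); apply: cvg_at_left_filter; apply: cdbr.
- by apply: (is_derive_LRcontinuous ler01) => x /andP[x0 x1]; exact: Dbr.
- apply: (@continuous_subspaceW _ _ _ `[branch i 1, 1]).
    by apply: subset_itvl; rewrite bnd_simp.
  move=> y; apply: cvgM; first exact: cphi.
  move: y; apply: continuous_in_subspaceT => y; rewrite inE /= in_itv/= => /andP[y0 _].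
  by apply: gauss_density_continuous; apply: le_trans y0; exact: ltW.
Unshelve. all: by end_near. Qed.

End calculus.

(** * Convergence of the iterated means *)

Section iterates.
Variable R : realType.
Local Notation mu := (@lebesgue_measure R).

Lemma integral_gauss_density :
  (\int[mu]_(y in `]0%R, 1%R]) (gauss_density y)%:E = (ln 2)%:E)%E.
Proof.
have c : {within `[0, 1], continuous (@gauss_density R)}.
  apply: continuous_in_subspaceT => y; rewrite inE /= in_itv/= => /andP[y0 _].
  exact: gauss_density_continuous.
rewrite integral_itv_obnd_cbnd; last first.
  apply/measurable_EFinP/measurable_funTS/measurable_funV.
  exact: measurable_funD.
have dF (x : R) : 0 <= x <= 1 -> is_derive x 1 (fun y : R => ln (1 + y)) (gauss_density x).
  move=> /andP[x0 x1]; have h : 0 < 1 + x by rewrite ltr_wpDr.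
  have d : is_derive x (1:R) (fun y : R => 1 + y) 1.
    rewrite -[X in is_derive _ _ _ X]add0r.
    exact: (@is_deriveD _ _ _ (cst (1 : R)) id).
  have := @is_derive1_comp R (@ln R) (fun y => 1 + y) x _ _ (is_derive1_ln h) d.
  by rewrite mulr1.
by rewrite (FTC2_is_derive ltr01 c dF) addr0 ln1 sube0.
Qed.

Definition gauss_integral (phi : R -> R) : \bar R :=
  (\int[mu]_(y in `]0%R, 1%R]) (phi y * gauss_density y)%:E)%E.

Lemma lipschitz_measurable L (phi : R -> R) : lipschitz01 L phi ->
  measurable_fun `](0:R), (1:R)] phi.
Proof.
move=> Lphi; apply: (@measurable_funS _ _ _ _ `[(0:R), (1:R)]) => //.
  exact: subset_itv_oc_cc.
apply: subspace_continuous_measurable_fun => //.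
exact: lipschitz_within Lphi.
Qed.

(** A function with Lipschitz constant [L] on the unit interval is within [L] of
    its mean for the Gauss probability measure. *)
Lemma gauss_integral_near (phi : R -> R) (L c : R) :
  lipschitz01 L phi -> (forall t, 0 <= t <= 1 -> 0 <= phi t) -> 0 <= L ->
  gauss_integral phi = (c * ln 2)%:E ->
  forall x, 0 <= x <= 1 -> `|phi x - c| <= L.
Proof.
move=> Lphi phi0 L0 I x x01.
have ln2 : 0 < ln 2 :> R by rewrite ln_gt0// ltr1n.
have g0 (y : R) : 0 <= y -> 0 <= gauss_density y by move=> y0; rewrite invr_ge0 addr_ge0.
have mg D : measurable D -> measurable_fun D (@gauss_density R).
  by move=> _; apply/measurable_funTS/measurable_funV; exact: measurable_funD.
have mp := lipschitz_measurable Lphi.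
have cst_int (a : R) : 0 <= a ->
    (\int[mu]_(y in `]0%R, 1%R]) (a * gauss_density y)%:E = (a * ln 2)%:E)%E.
  move=> a0; under eq_integral do rewrite EFinM.
  rewrite ge0_integralZl//.
  - by rewrite integral_gauss_density.
  - by apply/measurable_EFinP; exact: mg.
  - by move=> y /=; rewrite in_itv/= => /andP[y0 _]; rewrite lee_fin g0// ltW.
have nn (y : R) : 0 < y -> y <= 1 -> (0 <= (phi y * gauss_density y)%:E)%E.
  by move=> y0 y1; rewrite lee_fin mulr_ge0 ?phi0 ?g0// ltW.
have dist (y : R) : 0 < y <= 1 -> `|phi x - phi y| <= L.
  move=> /andP[y0 y1]; apply: le_trans (Lphi x y x01 _) _; first by rewrite ltW.
  by rewrite ler_piMr// ler_norml; have /andP[x0 x1] := x01; apply/andP; split; lra.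
rewrite distrC ler_norml; apply/andP; split.
- suff : phi x <= c + L by lra.
  rewrite -(ler_pM2r ln2) mulrDl -lee_fin EFinD.
  rewrite -I -(cst_int L L0) -(cst_int (phi x))//; last exact: phi0.
  rewrite /gauss_integral -ge0_integralD//; last 4 first.
  + move=> y /=; rewrite in_itv/= => /andP[y0 y1].
    exact: nn.
  + by apply/measurable_EFinP; apply: measurable_funM => //; exact: mg.
  + by move=> y /=; rewrite in_itv/= => /andP[y0 y1]; rewrite lee_fin mulr_ge0 // g0// ltW.
  + by apply/measurable_EFinP; apply: measurable_funM => //; exact: mg.
  apply: ge0_le_integral => //.
  + move=> y /=; rewrite in_itv/= => /andP[y0 y1].
    by rewrite lee_fin; apply: mulr_ge0; [exact: phi0|apply: g0; exact: ltW].
  + by apply/measurable_EFinP; apply: measurable_funM => //; exact: mg.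
  + by apply/measurable_EFinP; apply: measurable_funD; apply: measurable_funM => //; exact: mg.
  + move=> y; rewrite /= in_itv/= => /andP[y0 y1].
    rewrite lee_fin -mulrDl ler_wpM2r ?(g0 _ (ltW y0))//.
    by have := dist y; rewrite y0 y1 => /(_ isT) /ler_normlP[_]; rewrite lerBlDl.
- suff : c <= L + phi x by lra.
  rewrite -(ler_pM2r ln2) -lee_fin -I.
  rewrite -(cst_int (L + phi x)); last by rewrite addr_ge0 ?phi0.
  apply: ge0_le_integral => //.
  + move=> y /=; rewrite in_itv/= => /andP[y0 y1].
    exact: nn.
  + by apply/measurable_EFinP; apply: measurable_funM => //; exact: mg.
  + by apply/measurable_EFinP; apply: measurable_funM => //; exact: mg.
  + move=> y; rewrite /= in_itv/= => /andP[y0 y1].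
    rewrite lee_fin ler_wpM2r ?(g0 _ (ltW y0))//.
    by have := dist y; rewrite y0 y1 => /(_ isT) /ler_normlP[+ _]; rewrite opprB lerBlDr.
Qed.

Lemma gauss_integral_transfer L M (phi : R -> R) : 0 <= L ->
  lipschitz01 L phi -> (forall t, 0 <= t <= 1 -> 0 <= phi t <= M) ->
  gauss_integral (transfer phi) = gauss_integral phi.
Proof.
move=> L0 Lphi phiM.
rewrite [RHS]/gauss_integral gauss_invariance; last 3 first.
- exact: lipschitz_measurable Lphi.
- by move=> y /andP[y0 y1]; have := phiM y; rewrite ltW// y1 => /(_ isT)/andP[].
- move=> e e0; apply: (@continuous_subspaceW _ _ _ `[(0:R), (1:R)]).
    by apply: subset_itvr; rewrite bnd_simp ltW.
  exact: lipschitz_within Lphi.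
have LU := transfer_lipschitz L0 Lphi phiM.
have mU := lipschitz_measurable LU.
rewrite /gauss_integral integral_itv_obnd_cbnd; last first.
  apply/measurable_EFinP; apply: measurable_funM => //.
  by apply/measurable_funTS/measurable_funV; exact: measurable_funD.
apply: eq_integral => x; rewrite inE /= in_itv/= => x01.
by have [_ _ ->] := transfer_spec phiM x01; rewrite EFinM.
Qed.

Definition iterate (g : R -> R) k := iter k (@transfer R) g.

Lemma iterate_spec L M (g : R -> R) k : 0 <= L ->
  lipschitz01 L g -> (forall t, 0 <= t <= 1 -> 0 <= g t <= M) ->
  [/\ lipschitz01 ((15 / 16) ^+ k * L) (iterate g k),
      (forall t, 0 <= t <= 1 -> 0 <= iterate g k t <= M) &
      gauss_integral (iterate g k) = gauss_integral g].
Proof.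
move=> L0 Lg gM; elim: k => [|k [IH1 IH2 IH3]]; first by rewrite expr0 mul1r.
have L0k : 0 <= (15 / 16) ^+ k * L by rewrite mulr_ge0// exprn_ge0//; lra.
split.
- by rewrite exprS -mulrA; apply: transfer_lipschitz IH1 IH2.
- by move=> t t01; have [_ + _] := transfer_spec IH2 t01.
- by rewrite -IH3; apply: gauss_integral_transfer L0k IH1 IH2.
Qed.

(** The k-th iterate is within [(15 / 16) ^+ k * L] of the mean [c]; sum the
    geometric series. *)
Lemma sum_iterate_near L M c (g : R -> R) n x : 0 <= L ->
  lipschitz01 L g -> (forall t, 0 <= t <= 1 -> 0 <= g t <= M) ->
  gauss_integral g = (c * ln 2)%:E -> 0 <= x <= 1 ->
  `|\sum_(k < n) iterate g k x - c * n%:R| <= 16 * L.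
Proof.
move=> L0 Lg gM I x01.
have -> : c * n%:R = \sum_(k < n) c by rewrite sumr_const card_ord mulr_natr.
rewrite -sumrB; apply: le_trans (ler_norm_sum _ _ _) _.
apply: (@le_trans _ _ (\sum_(k < n) (15 / 16) ^+ k * L)).
  apply: ler_sum => k _; have [h1 h2 h3] := iterate_spec k L0 Lg gM.
  apply: gauss_integral_near => //.
  - by move=> t /h2 /andP[].
  - by rewrite mulr_ge0// exprn_ge0//; lra.
  - by rewrite h3.
rewrite -mulr_suml ler_wpM2r//.
have : \sum_(k < n) (15 / 16 : R) ^+ k = 16 * (1 - (15 / 16) ^+ n).
  elim: n => [|n IH]; first by rewrite big_ord0 expr0 subrr mulr0.
  by rewrite big_ord_recr /= IH exprS; field.
move=> ->; have : 0 <= (15 / 16 : R) ^+ n by rewrite exprn_ge0//; lra.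
lra.
Qed.

End iterates.

(** * A strong law along squares *)

Section strong_law.
Variable R : realType.
Local Notation mu := (@lebesgue_measure R).

(** A nondecreasing sequence lies between its values at two consecutive squares,
    whose ratio tends to one. *)
Lemma cvg_along_squares (s : nat -> R) (c : R) :
  {homo s : m n / (m <= n)%N >-> m <= n} -> 0 <= s 0%N ->
  (s (k.+1 ^ 2)%N - c * (k.+1 ^ 2)%:R) / (k.+1 ^ 2)%:R @[k --> \oo] --> (0 : R) ->
  n%:R^-1 * s n @[n --> \oo] --> c.
Proof.
move=> s_homo s0 H.
have s_ge0 n : 0 <= s n by apply: le_trans s0 _; apply: s_homo.
pose r k : R := s (k.+1 ^ 2)%N / (k.+1 ^ 2)%:R.
have rc : r k @[k --> \oo] --> c.
  have : (s (k.+1 ^ 2)%N - c * (k.+1 ^ 2)%:R) / (k.+1 ^ 2)%:R + c @[k --> \oo] --> 0 + c.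
    by apply: cvgD => //; exact: cvg_cst.
  rewrite add0r; apply: cvg_trans; apply: near_eq_cvg; apply: nearW => k.
  by rewrite mulrBl mulfK ?subrK// pnatr_eq0 expn_eq0.
pose j n := (Num.truncn (Num.sqrt n%:R : R)).-1.
have j_spec n : (0 < n)%N -> ((j n).+1 ^ 2 <= n)%N /\ (n <= (j n).+2 ^ 2)%N.
  move=> n0; have sq0 : 0 <= Num.sqrt n%:R :> R by exact: sqrtr_ge0.
  have sq1 : 1 <= Num.sqrt n%:R :> R.
    by rewrite -[leLHS]sqrtr1; apply: ler_wsqrtr; rewrite ler1n.
  have : (0 < Num.truncn (Num.sqrt n%:R : R))%N by rewrite truncn_gt0.
  have /andP[t1 t2] := truncn_itv sq0.
  rewrite /j; case: (Num.truncn _) t1 t2 => // m t1 t2 _ /=.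
  rewrite -(ler_nat R) -(ler_nat R n) !natrX -[n%:R in leRHS]sqr_sqrtr//.
  rewrite -[n%:R in X in _ /\ X]sqr_sqrtr//.
  by split; rewrite lerXn2r ?nnegrE//; exact: ltW.
have j_oo : j n @[n --> \oo] --> \oo.
  move=> /= A [k _ kA]; exists (k.+2 ^ 2)%N => // n /= kn; apply: kA => /=.
  have n0 : (0 < n)%N by apply: leq_trans kn; rewrite expn_gt0.
  have [_ h] := j_spec n n0.
  by have := leq_trans kn h; rewrite leq_exp2r.
have ratio : (k.+2%:R / k.+1%:R : R) @[k --> \oo] --> (1 : R).
  have : (1 + harmonic k : R) @[k --> \oo] --> (1 + 0 : R).
    by apply: cvgD; [exact: cvg_cst|exact: cvg_harmonic].
  rewrite addr0; apply: cvg_trans; apply: near_eq_cvg; apply: nearW => k.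
  by rewrite /harmonic -[k.+2]addn1 natrD mulrDl mulfV ?pnatr_eq0// mul1r.
have ratioV : (k.+2%:R / k.+1%:R : R)^-1 @[k --> \oo] --> (1 : R)^-1.
  by apply: cvgV => //; exact: oner_neq0.
have low : r k * (k.+2%:R / k.+1%:R)^-1 ^+ 2 @[k --> \oo] --> c * (1^-1 * 1^-1).
  by apply: cvgM => //; exact: (cvgM ratioV ratioV).
have rcS : r k.+1 @[k --> \oo] --> c by rewrite (cvg_shiftS r).
have up : r k.+1 * (k.+2%:R / k.+1%:R) ^+ 2 @[k --> \oo] --> c * (1 * 1).
  by apply: cvgM => //; exact: (cvgM ratio ratio).
rewrite invr1 !mulr1 in low; rewrite !mulr1 in up.
apply: (@squeeze_cvgr _ _ _ _ (fun n => r (j n) * ((j n).+2%:R / (j n).+1%:R)^-1 ^+ 2)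
                     (fun n => r (j n).+1 * ((j n).+2%:R / (j n).+1%:R) ^+ 2)).
- near=> n; have n0 : (0 < n)%N by near: n; exists 1%N.
  have nR : 0 < n%:R :> R by rewrite ltr0n.
  have [h1 h2] := j_spec n n0; set k := j n in h1 h2 *.
  have k1 : 0 < k.+1%:R :> R by []. have k2 : 0 < k.+2%:R :> R by [].
  have -> : r k * (k.+2%:R / k.+1%:R)^-1 ^+ 2 = (k.+2%:R ^+ 2)^-1 * s (k.+1 ^ 2)%N.
    rewrite /r natrX; move: k1 k2; move: (k.+1%:R : R) (k.+2%:R : R) => a b a0 b0.
    by field; rewrite !gt_eqF.
  have -> : r k.+1 * (k.+2%:R / k.+1%:R) ^+ 2 = (k.+1%:R ^+ 2)^-1 * s (k.+2 ^ 2)%N.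
    rewrite /r natrX; move: k1 k2; move: (k.+1%:R : R) (k.+2%:R : R) => a b a0 b0.
    by field; rewrite !gt_eqF.
  apply/andP; split; apply: ler_pM; rewrite ?invr_ge0 ?exprn_ge0 ?s_ge0//.
  + by rewrite lef_pV2 ?posrE ?exprn_gt0// -natrX ler_nat.
  + exact: s_homo.
  + by rewrite lef_pV2 ?posrE ?exprn_gt0// -natrX ler_nat.
  + exact: s_homo.
- exact: (cvg_comp _ _ j_oo low).
- exact: (cvg_comp _ _ j_oo up).
Unshelve. all: by end_near. Qed.

Lemma sum_inv_square_le N : \sum_(i < N) (i.+2%:R ^+ 2)^-1 <= 1 :> R.
Proof.
apply: (@le_trans _ _ (1 - N.+1%:R^-1)); last by rewrite lerBlDr lerDl.
elim: N => [|N IH]; first by rewrite big_ord0 invr1 subrr.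
rewrite big_ord_recr /=; apply: le_trans (lerD IH (lexx _)) _.
have a0 : 0 < N.+1%:R :> R by [].
rewrite -[N.+2]addn1 natrD; move: (N.+1%:R : R) a0 => a a0.
have a1 : 0 < a + 1 by lra.
have : ((a + 1) ^+ 2)^-1 <= a^-1 - (a + 1)^-1.
  have -> : a^-1 - (a + 1)^-1 = (a * (a + 1))^-1 by field; rewrite !gt_eqF.
  by rewrite lef_pV2 ?posrE ?mulr_gt0 ?exprn_gt0//; nra.
lra.
Qed.

(** Along squares the variances of the averages are summable, so the series of
    squared deviations has a finite integral and is finite almost everywhere; its
    terms tend to 0 there, and monotonicity fills the gaps between squares. *)
Lemma strong_law (S : nat -> R -> R) (c D : R) :
  (forall n, measurable_fun setT (S n)) ->
  (forall u n, 0 < u < 1 -> S n u <= S n.+1 u) ->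
  (forall u, 0 < u < 1 -> 0 <= S 0%N u) ->
  (forall n, (\int[mu]_(u in `]0%R, 1%R[) ((S n u - c * n%:R) ^+ 2)%:E <= (D * n%:R)%:E)%E) ->
  {ae mu, forall u, 0 < u < 1 -> n%:R^-1 * S n u @[n --> \oo] --> c}.
Proof.
move=> mS S_homo S0 HD.
pose h m u : R := ((S (m.+1 ^ 2)%N u - c * (m.+1 ^ 2)%:R) / (m.+1 ^ 2)%:R) ^+ 2.
have D0 : 0 <= D.
  rewrite -lee_fin -[D]mulr1; apply: le_trans (HD 1%N).
  by apply: integral_ge0 => u _; rewrite lee_fin sqr_ge0.
have mh m : measurable_fun setT (h m).
  by apply: measurable_funX; apply: measurable_funM => //; apply: measurable_funB; [exact: mS|exact: measurable_cst].
have h_int m : (\int[mu]_(u in `]0%R, 1%R[) (h m u)%:E <= (D * (m.+1%:R ^+ 2)^-1)%:E)%E.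
  have -> : (\int[mu]_(u in `]0%R, 1%R[) (h m u)%:E =
     ((m.+1%:R ^+ 4)^-1)%:E * \int[mu]_(u in `]0%R, 1%R[) ((S (m.+1 ^ 2)%N u - c * (m.+1 ^ 2)%:R) ^+ 2)%:E)%E.
    rewrite -ge0_integralZl//; last 2 first.
    - apply/measurable_EFinP/measurable_funTS/measurable_funX.
      by apply: measurable_funB; [exact: mS|exact: measurable_cst].
    - by move=> u _; rewrite lee_fin sqr_ge0.
    apply: eq_integral => u _; rewrite -EFinM /h expr_div_n mulrC natrX -exprM.
    by [].
  apply: (@le_trans _ _ (((m.+1%:R ^+ 4)^-1)%:E * (D * (m.+1 ^ 2)%:R)%:E)%E).
    by apply: lee_wpmul2l; rewrite ?lee_fin ?invr_ge0 ?exprn_ge0.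
  rewrite -EFinM lee_fin natrX.
  have : m.+1%:R != 0 :> R by rewrite pnatr_eq0.
  move: (m.+1%:R : R) => a a0.
  by have -> : (a ^+ 4)^-1 * (D * a ^+ 2) = D * (a ^+ 2)^-1 by field.
have fin_sum : (\int[mu]_(u in `]0%R, 1%R[) (\sum_(m <oo) (h m u)%:E) < +oo)%E.
  rewrite integral_nneseries//; last 2 first.
  - by move=> m; apply/measurable_EFinP/measurable_funTS; exact: mh.
  - by move=> m u _; rewrite lee_fin sqr_ge0.
  apply: (@le_lt_trans _ _ (\sum_(m <oo) (D * (m.+1%:R ^+ 2)^-1)%:E)%E).
    apply: lee_nneseries => // m _ _.
    by apply: integral_ge0 => u _; rewrite lee_fin sqr_ge0.
  have [||_ /andP[_ b] ->] := @nneseries_EFin R (fun m => D * (m.+1%:R ^+ 2)^-1) (2 * D).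
  - by move=> m; rewrite mulr_ge0// invr_ge0 exprn_ge0.
  - move=> N; rewrite -mulr_sumr mulrC ler_wpM2r//.
    case: N => [|N]; first by rewrite big_ord0.
    by rewrite big_ord_recl /= expr1n invr1; have := sum_inv_square_le N; lra.
  - by rewrite ltry.
have : mu.-integrable `]0%R, 1%R[ (fun u => (\sum_(m <oo) (h m u)%:E)%E).
  apply/integrableP; split.
    apply: ge0_emeasurable_sum => [m u _ _|m _]; first by rewrite lee_fin sqr_ge0.
    by apply/measurable_EFinP/measurable_funTS; exact: mh.
  under eq_integral do (rewrite gee0_abs; last by apply: nneseries_ge0 => m _ _; rewrite lee_fin sqr_ge0).
  exact: fin_sum.
move=> /integrable_ae => /(_ (measurable_itv _)).
apply: filterS => u + u01; rewrite /= in_itv /= => /(_ u01) fin.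
apply: cvg_along_squares.
- by apply: homo_leq => //; [exact: le_trans|move=> n; exact: S_homo].
- exact: S0.
- have hu : cvgn (series (fun m => h m u)).
    apply: nondecreasing_is_cvgn.
      by apply/nondecreasing_seqP => n; rewrite /series /= big_nat_recr//= lerDl sqr_ge0.
    exists (fine (\sum_(m <oo) (h m u)%:E)%E) => _ [n _ <-].
    rewrite -lee_fin fineK// /series /= -sumEFin.
    by apply: nneseries_lim_ge => m _ _; rewrite lee_fin sqr_ge0.
  have h0 := cvg_series_cvg_0 hu.
  have : Num.sqrt (h k u) @[k --> \oo] --> Num.sqrt (0 : R).
    by apply: (cvg_comp _ _ h0); exact: sqrt_continuous.
  rewrite sqrtr0 => hs; apply/norm_cvg0P.
  by apply: cvg_trans hs; apply: near_eq_cvg; apply: nearW => k; rewrite /h sqrtr_sqr.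
Qed.

End strong_law.

(** * Averages along orbits of the natural extension *)

Section expectation.
Variable R : realType.
Local Notation mu := (@lebesgue_measure R).

Lemma quantile01 (x u : R) : 0 <= x <= 1 -> 0 < u < 1 -> 0 < quantile x u < 1.
Proof.
move=> /andP[x0 x1] /andP[u0 u1].
have h : 0 < 1 + x - x * u.
  by have : x * u <= x * 1 by [apply: ler_wpM2l => //; exact: ltW]; lra.
rewrite divr_gt0//= ltr_pdivrMr// mul1r.
have : 0 <= x * (1 - u) by apply: mulr_ge0; lra.
lra.
Qed.

Lemma expect_eq (x : R) (F G : R -> R) : 0 <= x <= 1 ->
  (forall t, 0 < t < 1 -> F t = G t) -> expect x F = expect x G.
Proof.
move=> x01 FG; apply: eq_integral => u; rewrite inE /= in_itv/= => u01.
by rewrite FG// quantile01.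
Qed.

Lemma expect_measurable (x : R) (F : R -> R) (D : set R) : measurable D ->
  measurable_fun setT F -> measurable_fun D (fun u => (F (quantile x u))%:E).
Proof.
move=> mD mF; apply/measurable_EFinP/measurable_funTS.
exact: measurableT_comp mF (measurable_quantile x).
Qed.

Lemma expect_ge0 (x : R) (F : R -> R) : (forall t, 0 <= F t) -> (0 <= expect x F)%E.
Proof. by move=> F0; apply: integral_ge0 => u _; rewrite lee_fin. Qed.

Lemma expectD (x : R) (F G : R -> R) : measurable_fun setT F -> measurable_fun setT G ->
  (forall t, 0 <= F t) -> (forall t, 0 <= G t) ->
  expect x (fun t => F t + G t) = (expect x F + expect x G)%E.
Proof.
move=> mF mG F0 G0; rewrite /expect -ge0_integralD//.
- by move=> u _; rewrite lee_fin.
- exact: expect_measurable.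
- by move=> u _; rewrite lee_fin.
- exact: expect_measurable.
Qed.

Lemma expectZ (x a : R) (F : R -> R) : measurable_fun setT F ->
  (forall t, 0 <= F t) -> 0 <= a ->
  expect x (fun t => a * F t) = (a%:E * expect x F)%E.
Proof.
move=> mF F0 a0; rewrite /expect -ge0_integralZl//.
- exact: expect_measurable.
- by move=> u _; rewrite lee_fin.
Qed.

Lemma expect_cst (x a : R) : expect x (fun=> a) = a%:E.
Proof.
rewrite /expect integral_cst//= lebesgue_measure_itv/= lte_fin ltr01.
by rewrite oppr0 adde0 mule1.
Qed.

Lemma expect_le (x : R) (F G : R -> R) : 0 <= x <= 1 ->
  measurable_fun setT F -> measurable_fun setT G ->
  (forall t, 0 <= F t) -> (forall t, 0 < t < 1 -> F t <= G t) ->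
  (expect x F <= expect x G)%E.
Proof.
move=> x01 mF mG F0 FG; apply: ge0_le_integral => //.
- by move=> u _; rewrite lee_fin.
- exact: expect_measurable.
- exact: expect_measurable.
- by move=> u; rewrite /= in_itv/= => u01; rewrite lee_fin FG// quantile01.
Qed.

End expectation.

Section dynamics.
Variable R : realType.

(** The maximum makes the digit positive for every real [t], so that orbit sums of
    nonnegative functions are nonnegative on the whole line. *)
Definition digit (t : R) : nat := maxn 1 (Num.truncn t^-1).
(** The pair of [past] and [gauss_map] is the natural extension of the Gauss map. *)
Definition past (x t : R) : R := ((digit t)%:R + x)^-1.
Definition gauss_map (t : R) : R := t^-1 - (digit t)%:R.

Fixpoint birkhoff (f : R -> R -> R) (n : nat) (x t : R) : R :=
  if n is m.+1 then f x t + birkhoff f m (past x t) (gauss_map t) else 0.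

Lemma digit_branch i (t : R) : 0 < t < 1 -> digit (branch i t) = i.+1.
Proof.
move=> /andP[t0 t1]; rewrite /digit /branch invrK.
rewrite (@truncn_def _ _ i.+1) ?(maxn_idPr _)//.
by rewrite lerDl ltW//= -[i.+2]addn1 natrD ltrD2l.
Qed.

Lemma past_branch i (x t : R) : 0 < t < 1 -> past x (branch i t) = branch i x.
Proof. by move=> t01; rewrite /past digit_branch. Qed.

Lemma gauss_map_branch i (t : R) : 0 < t < 1 -> gauss_map (branch i t) = t.
Proof. by move=> t01; rewrite /gauss_map digit_branch// /branch invrK addrAC subrr add0r. Qed.

Lemma past_ge0 (x t : R) : 0 <= x -> 0 <= past x t.
Proof. by move=> x0; rewrite invr_ge0 addr_ge0. Qed.

Lemma measurable_digit : measurable_fun [set: R] (fun t => (digit t)%:R : R).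
Proof.
have -> : (fun t => (digit t)%:R : R) = (fun t => Num.max 1 (Num.truncn t^-1)%:R).
  apply/funext => t; rewrite /digit; case: (leqP 1 (Num.truncn t^-1)) => h.
    by rewrite (max_idPr _)// ler1n.
  by rewrite (max_idPl _)// -[1]/(1%:R) ler_nat ltnW.
apply: measurable_maxr => //.
exact: measurableT_comp (@measurable_truncn R) (@measurable_inv R).
Qed.

Lemma measurable_birkhoff f n :
  measurable_fun [set: R * R] (fun z : R * R => f z.1 z.2) ->
  measurable_fun [set: R * R] (fun z : R * R => birkhoff f n z.1 z.2).
Proof.
move=> mf; elim: n => [|n IH] /=; first exact: measurable_cst.
apply: measurable_funD => //.
have m2 : measurable_fun [set: R * R] (fun z : R * R => (digit z.2)%:R : R).
  exact: measurableT_comp measurable_digit measurable_snd.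
have mP : measurable_fun [set: R * R] (fun z : R * R => past z.1 z.2).
  by apply: measurable_funV; apply: measurable_funD.
have mG : measurable_fun [set: R * R] (fun z : R * R => gauss_map z.2).
  by apply: measurable_funB => //; apply: measurable_funV.
exact: (measurableT_comp IH (measurable_fun_pair mP mG)).
Qed.

(** One step of the orbit under the expectation; the factor [J t], a function of the
    present, becomes a function of the future through the branch. *)
Lemma expect_step (x : R) (J : R -> R) (F : R -> R -> R) : 0 <= x <= 1 ->
  measurable_fun [set: R] J -> (forall t, 0 <= J t) ->
  measurable_fun [set: R * R] (fun z : R * R => F z.1 z.2) ->
  (forall y t, 0 <= y -> 0 <= F y t) ->
  (expect x (fun t => J t * F (past x t) (gauss_map t))%R =
   \sum_(i <oo) (weight i x)%:E *
     expect (branch i x) (fun t => J (branch i t) * F (branch i x) t)%R)%E.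
Proof.
move=> x01 mJ J0 mF F0; have /andP[x0 x1] := x01.
rewrite expect_one_step//; last 2 first.
- apply: measurable_funM => //.
  have mP : measurable_fun [set: R] (past x).
    by apply: measurable_funV; apply: measurable_funD => //; exact: measurable_digit.
  have mG : measurable_fun [set: R] gauss_map.
    by apply: measurable_funB; [exact: measurable_inv|exact: measurable_digit].
  exact: (measurableT_comp mF (measurable_fun_pair mP mG)).
- by move=> t; rewrite mulr_ge0// F0// past_ge0.
apply: eq_eseriesr => i _; congr (_ * _)%E.
apply: expect_eq; first exact: branch01.
by move=> t t01; rewrite /= past_branch// gauss_map_branch.
Qed.

End dynamics.

Lemma sum_weight_oo (R : realType) (x : R) : 0 <= x <= 1 ->
  (\sum_(i <oo) (weight i x)%:E = 1)%E.
Proof.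
move=> x01; have := expect_one_step x01 (measurable_cst (1 : R)) (fun=> ler01).
rewrite expect_cst => ->; apply: eq_eseriesr => i _.
by rewrite (_ : cst 1 \o branch i = fun=> 1)// expect_cst mule1.
Qed.

Section monotone.
Variable R : realType.

Definition monotone01 (J : R -> R) :=
  (forall s t, 0 <= s -> s <= t -> t <= 1 -> J s <= J t) \/
  (forall s t, 0 <= s -> s <= t -> t <= 1 -> J t <= J s).

Lemma branch_anti i (s t : R) : 0 <= s -> s <= t -> branch i t <= branch i s.
Proof.
move=> s0 st; have t0 := le_trans s0 st.
by rewrite /branch lef_pV2 ?posrE ?natSD_gt0// lerD2l.
Qed.

Lemma branch_between (J : R -> R) i t : monotone01 J -> 0 <= t <= 1 ->
  Num.min (J (branch i 0)) (J (branch i 1)) <= J (branch i t) <=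
  Num.max (J (branch i 0)) (J (branch i 1)).
Proof.
move=> mJ /andP[t0 t1].
have /andP[b0 b1] := branch01 i t0.
have /andP[_ b01] := branch01 i (lexx (0 : R)).
have /andP[b10 _] := branch01 i (ler01 : (0 : R) <= 1).
have h1 := branch_anti i (lexx 0) t0.
have h2 := branch_anti i t0 t1.
case: mJ => mJ.
- have a1 : J (branch i 1) <= J (branch i t) by exact: mJ.
  have a2 : J (branch i t) <= J (branch i 0) by exact: mJ.
  by rewrite ge_min le_max a1 a2 orbT.
- have a1 : J (branch i 0) <= J (branch i t) by exact: mJ.
  have a2 : J (branch i t) <= J (branch i 1) by exact: mJ.
  by rewrite ge_min le_max a1 a2 orbT.
Qed.

Lemma monotone01_branch (J : R -> R) i : monotone01 J -> monotone01 (J \o branch i).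
Proof.
move=> [mJ|mJ]; [right|left] => s t s0 st t1 /=; apply: mJ.
- by have /andP[] := branch01 i (le_trans s0 st).
- exact: branch_anti.
- by have /andP[] := branch01 i s0.
- by have /andP[] := branch01 i (le_trans s0 st).
- exact: branch_anti.
- by have /andP[] := branch01 i s0.
Qed.

(** The images of the unit interval under the branches are adjacent, so the
    oscillations of a monotone function over them add up to at most its total
    oscillation. *)
Lemma oscillation_sum (J : R -> R) o N : monotone01 J ->
  (forall t, 0 <= t <= 1 -> 0 <= J t <= o) ->
  \sum_(i < N) `|J (branch i 0) - J (branch i 1)| <= o.
Proof.
move=> mJ Jo.
have bS i : branch i 1 = branch i.+1 0 :> R by rewrite /branch addr0 natr1.
have b01 i : 0 <= branch i (0 : R) <= 1 by exact: branch01.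
have dec i : branch i.+1 (0 : R) <= branch i (0 : R) by rewrite -bS; apply: branch_anti.
have /andP[j0 j1] := Jo _ (b01 0%N); have /andP[k0 k1] := Jo _ (b01 N).
case: mJ => mJ.
- have -> : \sum_(i < N) `|J (branch i 0) - J (branch i 1)| = J (branch 0 0) - J (branch N 0).
    elim: N {k0 k1} => [|N IH]; first by rewrite big_ord0 subrr.
    rewrite big_ord_recr /= IH bS ger0_norm ?addrA ?subrK// subr_ge0.
    by have /andP[h1 h2] := b01 N; have /andP[h3 _] := b01 N.+1; exact: mJ.
  lra.
- have -> : \sum_(i < N) `|J (branch i 0) - J (branch i 1)| = J (branch N 0) - J (branch 0 0).
    elim: N {k0 k1} => [|N IH]; first by rewrite big_ord0 subrr.
    rewrite big_ord_recr /= IH bS ler0_norm; last first.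
      rewrite subr_le0.
      by have /andP[h1 h2] := b01 N; have /andP[h3 _] := b01 N.+1; exact: mJ.
    by rewrite opprB addrC addrA subrK.
  lra.
Qed.

Lemma weight_le_half i (x : R) : 0 <= x -> weight i x <= 2^-1.
Proof.
move=> x0; have h1 := natSD_gt0 i x0; have h2 := natSD_gt0 i.+1 x0.
rewrite /weight ler_pdivrMr ?mulr_gt0// mulrC ler_pdivlMr//.
apply: ler_pM; rewrite ?addr_ge0//.
- by rewrite lerD2r ler1n.
- by rewrite -[leLHS]addr0; apply: lerD => //; rewrite ler_nat.
Qed.

End monotone.

Section moments.
Variable R : realType.
Variables (f : R -> R -> R) (g : R -> R) (L M C c : R).
Hypothesis mf : measurable_fun [set: R * R] (fun z : R * R => f z.1 z.2).
Hypothesis f_ge0 : forall x t, 0 <= x -> 0 <= f x t.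
Hypothesis f_mean : forall x, 0 <= x <= 1 -> expect x (f x) = (g x)%:E.
Hypothesis f_sqr : forall x, 0 <= x <= 1 -> (expect x (fun t => f x t ^+ 2)%R <= C%:E)%E.
Hypothesis L_ge0 : 0 <= L.
Hypothesis g_lip : lipschitz01 L g.
Hypothesis g_bound : forall t, 0 <= t <= 1 -> 0 <= g t <= M.
Hypothesis g_int : gauss_integral g = (c * ln 2)%:E.
Hypothesis c_ge0 : 0 <= c.

Let S := birkhoff f.
Let A n x := \sum_(k < n) iterate g k x.

Lemma birkhoff_ge0 n x t : 0 <= x -> 0 <= S n x t.
Proof.
elim: n x t => [|n IH] x t x0 //=.
by rewrite addr_ge0 ?f_ge0 ?IH ?past_ge0.
Qed.

Let mfx x : measurable_fun [set: R] (f x).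
Proof. exact: (measurable_fun_pair2 x mf). Qed.

Lemma measurable_birkhoff_section n x : measurable_fun [set: R] (S n x).
Proof. exact: (measurable_fun_pair2 x (measurable_birkhoff n mf)). Qed.

Let mSs n x : measurable_fun [set: R] (fun t => S n (past x t) (gauss_map t)).
Proof.
have mP : measurable_fun [set: R] (past x).
  by apply: measurable_funV; apply: measurable_funD => //; exact: measurable_digit.
have mG : measurable_fun [set: R] (@gauss_map R).
  by apply: measurable_funB; [exact: measurable_inv|exact: measurable_digit].
exact: (measurableT_comp (measurable_birkhoff n mf) (measurable_fun_pair mP mG)).
Qed.

Lemma mean_sum_ge0 n x : 0 <= x <= 1 -> 0 <= A n x.
Proof.
move=> x01; apply: sumr_ge0 => k _.
by have [_ h _] := iterate_spec k L_ge0 g_lip g_bound; have /andP[] := h x x01.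
Qed.

Lemma mean_sum_near n x : 0 <= x <= 1 -> `|A n x - c * n%:R| <= 16 * L.
Proof. exact: sum_iterate_near L_ge0 g_lip g_bound g_int. Qed.

Lemma transfer_mean_sum n x : 0 <= x <= 1 ->
  (\sum_(i <oo) (weight i x)%:E * (A n (branch i x))%:E = (A n.+1 x - g x)%:E)%E.
Proof.
move=> x01; have /andP[x0 x1] := x01.
transitivity (\sum_(i <oo) \sum_(k < n) (weight i x)%:E * (iterate g k (branch i x))%:E)%E.
  apply: eq_eseriesr => i _; rewrite -EFinM mulr_sumr -sumEFin.
  by apply: eq_bigr => k _; rewrite EFinM.
rewrite nneseries_sum; last first.
  move=> k i _; rewrite -EFinM lee_fin mulr_ge0 ?weight_ge0//.
  by have [_ h _] := iterate_spec k L_ge0 g_lip g_bound; have /andP[] := h _ (branch01 i x0).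
rewrite /A big_ord_recl /= addrAC subrr add0r -sumEFin; apply: eq_bigr => k _.
have [_ h _] := iterate_spec k L_ge0 g_lip g_bound.
by have [_ _ ->] := transfer_spec h x01.
Qed.

(** The expectation of [f] after [k] steps is the k-th iterate of its mean [g]
    under the transition operator. *)
Lemma expect_birkhoff n x : 0 <= x <= 1 -> expect x (S n x) = (A n x)%:E.
Proof.
elim: n x => [|n IH] x x01; first by rewrite /A big_ord0 expect_cst.
have /andP[x0 x1] := x01.
rewrite /= expectD//; last 2 first.
- by move=> t; exact: (f_ge0 t x0).
- by move=> t; apply: birkhoff_ge0; exact: past_ge0.
rewrite f_mean//.
have -> : expect x (fun t => birkhoff f n (past x t) (gauss_map t)) =
    expect x (fun t => 1 * S n (past x t) (gauss_map t)).
  by apply: expect_eq => // t _; rewrite mul1r.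
rewrite (expect_step (F := S n) x01 (measurable_cst _))//; last 2 first.
- exact: measurable_birkhoff.
- by move=> y t y0; apply: birkhoff_ge0.
rewrite (eq_eseriesr (g := fun i => (weight i x)%:E * (A n (branch i x))%:E)%E); last first.
  move=> i _; rewrite -IH; last exact: branch01.
  by congr (_ * _)%E; apply: expect_eq => [|t _]; rewrite ?mul1r// branch01.
by rewrite transfer_mean_sum// -EFinD addrC subrK.
Qed.

Lemma mean_sum_le n x : 0 <= x <= 1 -> A n x <= c * n%:R + 16 * L.
Proof. by move=> x01; have /ler_normlP[_] := mean_sum_near n x01; rewrite lerBlDl. Qed.

Let K1 : R := 16 * L.
Let K2 : R := 2 * (1 + K1).

(** A monotone factor [J] of oscillation at most [o] is nearly uncorrelated
    with the orbit sums, with an error [o * K2] that does not depend on [n]. *)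
Definition correlation_bound n := forall (x : R) (J : R -> R) (o : R), 0 <= x <= 1 ->
  measurable_fun [set: R] J -> (forall t, 0 <= J t) -> monotone01 J ->
  (forall t, 0 <= t <= 1 -> J t <= o) ->
  (expect x (fun t => J t * S n x t)%R <=
     (c * n%:R)%:E * expect x J + (o * K2)%:E)%E.

(** Condition on the first digit.  On each branch, [J] is its minimum plus a
    monotone function of smaller oscillation: the minimum meets the mean of the orbit sum
    exactly, and the rest is handled by the bound for the branch.  Since
    each weight is at most one half and the oscillations add up to at most [o], the
    error [K2] is halved. *)
Lemma correlation_shift n : correlation_bound n ->
  forall (x : R) (J : R -> R) (o : R), 0 <= x <= 1 ->
  measurable_fun [set: R] J -> (forall t, 0 <= J t) -> monotone01 J ->
  (forall t, 0 <= t <= 1 -> J t <= o) ->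
  (expect x (fun t => J t * S n (past x t) (gauss_map t))%R <=
     (c * n%:R)%:E * expect x J + (o * (K1 + K2 / 2))%:E)%E.
Proof.
move=> Pn x J o x01 mJ J0 J_mono Jo; have /andP[x0 x1] := x01.
have K10 : 0 <= K1 by rewrite mulr_ge0.
have K20 : 0 <= K2 by rewrite mulr_ge0// addr_ge0.
have cn0 : 0 <= c * n%:R by rewrite mulr_ge0.
have o0 : 0 <= o by apply: le_trans (Jo 0 _); rewrite ?lexx ?ler01.
rewrite (expect_step (F := S n) x01 mJ J0 (measurable_birkhoff n mf) (birkhoff_ge0 n)).
pose m i := Num.min (J (branch i 0)) (J (branch i 1)).
pose os i := `|J (branch i 0) - J (branch i 1)|.
have m0 i : 0 <= m i by rewrite le_min !J0.
have mo i : m i <= o by rewrite ge_min Jo// branch01.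
have mJb i : measurable_fun [set: R] (J \o branch i).
  exact: measurableT_comp mJ (measurable_branch i).
have bound i : (expect (branch i x) (fun t => J (branch i t) * S n (branch i x) t)%R <=
    (c * n%:R)%:E * expect (branch i x) (J \o branch i) + (m i * K1 + os i * K2)%:E)%E.
  pose J' t := `|J (branch i t) - m i|.
  have mJ' : measurable_fun [set: R] J'.
    by apply: measurableT_comp => //; apply: measurable_funB => //; exact: mJb.
  have J'E t : 0 <= t <= 1 -> J' t = J (branch i t) - m i.
    move=> t01; rewrite /J' ger0_norm// subr_ge0.
    by have /andP[] := branch_between i J_mono t01.
  have b01 := branch01 i x0.
  have mSi := measurable_birkhoff_section n (branch i x).
  have Si0 t : 0 <= S n (branch i x) t by apply: birkhoff_ge0; have /andP[] := b01.
  have -> : expect (branch i x) (fun t => J (branch i t) * S n (branch i x) t) =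
     ((m i)%:E * (A n (branch i x))%:E + expect (branch i x) (fun t => J' t * S n (branch i x) t)%R)%E.
    rewrite -expect_birkhoff// -expectZ// -expectD//; last 4 first.
    - exact: measurable_funM.
    - exact: measurable_funM.
    - by move=> t; rewrite mulr_ge0.
    - by move=> t; rewrite mulr_ge0 ?normr_ge0.
    apply: expect_eq => // t /andP[t0 t1].
    by rewrite J'E ?ltW// -mulrDl addrC subrK.
  have -> : expect (branch i x) (J \o branch i) = ((m i)%:E + expect (branch i x) J')%E.
    rewrite -[in RHS](expect_cst (branch i x) (m i)) -expectD//; last first.
      by move=> t; exact: normr_ge0.
    apply: expect_eq => // t /andP[t0 t1].
    by rewrite J'E ?ltW//= addrC subrK.
  have J'mono : monotone01 J'.
    case: (monotone01_branch i J_mono) => H; [left|right] => s t s0 st t1.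
    - have s01 : 0 <= s <= 1 by rewrite s0 (le_trans st t1).
      have t01 : 0 <= t <= 1 by rewrite t1 (le_trans s0 st).
      by rewrite (J'E s s01) (J'E t t01) lerD2r; apply: H.
    - have s01 : 0 <= s <= 1 by rewrite s0 (le_trans st t1).
      have t01 : 0 <= t <= 1 by rewrite t1 (le_trans s0 st).
      by rewrite (J'E s s01) (J'E t t01) lerD2r; apply: H.
  have J'os t : 0 <= t <= 1 -> J' t <= os i.
    move=> t01; rewrite J'E// /os /m.
    have /andP[_] := branch_between i J_mono t01.
    by case: (leP (J (branch i 0)) (J (branch i 1))) => h1 h2;
      [rewrite ler0_norm|rewrite gtr0_norm]; lra.
  have := Pn (branch i x) J' (os i) b01 mJ' (fun t => normr_ge0 _) J'mono J'os.
  move=> /(leeD2l ((m i)%:E * (A n (branch i x))%:E)%E) /le_trans; apply.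
  have := mean_sum_le n b01; rewrite -/K1 => hA.
  have E'0 : (0 <= expect (branch i x) J')%E by apply: expect_ge0 => t; exact: normr_ge0.
  have E'1 : (expect (branch i x) J' <= (os i)%:E)%E.
    rewrite -(expect_cst (branch i x) (os i)); apply: expect_le => // t.
    - exact: normr_ge0.
    - by move=> /andP[t0 t1]; apply: J'os; rewrite !ltW.
  move: E'0 E'1; case: (expect (branch i x) J') => [e| |]// _ _.
  rewrite -EFinD -!EFinM -!EFinD lee_fin.
  have hm : m i * A n (branch i x) <= m i * (c * n%:R + K1) by apply: ler_wpM2l.
  by rewrite !mulrDr in hm *; rewrite [c * n%:R * m i]mulrC; lra.
have w0 i : (0 <= (weight i x)%:E)%E by rewrite lee_fin weight_ge0.
have EJ0 i : (0 <= expect (branch i x) (J \o branch i))%E.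
  by apply: expect_ge0 => t; exact: J0.
have r0 i : 0 <= m i * K1 + os i * K2 by rewrite addr_ge0// mulr_ge0// normr_ge0.
apply: (@le_trans _ _ (\sum_(i <oo) ((c * n%:R)%:E * ((weight i x)%:E *
     expect (branch i x) (J \o branch i)) + (weight i x * (m i * K1 + os i * K2))%:E))%E).
  apply: lee_nneseries => [i _ _|i _].
    apply: mule_ge0 => //; apply: expect_ge0 => t; apply: mulr_ge0 => //.
    by apply: birkhoff_ge0; have /andP[] := branch01 i x0.
  rewrite muleCA (EFinM (weight i x)) -ge0_muleDr ?mule_ge0 ?lee_fin//.
  exact: lee_wpmul2l (bound i).
rewrite nneseriesD//; last 2 first.
- by move=> i _ _; rewrite !mule_ge0// lee_fin.
- by move=> i _ _; rewrite lee_fin mulr_ge0// weight_ge0.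
rewrite nneseriesZl//; last by move=> i _; rewrite mule_ge0.
rewrite -(expect_one_step x01 mJ J0) leeD2l//.
have [||_ /andP[_ b] ->] := @nneseries_EFin R
    (fun i => weight i x * (m i * K1 + os i * K2)) (o * (K1 + K2 / 2)).
- by move=> i; rewrite mulr_ge0// weight_ge0.
- move=> N.
  apply: (@le_trans _ _ (\sum_(i < N) (weight i x * (o * K1) + 2^-1 * K2 * os i))).
    apply: ler_sum => i _; rewrite mulrDr; apply: lerD.
      by rewrite ler_wpM2l ?weight_ge0// ler_wpM2r.
    have -> : 2^-1 * K2 * os i = 2^-1 * (os i * K2) by ring.
    by apply: ler_wpM2r; [rewrite mulr_ge0// normr_ge0|exact: weight_le_half].
  rewrite big_split /= mulrDr; apply: lerD.
    rewrite -mulr_suml sum_weight//.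
    rewrite ler_piMl ?mulr_ge0// lerBlDr lerDl.
    exact/ltW/cutpoint_gt0.
  rewrite -mulr_sumr.
  have Jo' (t : R) : 0 <= t <= 1 -> 0 <= J t <= o by move=> t01; rewrite J0 Jo.
  have hos := oscillation_sum N J_mono Jo'; rewrite -/os in hos.
  have -> : o * (K2 / 2) = 2^-1 * K2 * o by ring.
  by rewrite ler_wpM2l// mulr_ge0.
- by rewrite lee_fin.
Qed.

Hypothesis f_le1 : forall x t, f x t <= 1.

(** Induction on [n]: the first term of the sum costs at most [o], and
    [K2 = 1 + (K1 + K2 / 2)] closes the induction. *)
Lemma correlation n : correlation_bound n.
Proof.
have K10 : 0 <= K1 by rewrite mulr_ge0.
elim: n => [|n IH] x J o x01 mJ J0 J_mono Jo.
  have -> : expect x (fun t => J t * S 0 x t) = 0%E.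
    transitivity (expect x (fun=> 0)); last exact: expect_cst.
    by apply: expect_eq => // t _; rewrite mulr0.
  rewrite adde_ge0//; last first.
    by rewrite lee_fin mulr_ge0 ?mulr_ge0 ?addr_ge0//; apply: le_trans (Jo 0 _); rewrite ?lexx ?ler01.
  by rewrite mulr0 mul0e.
have /andP[x0 x1] := x01.
have -> : expect x (fun t => J t * S n.+1 x t) =
   (expect x (fun t => J t * f x t)%R + expect x (fun t => J t * S n (past x t) (gauss_map t))%R)%E.
  rewrite -expectD//; last 4 first.
  - exact: measurable_funM.
  - exact: measurable_funM.
  - by move=> t; rewrite mulr_ge0// f_ge0.
  - by move=> t; rewrite mulr_ge0// birkhoff_ge0// past_ge0.
  by apply: expect_eq => // t _; rewrite -mulrDr.
have h1 : (expect x (fun t => J t * f x t)%R <= o%:E)%E.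
  rewrite -(expect_cst x o); apply: expect_le => //.
  - exact: measurable_funM.
  - by move=> t; rewrite mulr_ge0// f_ge0.
  - move=> t /andP[t0 t1]; apply: (@le_trans _ _ (J t * 1)).
      by apply: ler_wpM2l.
    by rewrite mulr1; apply: Jo; rewrite !ltW.
have h2 := correlation_shift IH x01 mJ J0 J_mono Jo.
have EJ0 : (0 <= expect x J)%E by apply: expect_ge0.
have EJ1 : (expect x J <= o%:E)%E.
  rewrite -(expect_cst x o); apply: expect_le => //.
  by move=> t /andP[t0 t1]; apply: Jo; rewrite !ltW.
apply: le_trans (leeD h1 h2) _.
move: EJ0 EJ1; case: (expect x J) => [e| |]//; rewrite -!EFinM -!EFinD !lee_fin => e0 _.
have -> : o * K2 = o + o * (K1 + K2 / 2) by rewrite /K2; field.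
suff : c * n%:R * e <= c * n.+1%:R * e by lra.
by apply: ler_wpM2r => //; apply: ler_wpM2l => //; rewrite ler_nat.
Qed.

(** Expand the square of [f + S_n] and use the Markov property for the last square.
    Stated with [A n x] on the right, which is [c * n] up to a constant, the bound
    propagates from one [n] to the next with an error that is constant, and the
    variance grows at most linearly. *)
Lemma second_moment (K : R) : 0 <= K -> 0 <= C ->
  (forall n x, 0 <= x <= 1 ->
    (expect x (fun t => f x t * S n (past x t) (gauss_map t))%R <=
      (c * n%:R * g x + K)%:E)%E) ->
  exists2 D, 0 <= D & forall n x, 0 <= x <= 1 ->
    (expect x (fun t => S n x t ^+ 2)%R + ((c * n%:R) ^+ 2)%:E <=
      (2 * (c * n%:R) * A n x + D * n%:R)%:E)%E.
Proof.
move=> K0 C0 HK; pose D := C + 2 * K + 32 * (c * L).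
have D0 : 0 <= D by rewrite !addr_ge0 ?mulr_ge0.
exists D => //; elim=> [|n IH] x x01.
  have -> : expect x (fun t => S 0 x t ^+ 2) = 0%E.
    transitivity (expect x (fun=> 0)); last exact: expect_cst.
    apply: expect_eq => // t _.
    by rewrite /S /= expr0n.
  by rewrite add0e mulr0 expr0n /= !mulr0 mul0r addr0.
have /andP[x0 x1] := x01.
set SP := fun t => S n (past x t) (gauss_map t).
have SP0 t : 0 <= SP t by apply: birkhoff_ge0; apply: past_ge0.
have mSP : measurable_fun [set: R] SP by exact: mSs.
have fx0 t : 0 <= f x t by apply: f_ge0.
have -> : expect x (fun t => S n.+1 x t ^+ 2) =
    (expect x (fun t => f x t ^+ 2)%R +
    (2%:E * expect x (fun t => f x t * SP t)%R + expect x (fun t => SP t ^+ 2)%R))%E.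
  rewrite -expectZ//; last 2 first.
  - exact: measurable_funM.
  - by move=> t; rewrite mulr_ge0.
  rewrite -expectD//; last 4 first.
  - by apply: measurable_funM => //; apply: measurable_funM.
  - exact: measurable_funX.
  - by move=> t; rewrite !mulr_ge0.
  - by move=> t; rewrite sqr_ge0.
  rewrite -expectD//; last 4 first.
  - exact: measurable_funX.
  - apply: measurable_funD; last exact: measurable_funX.
    by apply: measurable_funM => //; apply: measurable_funM.
  - by move=> t; rewrite sqr_ge0.
  - by move=> t; rewrite addr_ge0 ?sqr_ge0// !mulr_ge0.
  by apply: expect_eq => // t _; rewrite (_ : S n.+1 x t = f x t + SP t)//; ring.
have Q : (expect x (fun t => SP t ^+ 2)%R + ((c * n%:R) ^+ 2)%:E <=
    (2 * (c * n%:R) * (A n.+1 x - g x) + D * n%:R)%:E)%E.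
  rewrite -(expect_cst x ((c * n%:R) ^+ 2)) -expectD//; last 3 first.
  - exact: measurable_funX.
  - by move=> t; rewrite sqr_ge0.
  - by move=> t; rewrite sqr_ge0.
  pose F y t := S n y t ^+ 2 + (c * n%:R) ^+ 2.
  have -> : expect x (fun t => SP t ^+ 2 + (c * n%:R) ^+ 2) =
      expect x (fun t => 1 * F (past x t) (gauss_map t)).
    by apply: expect_eq => // t _; rewrite mul1r.
  rewrite (expect_step (F := F) x01 (measurable_cst _))//; last 2 first.
  - apply: measurable_funD => //; apply: measurable_funX; exact: measurable_birkhoff.
  - by move=> y t y0; rewrite addr_ge0 ?sqr_ge0.
  apply: (@le_trans _ _ (\sum_(i <oo) ((2 * (c * n%:R))%:E * ((weight i x)%:E * (A n (branch i x))%:E) +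
     (D * n%:R)%:E * (weight i x)%:E))%E).
    apply: lee_nneseries => [i _ _|i _].
      rewrite mule_ge0 ?lee_fin ?weight_ge0//; apply: expect_ge0 => t.
      by rewrite mul1r addr_ge0 ?sqr_ge0.
    have b01 := branch01 i x0.
    rewrite -!EFinM -EFinD.
    have -> : 2 * (c * n%:R) * (weight i x * A n (branch i x)) + D * n%:R * weight i x =
      weight i x * (2 * (c * n%:R) * A n (branch i x) + D * n%:R) by ring.
    rewrite (EFinM (weight i x)).
    apply: (@lee_wpmul2l _ (weight i x)%:E); first by rewrite lee_fin weight_ge0.
    apply: le_trans (IH _ b01).
    rewrite -(expect_cst (branch i x) ((c * n%:R) ^+ 2)) -expectD//; last 3 first.
    - by apply: measurable_funX; exact: measurable_birkhoff_section.
    - by move=> t; rewrite sqr_ge0.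
    - by move=> t; rewrite sqr_ge0.
    by rewrite (expect_eq (G := F (branch i x)))// => t _; rewrite mul1r.
  have w0 i : (0 <= (weight i x)%:E)%E by rewrite lee_fin weight_ge0.
  have A0 i : (0 <= (weight i x)%:E * (A n (branch i x))%:E)%E.
    by rewrite mule_ge0// lee_fin mean_sum_ge0// branch01.
  rewrite nneseriesD//; last 2 first.
  - by move=> i _ _; rewrite mule_ge0// lee_fin !mulr_ge0.
  - by move=> i _ _; rewrite mule_ge0// lee_fin mulr_ge0.
  rewrite nneseriesZl// nneseriesZl// transfer_mean_sum// sum_weight_oo// mule1.
  by rewrite -EFinM -EFinD.
have P1 := f_sqr x01; have P2 := HK n x x01; rewrite -/SP in P2.
have An := mean_sum_near n.+1 x01.
move: P1 P2 Q.
have e1 : (0 <= expect x (fun t => f x t ^+ 2)%R)%E by apply: expect_ge0 => t; exact: sqr_ge0.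
have e2 : (0 <= expect x (fun t => f x t * SP t)%R)%E.
  by apply: expect_ge0 => t; exact: mulr_ge0.
have e3 : (0 <= expect x (fun t => SP t ^+ 2)%R)%E by apply: expect_ge0 => t; exact: sqr_ge0.
move: e1 e2 e3.
case: (expect x (fun t => f x t ^+ 2)%R) => [E1| |]//.
case: (expect x (fun t => f x t * SP t)%R) => [E2| |]//.
case: (expect x (fun t => SP t ^+ 2)%R) => [E3| |]//.
rewrite -!EFinM -!EFinD !lee_fin => _ _ _ P1 P2 Q.
have nE : n.+1%:R = n%:R + 1 :> R by rewrite -natr1.
move: An => /ler_normlP[An _]; rewrite nE in An *.
move: An Q; rewrite /D; move: (A n.+1 x) (n%:R : R) (g x) P2 => An1 N G P2 An Q.
have H : c * (c * (N + 1) - An1) <= c * (16 * L).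
  by rewrite ler_wpM2l//; lra.
have -> : c * (N + 1) = c * N + c by rewrite mulrDr mulr1.
have -> : (c * N + c) ^+ 2 = (c * N) ^+ 2 + 2 * c * (c * N) + c ^+ 2 by ring.
have c2 : 0 <= c ^+ 2 by exact: sqr_ge0.
have H' : 2 * (c * (c * N)) + 2 * c ^+ 2 <= 2 * (c * An1) + 32 * (c * L).
  have e1 : c * (c * (N + 1) - An1) = c * (c * N) + c ^+ 2 - c * An1 by ring.
  have e2 : c * (16 * L) = 16 * (c * L) by ring.
  by rewrite e1 e2 in H; lra.
have -> : 2 * (c * N + c) * An1 = 2 * (c * N) * An1 + 2 * (c * An1) by ring.
have e3 : 2 * c * (c * N) = 2 * (c * (c * N)) by ring.
have e4 : 2 * (c * N) * (An1 - G) = 2 * (c * N) * An1 - 2 * (c * N * G) by ring.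
rewrite e4 in Q; rewrite e3; lra.
Qed.

Local Notation mu := (@lebesgue_measure R).

(** For the past [0] the law is the Lebesgue measure on the unit interval, so
    the variance bound feeds the strong law. *)
Lemma birkhoff_average (K : R) : 0 <= K -> 0 <= C ->
  (forall n x, 0 <= x <= 1 ->
    (expect x (fun t => f x t * S n (past x t) (gauss_map t))%R <=
      (c * n%:R * g x + K)%:E)%E) ->
  {ae mu, forall u, 0 < u < 1 -> n%:R^-1 * S n 0 u @[n --> \oo] --> c}.
Proof.
move=> K0 C0 HK; have [D D0 HD] := second_moment K0 C0 HK.
have z01 : 0 <= (0 : R) <= 1 by rewrite lexx ler01.
apply: (@strong_law _ (fun n => S n 0) c D).
- by move=> n; exact: measurable_birkhoff_section.
- suff H n x t : 0 <= x -> S n x t <= S n.+1 x t by move=> u n _; exact: H.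
  elim: n x t => [|n IH] x t x0; first by rewrite /S /= addr0 f_ge0.
  by rewrite [S n.+1]/(birkhoff f n.+1) [S n.+2]/(birkhoff f n.+2) /= lerD2l IH// past_ge0.
- by move=> u _.
- move=> n.
  have -> : (\int[mu]_(u in `]0%R, 1%R[) ((S n 0 u - c * n%:R) ^+ 2)%:E)%E =
      expect 0 (fun t => (S n 0 t - c * n%:R) ^+ 2).
    apply: eq_integral => u _; congr (((S n 0 _ - _) ^+ 2)%:E).
    by rewrite /quantile addr0 mul0r subr0 divr1.
  have mS := measurable_birkhoff_section n 0.
  have S0 t : 0 <= S n 0 t by exact: birkhoff_ge0.
  have cn0 : 0 <= 2 * (c * n%:R) by rewrite !mulr_ge0.
  have E : (expect 0 (fun t => (S n 0 t - c * n%:R) ^+ 2)%R +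
      (2 * (c * n%:R))%:E * expect 0 (S n 0) =
      expect 0 (fun t => S n 0 t ^+ 2)%R + ((c * n%:R) ^+ 2)%:E)%E.
    rewrite -(expect_cst 0 ((c * n%:R) ^+ 2)) -expectZ// -!expectD//.
    - by apply: expect_eq => // t _; ring.
    - exact: measurable_funX.
    - by move=> t; exact: sqr_ge0.
    - by move=> t; exact: sqr_ge0.
    - by apply: measurable_funX; apply: measurable_funB.
    - exact: measurable_funM.
    - by move=> t; exact: sqr_ge0.
    - by move=> t; exact: mulr_ge0.
  have e0 : (0 <= expect 0 (fun t => (S n 0 t - c * n%:R) ^+ 2)%R)%E.
    by apply: expect_ge0 => t; exact: sqr_ge0.
  have := HD n 0 z01; rewrite -E expect_birkhoff// -EFinM.
  move: e0; case: (expect 0 _) => [e| |]// _.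
  by rewrite -EFinD !lee_fin addrC lerD2l.
Qed.

Lemma birkhoff_average_monotone : (forall x, 0 <= x <= 1 -> monotone01 (f x)) ->
  {ae mu, forall u, 0 < u < 1 -> n%:R^-1 * S n 0 u @[n --> \oo] --> c}.
Proof.
move=> f_mono; have z01 : 0 <= (0 : R) <= 1 by rewrite lexx ler01.
have K10 : 0 <= K1 by rewrite mulr_ge0.
have K20 : 0 <= K2 by rewrite mulr_ge0// addr_ge0.
apply: (@birkhoff_average (K1 + K2 / 2)).
- by rewrite addr_ge0// divr_ge0.
- rewrite -lee_fin; apply: le_trans (f_sqr z01).
  by apply: expect_ge0 => t; exact: sqr_ge0.
move=> n x x01; have /andP[x0 x1] := x01.
have := @correlation_shift n (correlation n) x (f x) 1 x01 (mfx x)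
  (fun t => f_ge0 t x0) (f_mono x x01) (fun t _ => f_le1 x t).
by rewrite f_mean// mul1r -EFinM -EFinD.
Qed.

(** If [f x t] depends on [t] through the digit only, it factors out of the
    expectation on each branch, and the correlation bound is immediate. *)
Lemma birkhoff_average_digit (psi : nat -> R -> R) :
  (forall i x t, 0 < t < 1 -> f x (branch i t) = psi i x) ->
  {ae mu, forall u, 0 < u < 1 -> n%:R^-1 * S n 0 u @[n --> \oo] --> c}.
Proof.
move=> f_psi; have z01 : 0 <= (0 : R) <= 1 by rewrite lexx ler01.
have K10 : 0 <= K1 by rewrite mulr_ge0.
have M0 : 0 <= M by have /andP[] := g_bound z01; exact: le_trans.
apply: (@birkhoff_average (K1 * M)).
- exact: mulr_ge0.
- rewrite -lee_fin; apply: le_trans (f_sqr z01).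
  by apply: expect_ge0 => t; exact: sqr_ge0.
move=> n x x01; have /andP[x0 x1] := x01.
have fx0 t : 0 <= f x t by exact: f_ge0.
have cnK : 0 <= c * n%:R + K1 by rewrite addr_ge0// mulr_ge0.
rewrite (expect_step (F := S n) x01 (mfx x) fx0 (measurable_birkhoff n mf) (birkhoff_ge0 n)).
apply: (@le_trans _ _ ((c * n%:R + K1)%:E * expect x (f x))%E).
  rewrite (expect_one_step x01 (mfx x) fx0) -nneseriesZl; last first.
    move=> i _; rewrite mule_ge0 ?lee_fin ?weight_ge0//.
    by apply: expect_ge0 => t; exact: fx0.
  apply: lee_nneseries => [i _ _|i _].
    rewrite mule_ge0 ?lee_fin ?weight_ge0//; apply: expect_ge0 => t.
    by rewrite mulr_ge0// birkhoff_ge0//; have /andP[] := branch01 i x0.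
  rewrite muleCA; apply: lee_wpmul2l; first by rewrite lee_fin weight_ge0.
  have b01 := branch01 i x0.
  have psi0 : 0 <= psi i x.
    by rewrite -(f_psi i x 2^-1)//; apply/andP; split; lra.
  have -> : expect (branch i x) (f x \o branch i) = (psi i x)%:E.
    by rewrite -(expect_cst (branch i x)); apply: expect_eq => // t t01 /=; rewrite f_psi.
  have -> : expect (branch i x) (fun t => f x (branch i t) * S n (branch i x) t) =
      ((psi i x)%:E * (A n (branch i x))%:E)%E.
    rewrite -expect_birkhoff// -expectZ//.
    - by apply: expect_eq => // t t01; rewrite f_psi.
    - exact: measurable_birkhoff_section.
    - by move=> t; apply: birkhoff_ge0; have /andP[] := b01.
  by rewrite muleC -!EFinM lee_fin ler_wpM2r// mean_sum_le.
rewrite f_mean// -EFinM lee_fin mulrDl lerD2l ler_wpM2l//.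
by have /andP[] := g_bound x01.
Qed.

End moments.

(** * The sum of the inverse squares *)

Section basel.
Variable R : realType.
Local Notation mu := (@lebesgue_measure R).

Let hp : R := pi / 2.
Let hp0 : 0 < hp. Proof. by rewrite divr_gt0// pi_gt0. Qed.

(** The proof of Matsuoka: compare the integrals of [cos x ^+ (2 * n)]
    and [x ^+ 2 * cos x ^+ (2 * n)] over a quarter of a period. *)
Definition quarter_integral (f : R -> R) : R := (\int[mu]_(x in `[0%R, (pi / 2)%R]) f x)%R.
Local Notation Int := quarter_integral.

Lemma quarter_integrable (f : R -> R) : continuous f ->
  mu.-integrable `[0%R, hp] (EFin \o f).
Proof.
move=> cf; apply: continuous_compact_integrable; first exact: segment_compact.
exact: continuous_subspaceT.
Qed.

Lemma quarter_FTC (F f : R -> R) : continuous f ->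
  (forall x : R, is_derive x 1 F (f x)) -> Int f = F hp - F 0.
Proof.
move=> cf dF; rewrite /quarter_integral /Rintegral -/hp.
by rewrite (@FTC2_is_derive _ F f 0 hp)//; exact: continuous_subspaceT.
Qed.

Let C n (x : R) := cos x ^+ (2 * n)%N.
Let J n (x : R) := x ^+ 2 * cos x ^+ (2 * n)%N.

Lemma continuous_cosX n : continuous (fun x : R => cos x ^+ n).
Proof.
by move=> x; exact: (continuous_comp (@continuous_cos R x) (@exprn_continuous R n _)).
Qed.

Let cC n : continuous (C n). Proof. exact: continuous_cosX. Qed.

Let cJ n : continuous (J n).
Proof.
by move=> x; apply: cvgM; [exact: (@exprn_continuous R 2)|exact: continuous_cosX].
Qed.

Lemma is_derive_pow (f : R -> R) n (x df : R) : is_derive x 1 f df ->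
  is_derive x 1 (fun y => f y ^+ n) (n%:R * f x ^+ n.-1 * df).
Proof.
move=> d; have -> : (fun y => f y ^+ n) = f ^+ n by apply/funext => y; rewrite exprfctE.
exact: is_deriveX.
Qed.

Lemma is_derive_mul (f g : R -> R) (x df dg : R) : is_derive x 1 f df ->
  is_derive x 1 g dg -> is_derive x 1 (fun y => f y * g y) (f x * dg + g x * df).
Proof. by move=> d1 d2; exact: is_deriveM. Qed.

Lemma cos_power_rec n : 2 * n.+1%:R * Int (C n.+1) = (2 * n%:R + 1) * Int (C n).
Proof.
have dF (x : R) : is_derive x 1 (fun y : R => sin y * cos y ^+ (2 * n).+1)
  (2 * n.+1%:R * C n.+1 x - (2 * n%:R + 1) * C n x).
  have := is_derive_mul (is_derive_sin x) (is_derive_pow (2 * n).+1 (is_derive_cos x)).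
  congr is_derive.
  have s2 : sin x ^+ 2 = 1 - cos x ^+ 2 by rewrite -(cos2Dsin2 x); ring.
  rewrite /C (_ : (2 * n.+1)%N = (2 * n).+2)%N; last by rewrite mulnS.
  rewrite -[(2 * n).+1%:R]natr1 natrM -[n.+1%:R]natr1 /= !exprS.
  transitivity (cos x * cos x * cos x ^+ (2 * n) - (2 * n%:R + 1) * cos x ^+ (2 * n) * sin x ^+ 2).
    by ring.
  by rewrite s2; ring.
have H := quarter_FTC _ dF.
have : Int (fun x => 2 * n.+1%:R * C n.+1 x - (2 * n%:R + 1) * C n x) = 0.
  rewrite H; last first.
    by move=> x; apply: cvgB; apply: cvgM; [exact: cvg_cst|exact: cC|exact: cvg_cst|exact: cC].
  by rewrite cos_pihalf sin0 mul0r expr0n /= mulr0 subrr.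
rewrite {1}/quarter_integral RintegralB//; last 2 first.
- by apply: quarter_integrable => x; apply: cvgM; [exact: cvg_cst|exact: cC].
- by apply: quarter_integrable => x; apply: cvgM; [exact: cvg_cst|exact: cC].
rewrite RintegralZl//; last by apply: quarter_integrable; exact: cC.
rewrite RintegralZl//; last by apply: quarter_integrable; exact: cC.
by move/eqP; rewrite subr_eq0 => /eqP.
Qed.

Lemma square_cos_power_rec n :
  Int (C n.+1) + 2 * n.+1%:R ^+ 2 * Int (J n.+1) = n.+1%:R * (2 * n%:R + 1) * Int (J n).
Proof.
have dF (x : R) : is_derive x 1 (fun y : R => y * cos y ^+ (2 * n.+1) +
    n.+1%:R * (y ^+ 2 * (sin y * cos y ^+ (2 * n).+1)))
  ((C n.+1 x + 2 * n.+1%:R ^+ 2 * J n.+1 x) - n.+1%:R * (2 * n%:R + 1) * J n x).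
  have d1 := is_derive_mul (is_derive_id x 1) (is_derive_pow (2 * n.+1) (is_derive_cos x)).
  have d2 := is_derive_mul (is_derive_sin x) (is_derive_pow (2 * n).+1 (is_derive_cos x)).
  have d3 := is_derive_mul (is_derive_pow 2 (is_derive_id x 1)) d2.
  have d4 := is_derive_mul (is_derive_cst (n.+1%:R : R) x 1) d3.
  have := is_deriveD d1 d4; congr is_derive.
  have s2 : sin x ^+ 2 = 1 - cos x ^+ 2 by rewrite -(cos2Dsin2 x); ring.
  rewrite /C /J (_ : (2 * n.+1)%N = (2 * n).+2)%N; last by rewrite mulnS.
  rewrite -[(2 * n).+2%:R]natr1 -[(2 * n).+1%:R]natr1 natrM -[n.+1%:R]natr1 /= !exprS /cst /=.
  set c := cos x in s2 *; set sn := sin x in s2 *; set p := c ^+ (2 * n); set N := n%:R.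
  transitivity (c * c * p + (N + 1) * x ^+ 2 * c * c * p
     - (N + 1) * (2 * N + 1) * x ^+ 2 * p * sn ^+ 2); first by ring.
  by rewrite s2; ring.
have H := quarter_FTC _ dF.
have c1 : continuous (fun x => C n.+1 x + 2 * n.+1%:R ^+ 2 * J n.+1 x).
  by move=> x; apply: cvgD; [exact: cC|apply: cvgM; [exact: cvg_cst|exact: cJ]].
have c2 : continuous (fun x => n.+1%:R * (2 * n%:R + 1) * J n x).
  by move=> x; apply: cvgM; [exact: cvg_cst|exact: cJ].
have : Int (fun x => (C n.+1 x + 2 * n.+1%:R ^+ 2 * J n.+1 x) - n.+1%:R * (2 * n%:R + 1) * J n x) = 0.
  rewrite H; last by move=> x; apply: cvgB; [exact: c1|exact: c2].
  by rewrite cos_pihalf sin0 !expr0n /=; ring.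
rewrite {1}/quarter_integral RintegralB//; last 2 first.
- by apply: quarter_integrable.
- by apply: quarter_integrable.
rewrite RintegralD//; last 2 first.
- apply: quarter_integrable; exact: cC.
- by apply: quarter_integrable => x; apply: cvgM; [exact: cvg_cst|exact: cJ].
rewrite RintegralZl//; last by apply: quarter_integrable; exact: cJ.
rewrite RintegralZl//; last by apply: quarter_integrable; exact: cJ.
by move/eqP; rewrite subr_eq0 => /eqP.
Qed.

Lemma cos_power0 : Int (C 0) = hp.
Proof.
rewrite (@quarter_FTC id)//; first by rewrite subr0.
Qed.

Lemma square_cos_power0 : Int (J 0) = hp ^+ 3 / 3.
Proof.
have dF (x : R) : is_derive x 1 (fun y : R => y ^+ 3 / 3) (J 0 x).
  have := is_derive_mul (is_derive_pow 3 (is_derive_id x 1)) (is_derive_cst (3^-1 : R) x 1).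
  by congr is_derive; rewrite /J muln0 expr0 /cst /=; field.
by rewrite (quarter_FTC (@cJ 0%N) dF) expr0n mul0r subr0.
Qed.

Lemma mul_cos_le_sin (x : R) : 0 <= x <= hp -> x * cos x <= sin x.
Proof.
move=> /andP[]; rewrite le_eqVlt => /predU1P[<- _|x0 xh]; first by rewrite mul0r sin0.
have dF (y : R) : is_derive y 1 (fun z : R => sin z - z * cos z) (y * sin y).
  have := is_deriveB (is_derive_sin y) (is_derive_mul (is_derive_id y 1) (is_derive_cos y)).
  by congr is_derive; ring.
have cf : {within `[0, x], continuous (fun y : R => y * sin y)}.
  by apply: continuous_subspaceT => y; apply: cvgM; [exact: cvg_id|exact: continuous_sin].
have := FTC2_is_derive x0 cf (fun y _ => dF y).
rewrite sin0 mul0r !subr0 sube0 => H.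
rewrite -subr_ge0 -lee_fin -H; apply: integral_ge0 => y /=; rewrite in_itv/= => /andP[y0 yx].
rewrite lee_fin mulr_ge0// sin_ge0_pi// y0/=.
apply: le_trans yx _; apply: le_trans xh _; rewrite /hp ler_pdivrMr//.
by have := pi_gt0 R; lra.
Qed.

Lemma cos_power_gt0 n : 0 < Int (C n).
Proof.
elim: n => [|n IH]; first by rewrite cos_power0.
have : 0 < 2 * n.+1%:R * Int (C n.+1) by rewrite cos_power_rec mulr_gt0// ltr_wpDl// mulr_ge0.
by rewrite pmulr_rgt0// mulr_gt0.
Qed.

(** Since [x * cos x <= sin x], [x ^+ 2 * cos x ^+ (2 * n.+1)] is at most
    [cos x ^+ (2 * n) - cos x ^+ (2 * n.+1)]; this makes the ratio of the two integrals
    tend to 0. *)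
Lemma square_cos_power_le n : 0 <= Int (J n.+1) <= Int (C n.+1) / (2 * n%:R + 1).
Proof.
apply/andP; split.
  by apply: Rintegral_ge0 => x _; rewrite mulr_ge0 ?sqr_ge0// exprM exprn_ge0 ?sqr_ge0.
have n1 : 0 < 2 * n%:R + 1 :> R by rewrite ltr_wpDl// mulr_ge0.
have -> : Int (C n.+1) / (2 * n%:R + 1) = Int (C n) - Int (C n.+1).
  have := cos_power_rec n; rewrite -[n.+1%:R]natr1.
  move: (Int (C n.+1)) (Int (C n)) (n%:R : R) n1 => a b N N0 H.
  have -> : b = 2 * (N + 1) * a / (2 * N + 1) by rewrite H mulrAC mulfV ?mul1r// gt_eqF.
  by field; rewrite gt_eqF.
rewrite /quarter_integral -RintegralB//; last 2 first.
- by apply: quarter_integrable; exact: cC.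
- by apply: quarter_integrable; exact: cC.
apply: le_Rintegral => //.
- by apply: quarter_integrable; exact: cJ.
- by apply: quarter_integrable => x; apply: cvgB; exact: cC.
- move=> x /=; rewrite in_itv/= => x01; have /andP[x0 xh] := x01.
  have c0 : 0 <= cos x.
    by rewrite cos_ge0_pihalf// xh andbT (le_trans _ x0)// oppr_le0 ltW.
  have h : (x * cos x) ^+ 2 <= sin x ^+ 2.
    rewrite lerXn2r ?nnegrE ?mulr_ge0//; last exact: mul_cos_le_sin.
    by apply: le_trans (mul_cos_le_sin x01); rewrite mulr_ge0.
  have s2 : sin x ^+ 2 = 1 - cos x ^+ 2 by rewrite -(cos2Dsin2 x); ring.
  have p0 : 0 <= cos x ^+ (2 * n) by rewrite exprn_ge0.
  rewrite /J /C (_ : (2 * n.+1)%N = (2 + 2 * n)%N) ?mulnS// exprD mulrA -exprMn.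
  apply: le_trans (ler_wpM2r p0 h) _.
  by rewrite s2 mulrBl mul1r.
Qed.

(** By the two recurrences, the ratio of the two integrals changes by
    [1 / (2 * n.+1 ^+ 2)] at each step. *)
Lemma inverse_squares_telescope n : \sum_(k < n) (k.+1%:R ^+ 2)^-1 =
  2 * (Int (J 0) / Int (C 0) - Int (J n) / Int (C n)).
Proof.
elim: n => [|n IH]; first by rewrite big_ord0 subrr mulr0.
rewrite big_ord_recr /= IH -[LHS]/(_ + _).
have := cos_power_rec n; have := square_cos_power_rec n.
have := cos_power_gt0 n; have := cos_power_gt0 n.+1.
move: (Int (J 0) / Int (C 0)) => q0.
move: (Int (J n)) (Int (J n.+1)) (Int (C n)) (Int (C n.+1)) => a b c d d0 c0 H1 H2.
have n1 : 0 < 2 * n%:R + 1 :> R by rewrite ltr_wpDl// mulr_ge0.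
have m0 : 0 < n.+1%:R :> R by [].
move: H1 H2; move: (n.+1%:R : R) (2 * n%:R + 1 : R) m0 n1 => m N m0 N0 H1 H2.
have aE : a = (d + 2 * m ^+ 2 * b) / (m * N) by rewrite H1 [_ * a]mulrC mulfK// mulf_neq0 ?gt_eqF.
have cE : c = 2 * m * d / N by rewrite H2 [_ * c]mulrC mulfK// gt_eqF.
rewrite aE cE; field.
by rewrite !gt_eqF.
Qed.

Lemma basel : \sum_(k < n) (k.+1%:R ^+ 2)^-1 @[n --> \oo] --> (pi ^+ 2 / 6 : R).
Proof.
have E0 : 2 * (Int (J 0) / Int (C 0)) = pi ^+ 2 / 6.
  rewrite square_cos_power0 cos_power0 /hp.
  have p0 : pi != 0 :> R by rewrite gt_eqF// pi_gt0.
  by move: (pi : R) p0 => p p0; field; rewrite p0.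
have lim0 : Int (J n) / Int (C n) @[n --> \oo] --> (0 : R).
  rewrite -(cvg_shiftS (fun n => Int (J n) / Int (C n))).
  apply: (@squeeze_cvgr _ _ _ _ (fun=> 0) (@harmonic R)).
  - apply: nearW => n; have /andP[h1 h2] := square_cos_power_le n.
    have c0 := cos_power_gt0 n.+1.
    rewrite divr_ge0 ?(ltW c0)//= ler_pdivrMr//; apply: le_trans h2 _.
    rewrite mulrC; apply: ler_wpM2r; first exact: ltW.
    rewrite /harmonic lef_pV2 ?posrE ?ltr_wpDl ?mulr_ge0//.
    by rewrite -natr1 lerD2r ler_peMl// ler1n.
  - exact: cvg_cst.
  - exact: cvg_harmonic.
have : 2 * (Int (J 0) / Int (C 0) - Int (J n) / Int (C n)) @[n --> \oo] -->
    2 * (Int (J 0) / Int (C 0) - 0).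
  by apply: cvgM; [exact: cvg_cst|apply: cvgB => //; exact: cvg_cst].
rewrite subr0 E0; apply: cvg_trans; apply: near_eq_cvg; apply: nearW => n.
by rewrite inverse_squares_telescope.
Qed.

End basel.

(** * The frequency of Hermite vectors *)

Section hermite_frequency.
Variable R : realType.
Local Notation mu := (@lebesgue_measure R).

(** Dividing the test of [hermite_reduced] by [q * r'], with [x = q' / q] and
    [t = r / r'], gives [t <= threshold x]. *)
Definition threshold (x : R) : R := (2 * x + 1) / (x + 2).
Definition hermite_test (x t : R) : R := if t <= threshold x then 1 else 0.
(** The distribution function of the law attached to [x], at the threshold. *)
Definition hermite_mean (x : R) : R :=
  (1 + x) * (2 * x + 1) / (2 * (x ^+ 2 + x + 1)).

Lemma measurable_hermite_test :
  measurable_fun [set: R * R] (fun z : R * R => hermite_test z.1 z.2).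
Proof.
have m1 : measurable_fun [set: R * R] (fun z : R * R => threshold z.1).
  apply: measurable_funM.
    by apply: measurable_funD => //; apply: measurable_funM.
  by apply: measurable_funV; apply: measurable_funD.
apply: measurable_fun_ifT => //.
exact: measurable_fun_ler.
Qed.

Lemma quantile_le (x u s : R) : 0 <= x <= 1 -> 0 < u < 1 -> 0 <= s ->
  (quantile x u <= s) = (u <= (1 + x) * s / (1 + x * s)).
Proof.
move=> /andP[x0 x1] /andP[u0 u1] s0.
have h : 0 < 1 + x - x * u.
  by have : x * u <= x * 1 by [apply: ler_wpM2l => //; exact: ltW]; lra.
have h2 : 0 < 1 + x * s by rewrite ltr_wpDr// mulr_ge0.
rewrite /quantile ler_pdivrMr// ler_pdivlMr//.
by rewrite -subr_ge0 -[RHS]subr_ge0; congr (0 <= _); ring.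
Qed.

Lemma expect_hermite_test (x : R) : 0 <= x <= 1 ->
  expect x (hermite_test x) = (hermite_mean x)%:E.
Proof.
move=> x01; have /andP[x0 x1] := x01.
have s0 : 0 <= threshold x by rewrite divr_ge0 ?addr_ge0 ?mulr_ge0.
pose w := (1 + x) * threshold x / (1 + x * threshold x).
have d1 : x + 2 != 0 by rewrite gt_eqF//; lra.
have d2 : 0 < x ^+ 2 + x + 1 by rewrite ltr_wpDl// addr_ge0// sqr_ge0.
have wE : w = hermite_mean x.
  have e : 1 + x * threshold x = 2 * (x ^+ 2 + x + 1) / (x + 2).
    by rewrite /threshold; field.
  rewrite /w e /threshold /hermite_mean; move: d2; move: (x ^+ 2 + x + 1) => D D0.
  by field; rewrite d1 gt_eqF.
have w0 : 0 < w by rewrite wE divr_gt0 ?mulr_gt0//; lra.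
have w1 : w <= 1.
  rewrite wE /hermite_mean ler_pdivrMr ?mulr_gt0// mul1r.
  by rewrite -subr_ge0 (_ : _ - _ = 1 - x) ?subr_ge0//; ring.
rewrite -wE /expect.
transitivity (\int[mu]_(u in `]0%R, 1%R[) (\1_(`]0, w] : set R) u)%:E)%E.
  apply: eq_integral => u; rewrite inE /= in_itv/= => u01.
  congr (_%:E); rewrite /hermite_test quantile_le// -/w indicE.
  by rewrite mem_setE /= in_itv /=; have /andP[-> _] := u01; case: ifP.
rewrite integral_indic//= setIC.
have -> : `]0, 1[%classic `&` `]0, w]%classic = (if w < 1 then `]0, w]%classic else `]0, 1[%classic) :> set R.
  apply/seteqP; split=> u /=; case: ltP => hw; rewrite /= !in_itv/=.
  - by move=> [].
  - by move=> [].
  - move=> /andP[u0 uw]; split; rewrite ?u0//=.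
    exact: le_lt_trans uw hw.
  - by move=> /andP[u0 u1]; rewrite u0 u1 /=; split=> //; apply: le_trans hw; exact: ltW.
case: ltP => hw; rewrite lebesgue_measure_itv/= lte_fin ?w0 ?ltr01 oppr0 adde0//.
by congr (_%:E); apply/eqP; rewrite eq_le w1 hw.
Qed.

Lemma hermite_mean_lipschitz : lipschitz01 2 hermite_mean.
Proof.
move=> x y /andP[x0 x1] /andP[y0 y1].
have dx : 0 < x ^+ 2 + x + 1 by rewrite ltr_wpDl// addr_ge0// sqr_ge0.
have dy : 0 < y ^+ 2 + y + 1 by rewrite ltr_wpDl// addr_ge0// sqr_ge0.
have -> : hermite_mean x - hermite_mean y = (x - y) *
    ((2 + x + y - x * y) / (2 * ((x ^+ 2 + x + 1) * (y ^+ 2 + y + 1)))).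
  transitivity (((1 + x) * (2 * x + 1) * (y ^+ 2 + y + 1) - (1 + y) * (2 * y + 1) * (x ^+ 2 + x + 1))
      / (2 * ((x ^+ 2 + x + 1) * (y ^+ 2 + y + 1)))).
    rewrite /hermite_mean; move: dx dy; move: (x ^+ 2 + x + 1) (y ^+ 2 + y + 1) => D E D0 E0.
    by field; rewrite !gt_eqF.
  by rewrite [RHS]mulrA; congr (_ / _); ring.
rewrite normrM mulrC ler_wpM2r// ger0_norm; last first.
  rewrite divr_ge0 ?mulr_ge0 ?(ltW dx) ?(ltW dy)//.
  by have : x * y <= 1 * 1 by [apply: ler_pM]; lra.
rewrite ler_pdivrMr ?mulr_gt0//.
have h1 : 1 <= x ^+ 2 + x + 1 by rewrite lerDr addr_ge0// sqr_ge0.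
have h2 : 1 <= y ^+ 2 + y + 1 by rewrite lerDr addr_ge0// sqr_ge0.
have h : 1 * 1 <= (x ^+ 2 + x + 1) * (y ^+ 2 + y + 1) by apply: ler_pM.
have : 0 <= x * y by rewrite mulr_ge0.
lra.
Qed.

Lemma hermite_mean_bound (x : R) : 0 <= x <= 1 -> 0 <= hermite_mean x <= 1.
Proof.
move=> /andP[x0 x1].
have dx : 0 < x ^+ 2 + x + 1 by rewrite ltr_wpDl// addr_ge0// sqr_ge0.
rewrite /hermite_mean divr_ge0 ?mulr_ge0 ?addr_ge0 ?sqr_ge0 ?mulr_ge0//=.
by rewrite ler_pdivrMr ?mulr_gt0// mul1r -subr_ge0 (_ : _ - _ = 1 - x) ?subr_ge0//; ring.
Qed.

(** Multiplied by the Gauss density the mean is the derivative of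
    [ln (x ^+ 2 + x + 1) / 2]. *)
Lemma hermite_mean_integral :
  gauss_integral hermite_mean = ((ln 3 / ln 4) * ln 2)%:E.
Proof.
have ln2 : 0 < ln 2 :> R by rewrite ln_gt0// ltr1n.
have -> : ln 4 = 2 * ln 2 :> R.
  by rewrite (_ : 4 = 2 ^+ 2 :> R) ?lnXn// ?mulr_natl//; ring.
have -> : ln 3 / (2 * ln 2) * ln 2 = ln 3 / 2 :> R by field; rewrite gt_eqF.
have q0 (x : R) : 0 <= x -> 0 < x ^+ 2 + x + 1.
  by move=> x0; rewrite ltr_wpDl// addr_ge0// sqr_ge0.
pose F (x : R) := ln (x ^+ 2 + x + 1) / 2.
pose h (x : R) := hermite_mean x * gauss_density x.
have dF (x : R) : 0 <= x <= 1 -> is_derive x 1 F (h x).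
  move=> /andP[x0 x1].
  have dp : is_derive x (1 : R) (fun y : R => y ^+ 2 + y + 1) (2 * x + 1).
    by apply: is_derive_eq; rewrite /GRing.scale /=; ring.
  have dl := @is_derive1_comp R (@ln R) (fun y => y ^+ 2 + y + 1) x _ _ (is_derive1_ln (q0 x x0)) dp.
  have dd : is_derive x (1 : R) (fun y : R => ln (y ^+ 2 + y + 1) * 2^-1)
     (2^-1 * ((x ^+ 2 + x + 1)^-1 * (2 * x + 1))).
    by apply: is_derive_eq; rewrite /GRing.scale /=; ring.
  suff -> : h x = 2^-1 * ((x ^+ 2 + x + 1)^-1 * (2 * x + 1)) by [].
  have h1 : 1 + x != 0 by rewrite gt_eqF// ltr_wpDr.
  rewrite /h /hermite_mean /gauss_density; move: (q0 x x0); move: (x ^+ 2 + x + 1) => D D0.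
  by field; rewrite h1 gt_eqF.
have ch : {within `[(0:R), 1], continuous h}.
  move=> y; apply: cvgM; first exact: (lipschitz_within hermite_mean_lipschitz).
  move: y; apply: continuous_in_subspaceT => y; rewrite inE /= in_itv/= => /andP[y0 _].
  exact: gauss_density_continuous.
rewrite /gauss_integral integral_itv_obnd_cbnd; last first.
  apply: (@measurable_funS _ _ _ _ `[(0:R), 1]) => //; first exact: subset_itv_oc_cc.
  by apply/measurable_EFinP; apply: subspace_continuous_measurable_fun.
rewrite (FTC2_is_derive ltr01 ch dF) /F expr0n expr1n /= !add0r ln1 mul0r sube0.
by congr ((ln _ / 2)%:E); ring.
Qed.

Lemma hermite_test_average :
  {ae mu, forall u, 0 < u < 1 ->
    n%:R^-1 * birkhoff hermite_test n 0 u @[n --> \oo] --> (ln 3 / ln 4 : R)}.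
Proof.
have ln2 : 0 < ln 2 :> R by rewrite ln_gt0// ltr1n.
have t01 (x t : R) : 0 <= hermite_test x t <= 1.
  by rewrite /hermite_test; case: ifP => _; rewrite ?lexx ?ler01.
apply: (@birkhoff_average_monotone R hermite_test hermite_mean 2 1 1 (ln 3 / ln 4)).
- exact: measurable_hermite_test.
- by move=> x t _; have /andP[] := t01 x t.
- exact: expect_hermite_test.
- move=> x x01; rewrite -[leRHS](expect_cst x 1); apply: expect_le => //.
  + apply: measurable_funX; exact: (measurable_fun_pair2 x measurable_hermite_test).
  + by move=> t; exact: sqr_ge0.
  + by move=> t _; rewrite /hermite_test; case: ifP => _; rewrite ?expr1n ?expr0n.
- by [].
- exact: hermite_mean_lipschitz.
- exact: hermite_mean_bound.
- exact: hermite_mean_integral.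
- by rewrite divr_ge0// ln_ge0// ler1n.
- by move=> x t; have /andP[] := t01 x t.
- move=> x _; right => s t s0 st t1; rewrite /hermite_test.
  case: (leP t (threshold x)) => ht; last by case: ifP.
  by rewrite (le_trans st ht).
Qed.

End hermite_frequency.

(** * The mean logarithm of a digit *)

Section levy_bounds.
Variable R : realType.
Local Notation mu := (@lebesgue_measure R).

Lemma ln_le_sub (a b : R) : 0 < b -> 0 < a -> ln a - ln b <= (a - b) / b.
Proof.
move=> b0 a0; rewrite -ln_div ?posrE//.
have -> : (a - b) / b = a / b - 1 by rewrite mulrBl mulfV// gt_eqF.
have : ln (1 + (a / b - 1)) <= a / b - 1.
  by apply: le_ln1Dx; rewrite ltrBrDl subrr divr_gt0.
by rewrite addrC subrK.
Qed.

Lemma ln_lipschitz (a b : R) : 1 <= a -> 1 <= b -> `|ln a - ln b| <= `|a - b|.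
Proof.
wlog ab : a b / b <= a.
  move=> H a1 b1; have [/H|/ltW/H] := leP b a; first exact.
  by rewrite [`|ln b - _|]distrC [`|b - _|]distrC; apply.
move=> a1 b1; have a0 : 0 < a by lra. have b0 : 0 < b by lra.
rewrite ger0_norm ?subr_ge0 ?ler_ln ?posrE// ger0_norm ?subr_ge0//.
apply: le_trans (ln_le_sub b0 a0) _.
by rewrite ler_pdivrMr// ler_peMr// subr_ge0.
Qed.

Lemma ln_le_sqrt (y : R) : 1 <= y -> ln y <= 2 * Num.sqrt y.
Proof.
move=> y1; have y0 : 0 < y by lra.
have s0 : 0 < Num.sqrt y by rewrite sqrtr_gt0.
have -> : ln y = 2 * ln (Num.sqrt y).
  by rewrite -[in LHS](sqr_sqrtr (ltW y0)) lnXn// mulr_natl.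
have := ln_le_sub ltr01 s0; rewrite ln1 subr0 divr1; lra.
Qed.

(** A bound by the square root is enough to sum the squared logarithms of the
    digits against the weights, which decrease like the inverse square of the digit. *)
Lemma ln_sqr_le (y : R) : 1 <= y -> ln y ^+ 2 <= 16 * Num.sqrt y.
Proof.
move=> y1; have y0 : 0 < y by lra.
have s1 : 1 <= Num.sqrt y by rewrite -[leLHS]sqrtr1; apply: ler_wsqrtr.
have s0 : 0 < Num.sqrt y by lra.
have h := ln_le_sqrt s1.
have l0 : 0 <= ln (Num.sqrt y) by rewrite ln_ge0.
have -> : ln y = 2 * ln (Num.sqrt y).
  by rewrite -[in LHS](sqr_sqrtr (ltW y0)) lnXn// mulr_natl.
have : (2 * ln (Num.sqrt y)) ^+ 2 <= (4 * Num.sqrt (Num.sqrt y)) ^+ 2.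
  by rewrite lerXn2r ?nnegrE ?mulr_ge0 ?sqrtr_ge0//; lra.
by rewrite [leRHS]exprMn sqr_sqrtr ?sqrtr_ge0// -natrX.
Qed.

Definition log_digit (i : nat) (x : R) : R := ln (i.+1%:R + x).

Lemma log_digit_ge0 i (x : R) : 0 <= x -> 0 <= log_digit i x.
Proof. by move=> x0; rewrite ln_ge0// ler_wpDr// ler1n. Qed.

Lemma weight_le i (x : R) : 0 <= x <= 1 -> weight i x <= 2 / (i.+1%:R * i.+2%:R).
Proof.
move=> /andP[x0 x1]; rewrite /weight; apply: ler_pM => //.
- by rewrite addr_ge0.
- by rewrite invr_ge0 mulr_ge0 ?ltW ?natSD_gt0.
- lra.
- rewrite lef_pV2 ?posrE ?mulr_gt0 ?natSD_gt0//.
  by apply: ler_pM => //; rewrite lerDl.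
Qed.

Lemma inv_sqrt_telescope i : (i.+1%:R * Num.sqrt i.+2%:R)^-1 <=
  4 * ((Num.sqrt i.+1%:R)^-1 - (Num.sqrt i.+2%:R)^-1) :> R.
Proof.
pose a : R := Num.sqrt i.+1%:R; pose b : R := Num.sqrt i.+2%:R.
have a2 : i.+1%:R = a ^+ 2 :> R by rewrite sqr_sqrtr.
have b2 : i.+2%:R = b ^+ 2 :> R by rewrite sqr_sqrtr.
have a1 : 1 <= a by rewrite -[leLHS]sqrtr1; apply: ler_wsqrtr; rewrite ler1n.
have ab : b ^+ 2 = a ^+ 2 + 1 by rewrite -a2 -b2 natr1.
have b1 : a <= b by apply: ler_wsqrtr; rewrite ler_nat.
rewrite -/a -/b a2.
have a0 : 0 < a by lra. have b0 : 0 < b by lra.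
have b3 : b <= 3 * a.
  rewrite -(@ler_pXn2r _ 2)// ?nnegrE ?mulr_ge0 ?(ltW a0) ?(ltW b0)// exprMn ab.
  by have : 1 * 1 <= a * a by [apply: ler_pM]; nra.
have -> : 4 * (a^-1 - b^-1) = 4 / (a * b * (a + b)).
  have e : (b - a) * (b + a) = 1 by rewrite -subr_sqr ab addrAC subrr add0r.
  have -> : a^-1 - b^-1 = (b - a) / (a * b) by field; rewrite !gt_eqF.
  have -> : b - a = (b + a)^-1.
    by rewrite -[LHS](mulfK (_ : b + a != 0)) ?e ?mul1r// gt_eqF// addr_gt0.
  by field; rewrite !gt_eqF ?addr_gt0.
rewrite ler_pdivlMr ?mulr_gt0 ?addr_gt0// mulrC ler_pdivrMr ?mulr_gt0 ?exprn_gt0//.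
have : 0 <= a * b by rewrite mulr_ge0 ?ltW.
move=> hab; have : a * b * (a + b) <= a * b * (4 * a) by apply: ler_wpM2l => //; lra.
by lra.
Qed.

(** The term of index [i] is at most [32 / (i.+1 * sqrt i.+2)], and by
    [inv_sqrt_telescope] these bounds add up to at most [4 * 32]. *)
Lemma log_digit_square_sum N (x : R) : 0 <= x <= 1 ->
  \sum_(i < N) weight i x * log_digit i x ^+ 2 <= 128.
Proof.
move=> x01; have /andP[x0 x1] := x01.
apply: (@le_trans _ _ (128 * (1 - (Num.sqrt N.+1%:R)^-1))); last first.
  by rewrite ler_piMr// lerBlDr lerDl invr_ge0 sqrtr_ge0.
elim: N => [|N IH]; first by rewrite big_ord0 sqrtr1 invr1 subrr mulr0.
rewrite big_ord_recr /=; apply: le_trans (lerD IH (lexx _)) _.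
suff : weight N x * log_digit N x ^+ 2 <= 32 * (N.+1%:R * Num.sqrt N.+2%:R)^-1.
  have := inv_sqrt_telescope N; move: (_^-1) (_^-1) (_^-1) (_ * _ ^+ 2) => p q r w h1 h2.
  by lra.
have l : log_digit N x ^+ 2 <= 16 * Num.sqrt N.+2%:R.
  have h : 1 <= N.+1%:R + x by rewrite ler_wpDr// ler1n.
  apply: le_trans (ln_sqr_le h) _; rewrite ler_wpM2l//; apply: ler_wsqrtr.
  by rewrite -[N.+2]addn1 natrD lerD2l.
apply: le_trans (ler_pM (weight_ge0 N x0) (sqr_ge0 _) (weight_le N x01) l) _.
have s2 : N.+2%:R = Num.sqrt N.+2%:R ^+ 2 :> R by rewrite sqr_sqrtr.
have s0 : 0 < Num.sqrt N.+2%:R :> R by rewrite sqrtr_gt0.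
rewrite {1}s2; move: s0; move: (Num.sqrt _) => s s0.
have : 0 < N.+1%:R :> R by []. move: (N.+1%:R : R) => a a0.
rewrite le_eqVlt; apply/orP; left; apply/eqP; field.
by rewrite !gt_eqF.
Qed.

Lemma log_digit_sum N (x : R) : 0 <= x <= 1 ->
  \sum_(i < N) weight i x * log_digit i x <= 129.
Proof.
move=> x01; have /andP[x0 x1] := x01.
apply: (@le_trans _ _ (\sum_(i < N) (weight i x + weight i x * log_digit i x ^+ 2))).
  apply: ler_sum => i _; rewrite -[X in X + _]mulr1 -mulrDr ler_wpM2l ?weight_ge0//.
  have := sqr_ge0 (log_digit i x - 1); have := sqr_ge0 (log_digit i x).
  rewrite sqrrB1; nra.
rewrite big_split /=; have := log_digit_square_sum N x01.
rewrite sum_weight//; have := cutpoint_gt0 N x0; lra.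
Qed.

Definition levy_mean (x : R) : R :=
  limn (series (fun i => weight i x * log_digit i x)).

Lemma levy_mean_spec (x : R) : 0 <= x <= 1 ->
  [/\ cvgn (series (fun i => weight i x * log_digit i x)),
      0 <= levy_mean x <= 129 &
      (\sum_(i <oo) (weight i x)%:E * (log_digit i x)%:E = (levy_mean x)%:E)%E].
Proof.
move=> x01; have /andP[x0 x1] := x01.
have [|N|h1 h2 h3] := @nneseries_EFin R (fun i => weight i x * log_digit i x) 129.
- by move=> i; rewrite mulr_ge0 ?weight_ge0 ?log_digit_ge0.
- exact: log_digit_sum.
- by split.
Qed.

Lemma levy_mean_lipschitz : lipschitz01 4 levy_mean.
Proof.
move=> x y x01 y01; have /andP[x0 x1] := x01; have /andP[y0 y1] := y01.
have [cx _ _] := levy_mean_spec x01; have [cy _ _] := levy_mean_spec y01.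
apply: (@limit_difference_le _ _ _ _ 0) => // N; rewrite mul0r addr0.
have ha i : `|log_digit i x - log_digit i y| <= 1 * `|x - y|.
  rewrite mul1r /log_digit.
  have -> : `|x - y| = `|(i.+1%:R + x) - (i.+1%:R + y)| by congr `|_|; ring.
  by apply: ln_lipschitz; rewrite ler_wpDr// ler1n.
have hb i : `|log_digit i.+1 y - log_digit i y| <= i.+1%:R^-1.
  have p1 := natSD_gt0 i y0; have p2 := natSD_gt0 i.+1 y0.
  rewrite /log_digit ger0_norm; last first.
    by rewrite subr_ge0 ler_ln ?posrE// lerD2r ler_nat.
  apply: le_trans (ln_le_sub p1 p2) _.
  have -> : i.+2%:R + y - (i.+1%:R + y) = 1 by rewrite -[i.+2]addn1 natrD; ring.
  by rewrite mul1r lef_pV2 ?posrE// lerDl.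
apply: le_trans (weighted_sum_diff N x01 y01 ha hb) _.
rewrite mulrC; apply: ler_wpM2r => //.
have e2 : \sum_(i < N) (weight i x * 1 + i.+1%:R / i.+2%:R ^+ 2 * i.+1%:R^-1) <= 2.
  apply: (@le_trans _ _ (\sum_(i < N) (weight i x + (i.+2%:R ^+ 2)^-1))).
    apply: ler_sum => i _; rewrite mulr1 lerD2l mulrAC mulfV ?mul1r//.
  rewrite big_split /= sum_weight//.
  by have := sum_inv_square_le R N; have := cutpoint_gt0 N x0; lra.
have e3 : `|log_digit N y| / N.+1%:R <= 2.
  rewrite ger0_norm ?log_digit_ge0// ler_pdivrMr//.
  have h := natSD_gt0 N y0.
  have := ln_le_sub ltr01 h; rewrite ln1 subr0 divr1 -/(log_digit N y).
  by have : 1 <= N.+1%:R :> R by [rewrite ler1n]; lra.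
by rewrite (_ : 4 = 2 + 2) ?lerD// -natrD.
Qed.

End levy_bounds.

(** * The integral of the logarithm for the Gauss measure *)

Section levy_integral.
Variable R : realType.
Local Notation mu := (@lebesgue_measure R).

Let log_power (n : nat) (y : R) : R :=
  (n.+1%:R ^+ 2)^-1 * y ^+ n.+1 - n.+1%:R^-1 * (y ^+ n.+1 * ln y).

Lemma log_power_derive n (y : R) : 0 < y ->
  is_derive y 1 (log_power n) (- ln y * y ^+ n).
Proof.
move=> y0.
have d1 := @is_derive_pow R id n.+1 y 1 (is_derive_id _ _).
have d2 := @is_derive_mul R _ _ y _ _ d1 (is_derive1_ln y0).
have d3 := @is_derive_mul R (cst (n.+1%:R ^+ 2)^-1) _ y 0 _ (is_derive_cst _ _ _) d1.
have d4 := @is_derive_mul R (cst n.+1%:R^-1) _ y 0 _ (is_derive_cst _ _ _) d2.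
have E : (n.+1%:R ^+ 2)^-1 * (n.+1%:R * y ^+ n * 1) + y ^+ n.+1 * 0 -
    (n.+1%:R^-1 * (y ^+ n.+1 / y + ln y * (n.+1%:R * y ^+ n * 1)) +
     y ^+ n.+1 * ln y * 0) = - ln y * y ^+ n.
  rewrite [y ^+ n.+1]exprS; move: (ln y) (y ^+ n) => l p.
  have : 0 < n.+1%:R :> R by []. move: (n.+1%:R : R) => m m0.
  by field; rewrite !gt_eqF.
rewrite -E; exact: (is_deriveB d3 d4).
Qed.

Lemma log_power_cvg0 (n : nat) : log_power n k.+2%:R^-1 @[k --> \oo] --> 0.
Proof.
pose a (k : nat) : R := k.+2%:R^-1.
have a0 k : 0 < a k by rewrite invr_gt0.
have ca : a k @[k --> \oo] --> (0 : R).
  by have := @cvg_harmonic R; rewrite -cvg_shiftS.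
have cl : a k * ln (a k) @[k --> \oo] --> (0 : R).
  rewrite -oppr0 (_ : (fun k => _) = (fun k => - (a k * - ln (a k)))); last first.
    by apply/funext => k; rewrite mulrN opprK.
  apply: cvgN.
  have cs : 2 * Num.sqrt (a k) @[k --> \oo] --> (0 : R).
    suff : 2 * Num.sqrt (a k) @[k --> \oo] --> 2 * Num.sqrt (0 : R).
      by rewrite sqrtr0 mulr0.
    have c0 : Num.sqrt (a k) @[k --> \oo] --> (Num.sqrt 0 : R).
      by apply: continuous_cvg ca; exact: sqrt_continuous.
    by apply: cvgM; [exact: cvg_cst|exact: c0].
  apply: (squeeze_cvgr _ (cvg_cst 0) cs); apply: nearW => k.
  have h : ln (a k) = - ln (k.+2%:R) by rewrite lnV ?posrE.
  have ak := ltW (a0 k).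
  rewrite h opprK mulr_ge0//= ?ln_ge0 ?ler1n//.
  rewrite /a ler_pdivrMl//.
  have k1 : 1 <= k.+2%:R :> R by rewrite ler1n.
  apply: le_trans (ln_le_sqrt k1) _.
  rewrite mulrCA ler_wpM2l// sqrtrV//.
  by rewrite ler_pdivlMr ?sqrtr_gt0// -expr2 sqr_sqrtr.
have cp : a k ^+ n @[k --> \oo] --> (0 ^+ n : R).
  exact: (@continuous_cvg _ _ _ _ _ a (fun x : R => x ^+ n) 0 (@exprn_continuous R n 0) ca).
have -> : (fun k => log_power n k.+2%:R^-1) = (fun k =>
   (n.+1%:R ^+ 2)^-1 * (a k ^+ n * a k) - n.+1%:R^-1 * (a k ^+ n * (a k * ln (a k)))).
  by apply/funext => k; rewrite /log_power [_ ^+ n.+1]exprSr -!mulrA.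
have -> : 0 = (n.+1%:R ^+ 2)^-1 * (0 ^+ n * 0) - n.+1%:R^-1 * (0 ^+ n * 0) :> R.
  by rewrite !mulr0 subr0.
by apply: cvgB; apply: cvgM; (try exact: cvg_cst); apply: cvgM.
Qed.

(** The antiderivative [log_power n] extends continuously by 0 at the origin; the
    integrals over [`[1 / k.+2, 1]] increase to the one over [`]0, 1]]. *)
Lemma integral_log_power (n : nat) :
  (\int[mu]_(y in `]0%R, 1%R]) (- ln y * (y ^+ n - y ^+ n.+1))%:E =
   ((n.+1%:R ^+ 2)^-1 - (n.+2%:R ^+ 2)^-1)%:E)%E.
Proof.
pose h (y : R) := - ln y * (y ^+ n - y ^+ n.+1).
pose a (k : nat) : R := k.+2%:R^-1.
have a0 k : 0 < a k by rewrite invr_gt0.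
have a1 k : a k < 1 by rewrite invf_lt1// ltr1n.
pose D k : set R := `[a k, 1]%classic.
pose F y := log_power n y - log_power n.+1 y.
have dF (y : R) : 0 < y -> is_derive y 1 F (h y).
  by move=> y0; rewrite /h mulrBr; exact: (is_deriveB (log_power_derive n y0) (log_power_derive n.+1 y0)).
have ch k : {within `[a k, 1], continuous h}.
  apply: continuous_in_subspaceT => y; rewrite inE /= in_itv/= => /andP[ay _].
  have y0 := lt_le_trans (a0 k) ay.
  apply: (@cvgM _ _ _ _ (fun y => - ln y) (fun y => y ^+ n - y ^+ n.+1)).
    by apply: cvgN; exact: continuous_ln.
  by apply: cvgB; exact: exprn_continuous.
have UD : `]0%R, 1%R]%classic = \bigcup_k D k.
  apply/seteqP; split=> [y /=|y [k _]]; rewrite /D /= !in_itv/=.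
    move=> /andP[y0 y1]; exists (Num.truncn y^-1) => //; rewrite /D /= in_itv/= y1 andbT.
    rewrite /a -[leRHS]invrK lef_pV2 ?posrE ?invr_gt0//.
    have /andP[_ h1] : (Num.truncn y^-1)%:R <= y^-1 < (Num.truncn y^-1).+1%:R.
      by apply: truncn_itv; rewrite invr_ge0 ltW.
    by apply: le_trans (ltW h1) _; rewrite ler_nat.
  by move=> /andP[ay ->]; rewrite (lt_le_trans (a0 k) ay).
have cI : (\int[mu]_(y in D i) (h y)%:E @[i --> \oo] --> \int[mu]_(y in \bigcup_i D i) (h y)%:E)%E.
  apply: ge0_nondecreasing_set_cvg_integral.
  - move=> i j ij; apply/subsetPset => y; rewrite /D /= !in_itv/= => /andP[ay ->].
    by rewrite andbT (le_trans _ ay)// lef_pV2 ?posrE// ler_nat.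
  - by move=> k; exact: measurable_itv.
  - by move=> k; apply/measurable_EFinP; apply: subspace_continuous_measurable_fun;
      [exact: measurable_itv|exact: ch].
  - move=> k y; rewrite /D /= in_itv/= => /andP[ay y1]; have y0 := lt_le_trans (a0 k) ay.
    rewrite lee_fin /h mulr_ge0 ?oppr_ge0 ?ln_le0// subr_ge0 exprSr ler_piMr//.
    by rewrite exprn_ge0// ltW.
rewrite UD -(cvg_lim _ cI)//.
have F1 : F 1 = (n.+1%:R ^+ 2)^-1 - (n.+2%:R ^+ 2)^-1.
  by rewrite /F /log_power !expr1n ln1 !mulr0 !mulr1 !subr0.
rewrite (_ : (fun i => _) = (fun i => (F 1 - F (a i))%:E)); last first.
  apply/funext => k.
  have dk (y : R) : a k <= y <= 1 -> is_derive y 1 F (h y).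
    by move=> /andP[ay _]; exact: dF (lt_le_trans (a0 k) ay).
  by rewrite (FTC2_is_derive (a1 k) (ch k) dk) EFinB.
apply/cvg_lim => //; apply: cvg_EFin; first exact: nearW.
rewrite -F1 -[X in _ --> X]subr0; apply: cvgB; first exact: cvg_cst.
rewrite -[X in _ --> X]subr0; apply: cvgB; exact: log_power_cvg0.
Qed.

(** The partial sum of [2 * N] signed inverse squares is the partial sum of
    [2 * N] inverse squares minus half the partial sum of [N] of them. *)
Lemma alternating_inverse_squares :
  (\sum_(m <oo) ((m.*2.+1%:R ^+ 2)^-1 - (m.*2.+2%:R ^+ 2)^-1)%:E =
   (pi ^+ 2 / 12 : R)%:E)%E.
Proof.
pose H n : R := \sum_(k < n) (k.+1%:R ^+ 2)^-1.
have E N : \sum_(0 <= m < N) ((m.*2.+1%:R ^+ 2)^-1 - (m.*2.+2%:R ^+ 2)^-1) =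
    H (N.*2) - H N / 2.
  elim: N => [|N IH]; first by rewrite /H big_nil !big_ord0 mul0r subr0.
  rewrite big_nat_recr//= IH /H doubleS !big_ord_recr /=.
  have -> : (N.*2.+2%:R ^+ 2)^-1 = (N.+1%:R ^+ 2)^-1 / 4 :> R.
    by rewrite -doubleS -muln2 natrM exprMn invfM; congr (_ / _); rewrite -natrX.
  move: ((N.*2.+1%:R ^+ 2)^-1 : R) ((N.+1%:R ^+ 2)^-1 : R) => c d.
  by move: (\sum_(_ < _) _) (\sum_(_ < _) _) => a b; field.
apply/cvg_lim => //.
rewrite (_ : (fun n => _) = (fun N => (H N.*2 - H N / 2)%:E)); last first.
  by apply/funext => N; rewrite sumEFin E.
apply: cvg_EFin; first exact: nearW.
have -> : pi ^+ 2 / 12 = pi ^+ 2 / 6 - pi ^+ 2 / 6 / 2 :> R by move: (pi ^+ 2) => p; field.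
apply: cvgB; last by apply: cvgM; [exact: basel|exact: cvg_cst].
have := cvg_comp _ _ (@cvg_mulnr 2 isT) (@basel R); apply: cvg_trans.
by rewrite (_ : (fun N => H N.*2) = H \o (muln^~ 2%N))//; apply/funext => N /=; rewrite muln2.
Qed.

(** Expand [1 / (1 + y)] as the sum of [y ^+ (2 * m) - y ^+ (2 * m).+1], whose terms
    are nonnegative, so that the integral may be taken term by term. *)
Lemma integral_log_gauss :
  (\int[mu]_(y in `]0%R, 1%R]) (- ln y * gauss_density y)%:E = (pi ^+ 2 / 12)%:E)%E.
Proof.
pose f m (y : R) : R := - ln y * (y ^+ m.*2 - y ^+ m.*2.+1).
have f0 m (y : R) : 0 < y <= 1 -> 0 <= f m y.
  move=> /andP[y0 y1]; rewrite /f mulr_ge0 ?oppr_ge0 ?ln_le0// subr_ge0 exprSr ler_piMr//.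
  by rewrite exprn_ge0// ltW.
transitivity (\int[mu]_(y in `]0%R, 1%R]) \sum_(m <oo) (f m y)%:E)%E.
  apply: eq_integral => y; rewrite inE /= in_itv/= => /andP[y0 y1].
  have d0 : 1 + y != 0 by rewrite gt_eqF// ltr_wpDr// ltW.
  symmetry; apply/cvg_lim => //.
  rewrite (_ : (fun n => _) =
      (fun N => ((- ln y) * gauss_density y - (- ln y * y ^+ N.*2) * gauss_density y)%:E)); last first.
    apply/funext => N; rewrite sumEFin; congr (_%:E).
    elim: N => [|N IH]; first by rewrite big_nil expr0 mulr1 subrr.
    rewrite big_nat_recr//= IH /f /gauss_density doubleS !exprS.
    by move: (ln y) (y ^+ _) => l p; field.
  apply: cvg_EFin; first exact: nearW.
  rewrite -[X in _ --> X]subr0; apply: cvgB; first exact: cvg_cst.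
  rewrite -[X in _ --> X](mul0r (gauss_density y)); apply: cvgM; last exact: cvg_cst.
  have [->|y1'] := eqVneq y 1.
    by rewrite ln1 oppr0 (_ : (fun n => _) = (fun=> 0)); [exact: cvg_cst|apply/funext => N; rewrite mul0r].
  rewrite -[X in _ --> X](mulr0 (- ln y)); apply: cvgM; first exact: cvg_cst.
  have cy : y ^+ n @[n --> \oo] --> (0 : R).
    by apply: cvg_expr; rewrite gtr0_norm// lt_neqAle y1' y1.
  have := cvg_comp _ _ (@cvg_mulnr 2 isT) cy; apply: cvg_trans.
  by rewrite (_ : (fun N => y ^+ N.*2) = (fun n => y ^+ n) \o (muln^~ 2%N))//; apply/funext => N /=; rewrite muln2.
rewrite integral_nneseries//; last first.
  move=> m; apply/measurable_EFinP/measurable_funTS; apply: measurable_funM.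
    by apply: measurableT_comp => //; exact: measurable_ln.
  by apply: measurable_funB; exact: measurable_funX.
by rewrite -alternating_inverse_squares; apply: eq_eseriesr => m _; exact: integral_log_power.
Qed.

(** The logarithm of the ratio of two consecutive denominators. *)
Definition levy_fun (x t : R) : R := ln ((digit t)%:R + x).

Lemma levy_fun_branch i (x t : R) : 0 < t < 1 -> levy_fun x (branch i t) = log_digit i x.
Proof. by move=> t01; rewrite /levy_fun digit_branch. Qed.

Lemma levy_fun_ge0 (x t : R) : 0 <= x -> 0 <= levy_fun x t.
Proof. by move=> x0; rewrite ln_ge0// ler_wpDr// ler1n leq_maxl. Qed.

Lemma measurable_levy_fun :
  measurable_fun [set: R * R] (fun z : R * R => levy_fun z.1 z.2).
Proof.
apply: measurableT_comp (@measurable_ln R) _; apply: measurable_funD => //.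
exact: measurableT_comp (@measurable_digit R) measurable_snd.
Qed.

Lemma expect_digit_fun (x : R) (F : R -> R) (a : nat -> R) : 0 <= x <= 1 ->
  measurable_fun [set: R] F -> (forall t, 0 <= F t) ->
  (forall i t, 0 < t < 1 -> F (branch i t) = a i) ->
  (expect x F = \sum_(i <oo) (weight i x)%:E * (a i)%:E)%E.
Proof.
move=> x01 mF F0 Fa; have /andP[x0 x1] := x01.
rewrite expect_one_step//; apply: eq_eseriesr => i _; congr (_ * _)%E.
rewrite -(expect_cst (branch i x)); apply: expect_eq; first exact: branch01.
by move=> t t01 /=; rewrite Fa.
Qed.

(** The mean of [levy_fun] is the transition operator applied to [- ln], so by
    invariance its Gauss integral is that of [- ln]. *)
Lemma levy_mean_integral :
  gauss_integral (@levy_mean R) = ((pi ^+ 2 / (12 * ln 2)) * ln 2)%:E.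
Proof.
have ln2 : 0 < ln 2 :> R by rewrite ln_gt0// ltr1n.
have -> : pi ^+ 2 / (12 * ln 2) * ln 2 = pi ^+ 2 / 12 :> R.
  by move: (pi ^+ 2) (ln 2) ln2 => p l l0; field; rewrite gt_eqF.
rewrite -integral_log_gauss gauss_invariance.
- rewrite /gauss_integral integral_itv_obnd_cbnd; last first.
    apply/measurable_EFinP; apply: measurable_funM.
      exact: (lipschitz_measurable (@levy_mean_lipschitz R)).
    by apply: measurable_funTS; apply: measurable_funV; apply: measurable_funD.
  apply: eq_integral => x; rewrite inE /= in_itv/= => x01; have /andP[x0 x1] := x01.
  have [_ _ h] := levy_mean_spec x01; rewrite EFinM -h; congr (_ * _)%E.
  apply: eq_eseriesr => i _; congr (_ * _%:E)%E.
  by rewrite /branch lnV ?posrE ?natSD_gt0// opprK.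
- by apply: measurable_funTS; apply: measurableT_comp => //; exact: measurable_ln.
- by move=> y /andP[y0 y1]; rewrite oppr_ge0 ln_le0.
- move=> e e0; apply: continuous_in_subspaceT => y; rewrite inE /= in_itv/= => /andP[ey _].
  by apply: cvgN; apply: continuous_ln; exact: lt_le_trans e0 ey.
Qed.

Lemma levy_average :
  {ae mu, forall u, 0 < u < 1 ->
    n%:R^-1 * birkhoff levy_fun n 0 u @[n --> \oo] --> (pi ^+ 2 / (12 * ln 2) : R)}.
Proof.
have ln2 : 0 < ln 2 :> R by rewrite ln_gt0// ltr1n.
apply: (@birkhoff_average_digit R levy_fun (@levy_mean R) 4 129 128 (pi ^+ 2 / (12 * ln 2))).
- exact: measurable_levy_fun.
- exact: levy_fun_ge0.
- move=> x x01; have /andP[x0 _] := x01; have [_ _ <-] := levy_mean_spec x01.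
  apply: expect_digit_fun => //.
  + exact: (measurable_fun_pair2 x measurable_levy_fun).
  + by move=> t; exact: levy_fun_ge0.
  + by move=> i t; exact: levy_fun_branch.
- move=> x x01; have /andP[x0 _] := x01.
  rewrite (@expect_digit_fun x _ (fun i => log_digit i x ^+ 2))//; last 3 first.
  + apply: measurable_funX; exact: (measurable_fun_pair2 x measurable_levy_fun).
  + by move=> t; exact: sqr_ge0.
  + by move=> i t t01; rewrite levy_fun_branch.
  have [|N|_ /andP[_ h] E] :=
    @nneseries_EFin R (fun i => weight i x * log_digit i x ^+ 2) 128.
  + by move=> i; rewrite mulr_ge0 ?weight_ge0// sqr_ge0.
  + exact: log_digit_square_sum.
  rewrite [leLHS](_ : _ = \sum_(i <oo) (weight i x * log_digit i x ^+ 2)%:E)%E ?E ?lee_fin//.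
- by [].
- exact: levy_mean_lipschitz.
- by move=> x x01; have [_ h _] := levy_mean_spec x01.
- exact: levy_mean_integral.
- by rewrite divr_ge0 ?sqr_ge0// mulr_ge0// ltW.
- by move=> i x t t01; exact: levy_fun_branch.
Qed.

End levy_integral.

(** * From orbits to the sequences of vectors *)

Section counting_function.
Variable P : set (int * nat).

Lemma lists_infinite u : lists P u -> (exists v, P v) ->
  (forall v, P v -> exists2 w, P w & (v.2 < w.2)%N) ->
  forall n, exists v, u n = Some v.
Proof.
move=> uP [z Pz] next; have [_ uB _ uE] := uP.
elim=> [|n [v un]]; first by have [v [u0 _]] := lists_nonempty uP Pz; exists v.
have [w Pw vw] := next v (uB _ _ un); have [k [x [uk xw]]] := uE w Pw.
have nk : (n < k)%N.
  rewrite ltnNge; apply/negP => kn; rewrite -xw in vw.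
  move: kn; rewrite leq_eqVlt => /orP[/eqP kn|kn].
    by move: vw; move: uk; rewrite kn un => -[->]; rewrite ltnn.
  by have := lists_lt uP kn uk un; rewrite ltnNge (ltnW vw).
exact: lists_Some uP nk uk.
Qed.

Definition occurs (q : nat) : nat := `[< exists p, P (p, q) >].

Lemma occurs_gap a b : (a <= b)%N -> (forall v, P v -> (a <= v.2)%N -> (b <= v.2)%N) ->
  (\sum_(a <= q < b) occurs q = 0)%N.
Proof.
move=> ab gap; rewrite big_nat_cond big1// => q; rewrite andbT => /andP[aq qb].
rewrite /occurs; case: asboolP => // -[p Pp].
by have := gap (p, q) Pp aq; rewrite /= leqNgt qb.
Qed.

(** A sequence that lists [P] by increasing denominators is at index [n] when [n]
    denominators of [P] are smaller.  This identifies the index without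
    comparing two lists term by term. *)
Lemma lists_index u n w : lists P u -> u n = Some w ->
  n = (\sum_(0 <= q < w.2) occurs q)%N.
Proof.
move=> uP; have [_ uB ult _] := uP.
elim: n w => [|n IH] w un.
  rewrite occurs_gap// => v Pv _; have [x [u0 xv]] := lists_nonempty uP Pv.
  by move: un; rewrite u0 => -[<-].
have [v uv] := lists_Some uP (leqnSn n) un.
have vw := ult _ _ _ uv un.
rewrite (@big_cat_nat _ _ _ v.2)//=; last exact: ltnW.
rewrite -(IH v uv) big_ltn// (@occurs_gap v.2.+1)//; last exact: lists_next uP uv un.
rewrite addn0 /occurs asboolT ?addn1//; exists v.1.
by case: (v) (uB _ _ uv).
Qed.

End counting_function.

Section hermite_best.
Variables (R : realType) (theta : R).

(** At fixed [Delta], a smaller denominator must be paid for by a larger defect. *)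
Lemma hermite_best (v : int * nat) : (0 < v.2)%N ->
  hermite_best_approx theta v -> best_approx theta v.
Proof.
move=> v0 [_ [D D0 H]]; split=> // a b /andP[b0 bv].
  have ab : (a, b) != (0, 0) by apply/eqP => -[_ e]; move: b0; rewrite e normr0.
  have := H a b ab.
  have lt : b%:~R ^+ 2 / D < v.2%:R ^+ 2 / D.
    rewrite ltr_pM2r ?invr_gt0// -[ltLHS]ger0_norm ?sqr_ge0// normrX ltrXn2r ?nnegrE//.
    by rewrite -intr_norm pmulrn ltr_int.
  move=> h; have : (v.1%:~R - v.2%:R * theta) ^+ 2 < (a%:~R - b%:~R * theta) ^+ 2 by lra.
  by move=> h2; rewrite -ltr_sqr ?nnegrE// !real_normK ?num_real.
have ab : (a, b) != (0, 0) by apply/eqP => -[_ e]; move: b0; rewrite e normr0.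
have := H a b ab.
have le : b%:~R ^+ 2 / D <= v.2%:R ^+ 2 / D.
  rewrite ler_pM2r ?invr_gt0// -[leLHS]ger0_norm ?sqr_ge0// normrX lerXn2r ?nnegrE//.
  by rewrite -intr_norm pmulrn ler_int.
move=> h; have : (v.1%:~R - v.2%:R * theta) ^+ 2 <= (a%:~R - b%:~R * theta) ^+ 2 by lra.
by move=> h2; rewrite -ler_sqr ?nnegrE// !real_normK ?num_real.
Qed.

Lemma hermite_same_denominator (v w : int * nat) : best_approx theta v ->
  hermite_best_approx theta w -> v.2 = w.2 -> hermite_best_approx theta v.
Proof.
move=> vB wH vw; have [v0 _ vmin] := vB.
have [_ _ wmin] := hermite_best (v := w) (leq_trans v0 (eq_leq vw)) wH.
have E : (v.1%:~R - v.2%:R * theta) ^+ 2 = (w.1%:~R - w.2%:R * theta) ^+ 2.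
  rewrite -[LHS]real_normK ?num_real// -[RHS]real_normK ?num_real//; congr (_ ^+ 2).
  apply/eqP; rewrite eq_le.
  have -> : `|v.1%:~R - v.2%:R * theta| <= `|w.1%:~R - w.2%:R * theta|.
    by apply: (vmin w.1 w.2%:Z); rewrite ger0_norm// -vw !ltz_nat v0 /=.
  by apply: (wmin v.1 v.2%:Z); rewrite ger0_norm// -vw !ltz_nat v0 /=.
have [_ [D D0 H]] := wH; split; first by apply/eqP => e; move: v0; rewrite e.
by exists D => // a b ab; rewrite E vw; exact: H.
Qed.

Lemma hermite_horizontal : hermite_best_approx theta (1, 0%N).
Proof.
split=> //; exists 1 => // a b ab; rewrite mul0r subr0 expr0n /= mul0r addr0 expr1n.
rewrite divr1; have [b0|b0] := eqVneq b 0.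
  rewrite b0 mul0r subr0 expr0n addr0; apply: sqr_int_ge1.
  by apply: contra ab => /eqP ->; rewrite b0.
by apply: ler_wpDl; [exact: sqr_ge0|exact: sqr_int_ge1].
Qed.

End hermite_best.

Lemma birkhoff_orbit (R : realType) (f : R -> R -> R) (x t : nat -> R) n :
  (forall k, x k.+1 = past (x k) (t k)) -> (forall k, t k.+1 = gauss_map (t k)) ->
  birkhoff f n (x 0%N) (t 0%N) = \sum_(k < n) f (x k) (t k).
Proof.
elim: n x t => [|n IH] x t hx ht; first by rewrite big_ord0.
rewrite big_ord_recl /=; congr (_ + _).
rewrite -hx -ht (IH (fun k => x k.+1) (fun k => t k.+1))//.
Qed.

Definition nearest_distance (R : realType) (theta : R) : R :=
  `|(Num.floor (theta + 2^-1))%:~R - theta|.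

Definition irrational (R : realType) (theta : R) : Prop :=
  forall w : int * nat, (0 < w.2)%N -> defect theta w != 0.

Lemma best_approx_infinite (R : realType) (theta : R) u : irrational theta ->
  lists (best_approx theta) u -> exists v, forall n, u n = Some (v n).
Proof.
move=> irr uP.
suff H n : exists v, u n = Some v by have [v vP] := choice H; exists v.
apply: (lists_infinite uP).
  by exists (Num.floor (theta + 2^-1), 1%N); exact: nearest_best.
move=> w wB; have [_ uB _ /(_ w wB) [k [x [uk <-]]]] := uP.
have rx := lists_reduced uP uk; have [_ _ _ _ x0] := rx.
have d0 : 0 < `|defect theta x| by rewrite normr_gt0 irr.
have [cB xc] := next_vector_best rx (uB _ _ uk) d0.
by exists (next_vector theta (pred_vector theta u k x) x).
Qed.

Section trajectory.
Variables (R : realType) (theta : R) (u : nat -> option (int * nat)) (v : nat -> int * nat).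
Hypothesis uP : lists (best_approx theta) u.
Hypothesis uv : forall n, u n = Some (v n).
Hypothesis irr : irrational theta.

Let p n := pred_vector theta u n (v n).
Let x n : R := (p n).2%:R / (v n).2%:R.
Let t n : R := `|defect theta (v n)| / `|defect theta (p n)|.

Let red n : reduced_pair theta (p n) (v n).
Proof. exact: lists_reduced. Qed.

Let pS n : p n.+1 = v n.
Proof. by rewrite /p /= uv. Qed.

Let q_gt0 n : 0 < (v n).2%:R :> R.
Proof. by rewrite ltr0n; have [] := red n. Qed.

Let r_gt0 n : 0 < `|defect theta (v n)|.
Proof. by rewrite normr_gt0 irr//; have [] := red n. Qed.

Let rp_gt n : 0 < `|defect theta (p n)|.
Proof. by have [_ _ h _ _] := red n; exact: le_lt_trans h. Qed.

Let vS n : v n.+1 = next_vector theta (p n) (v n).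
Proof. by have [_] := lists_succ uP (uv n) (uv n.+1). Qed.

Let tV n : (t n)^-1 = `|defect theta (p n)| / `|defect theta (v n)|.
Proof. by rewrite /t invf_div. Qed.

Let digitE n : digit (t n) = Num.truncn (`|defect theta (p n)| / `|defect theta (v n)|).
Proof. by rewrite /digit tV (maxn_idPr _)//; exact: digit_gt0. Qed.

Let xS n : x n.+1 = past (x n) (t n).
Proof.
rewrite /past digitE /x pS vS /= natrD natrM -invf_div; congr (_^-1).
by rewrite mulrDl mulfK ?gt_eqF// addrC.
Qed.

Let tS n : t n.+1 = gauss_map (t n).
Proof.
rewrite /gauss_map digitE tV /t pS vS norm_defect_next//.
by rewrite mulrBl mulfK ?gt_eqF.
Qed.

Let x0 : x 0%N = 0.
Proof. by rewrite /x /p /= mul0r. Qed.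

Let v0 : exists2 a : int, v 0%N = (a, 1%N) & `|a%:~R - theta| = nearest_distance theta.
Proof.
have [a [u0 _ h]] := first_best_approx uP.
by exists a; first by move: u0; rewrite uv => -[].
Qed.

Let t0 : t 0%N = nearest_distance theta.
Proof.
have [a e <-] := v0.
have h : `|defect theta (unit_vector theta (a, 1%N))| = 1.
  rewrite /unit_vector {1}/defect /= mul0r subr0.
  by case: ifP => _; rewrite ?rmorphN ?normrN normr1.
by rewrite /t /p /= e h divr1 /defect /= mul1r.
Qed.

(** The ratios of successive denominators are the inverses of the pasts, and their
    logarithms add up. *)
Lemma log_denominator n : ln ((v n).2%:R : R) = birkhoff (@levy_fun R) n 0 (nearest_distance theta).
Proof.
rewrite -x0 -t0 (birkhoff_orbit _ _ xS tS).
elim: n => [|n IH].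
  by rewrite big_ord0; have [a -> _] := v0; rewrite ln1.
rewrite big_ord_recr /= -IH /levy_fun.
have -> : (digit (t n))%:R + x n = (v n.+1).2%:R / (v n).2%:R.
  by have := xS n; rewrite /past /x pS => /(congr1 (@GRing.inv R)); rewrite invrK invf_div.
by rewrite ln_div ?posrE// addrC subrK.
Qed.

Let test n : hermite_test (x n) (t n) = `[< hermite_best_approx theta (v n) >]%:R.
Proof.
have q0 := q_gt0 n; have r0 := r_gt0 n; have rp0 := rp_gt n.
have x_ge0 : 0 <= x n by rewrite divr_ge0.
have -> : hermite_test (x n) (t n) = ((t n <= threshold (x n))%R : nat)%:R.
  by rewrite /hermite_test; case: ifP.
congr (nat_of_bool _)%:R.
have -> : (t n <= threshold (x n)) =
    (3 * ((v n).2%:R * `|defect theta (v n)|) <=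
     (2 * (p n).2%:R + (v n).2%:R) * (2 * `|defect theta (p n)| - `|defect theta (v n)|)).
  have h : 0 < x n + 2 by rewrite ltr_wpDl.
  rewrite /threshold ler_pdivlMr//.
  have eq1 : (p n).2%:R = x n * (v n).2%:R by rewrite /x divfK// gt_eqF.
  have er : `|defect theta (v n)| = t n * `|defect theta (p n)| by rewrite /t divfK// gt_eqF.
  rewrite eq1 er; move: (x n) (t n) q0 rp0; move: ((v n).2%:R : R) (`|defect theta (p n)|).
  move=> q r y s q0 r0'.
  rewrite -subr_ge0 -[RHS]subr_ge0.
  have -> : (2 * (y * q) + q) * (2 * r - s * r) - 3 * (q * (s * r)) =
     (2 * q * r) * (2 * y + 1 - s * (y + 2)) by ring.
  by rewrite pmulr_rge0// !mulr_gt0.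
apply/idP/asboolP; first exact: hermite_reduced.
exact: hermite_reduced_conv.
Qed.

Definition hermite_count n := \sum_(k < n) (`[< hermite_best_approx theta (v k) >] : nat).

Lemma hermite_count_birkhoff n :
  (hermite_count n)%:R = birkhoff (@hermite_test R) n 0 (nearest_distance theta).
Proof.
rewrite -x0 -t0 (birkhoff_orbit _ _ xS tS) /hermite_count natr_sum.
by apply: eq_bigr => k _; rewrite test.
Qed.

Lemma card_hermite n : #|[pred k : 'I_n |
    `[< exists w, u k = Some w /\ hermite_best_approx theta w >]]| = hermite_count n.
Proof.
rewrite -sum1_card big_mkcond; apply: eq_bigr => k _; rewrite inE.
rewrite (_ : `[< _ >] = `[< hermite_best_approx theta (v k) >]); first by case: asbool.
apply/idP/idP => /asboolP h; apply/asboolP; last by exists (v k).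
by have [w []] := h; rewrite uv => -[<-].
Qed.

Let vlt i j : (i < j)%N -> ((v i).2 < (v j).2)%N.
Proof. by move=> ij; exact: lists_lt uP ij (uv i) (uv j). Qed.

Let index_lt n : (n < (v n).2)%N.
Proof. by elim: n => [|n IH]; [have [_ _ _ _] := red 0|exact: leq_ltn_trans IH (vlt (ltnSn n))]. Qed.

Let index_of w : best_approx theta w -> exists k, (v k).2 = w.2.
Proof.
move=> wB; have [_ _ _ /(_ w wB) [k [z [uk <-]]]] := uP.
by exists k; move: uk; rewrite uv => -[->].
Qed.

Let vB n : best_approx theta (v n).
Proof. by have [_ uB _ _] := uP; exact: uB (uv n). Qed.

Let occurs_index k :
  occurs (hermite_best_approx theta) (v k).2 = `[< hermite_best_approx theta (v k) >].
Proof.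
rewrite /occurs (_ : `[< exists _, _ >] = `[< hermite_best_approx theta (v k) >])//.
apply/idP/idP => /asboolP h; apply/asboolP.
  by have [a ha] := h; exact: (hermite_same_denominator (vB k) ha).
by exists (v k).1; case: (v k) h.
Qed.

(** The additional unit counts the denominator 0, of the Hermite vectors [(1, 0)] and
    [(-1, 0)], which are not best approximation vectors. *)
Lemma hermite_rank k :
  (\sum_(0 <= q < (v k).2) occurs (hermite_best_approx theta) q)%N = (hermite_count k).+1.
Proof.
elim: k => [|k IH].
  have [a -> _] := v0; rewrite big_nat1 /hermite_count big_ord0 /occurs asboolT//.
  by exists 1; exact: hermite_horizontal.
have kk := vlt (ltnSn k).
rewrite (@big_cat_nat _ _ _ (v k).2)//=; last exact: ltnW.
rewrite IH big_ltn// occurs_index (@occurs_gap _ (v k).2.+1)//; last first.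
  move=> w wH kw; have w0 : (0 < w.2)%N by exact: leq_trans kw.
  exact: lists_next uP (uv k) (uv k.+1) _ (hermite_best w0 wH) kw.
by rewrite /hermite_count big_ord_recr /= addn0 addSn.
Qed.

(** Among any two consecutive best approximation vectors one is Hermite. *)
Lemma hermite_infinite g : lists (hermite_best_approx theta) g ->
  forall n, exists w, g n = Some w.
Proof.
move=> gP; apply: (lists_infinite gP).
  by exists (1, 0%N); exact: hermite_horizontal.
move=> w _; have [h|h] := hermite_alternative uP (uv w.2) (uv w.2.+1).
  by exists (v w.2).
by exists (v w.2.+1) => //; exact: ltn_trans (index_lt _) (vlt (ltnSn _)).
Qed.

Lemma hermite_index g n w : lists (hermite_best_approx theta) g -> g n.+1 = Some w ->
  exists2 k, (v k).2 = w.2 & n = hermite_count k.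
Proof.
move=> gP gn; have E := lists_index gP gn.
have w0 : (0 < w.2)%N by case: (w.2) E => //; rewrite big_geq.
have [_ gH _ _] := gP.
have [k kw] := index_of (hermite_best w0 (gH _ _ gn)).
by exists k => //; move: E; rewrite -kw hermite_rank => -[].
Qed.

Lemma hermite_count_le k : (hermite_count k <= k)%N.
Proof.
rewrite -[leqRHS]card_ord -sum1_card; apply: leq_sum => i _.
by case: asbool.
Qed.

(** If the Hermite vector of index [n] is the best approximation vector of
    index [k], then [n] is the number of Hermite vectors before [k] plus one, and
    the two averages combine into a quotient. *)
Lemma hermite_growth (a b : R) g : 0 < b -> lists (hermite_best_approx theta) g ->
  n%:R^-1 * birkhoff (@levy_fun R) n 0 (nearest_distance theta) @[n --> \oo] --> a ->
  n%:R^-1 * birkhoff (@hermite_test R) n 0 (nearest_distance theta) @[n --> \oo] --> b ->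
  n%:R^-1 * oapp (fun w : int * nat => ln (w.2%:R : R)) 0 (g n) @[n --> \oo] --> a / b.
Proof.
move=> b0 gP ha hb.
pose L k : R := ln (v k).2%:R / ((hermite_count k)%:R + 1).
have cL : L k @[k --> \oo] --> a / b.
  rewrite -cvg_shiftS in ha; rewrite -cvg_shiftS in hb; rewrite -cvg_shiftS.
  have hb' : k.+1%:R^-1 * birkhoff (@hermite_test R) k.+1 0 (nearest_distance theta)
      + k.+1%:R^-1 @[k --> \oo] --> b.
    by rewrite -[b]addr0; apply: cvgD => //; exact: cvg_harmonic.
  have h : (k.+1%:R^-1 * birkhoff (@levy_fun R) k.+1 0 (nearest_distance theta)) /
      (k.+1%:R^-1 * birkhoff (@hermite_test R) k.+1 0 (nearest_distance theta) + k.+1%:R^-1)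
      @[k --> \oo] --> a / b.
    by apply: cvgM; [exact: ha|apply: cvgV; [exact: lt0r_neq0|exact: hb']].
  move: h; apply: cvg_trans.
  apply: near_eq_cvg; apply: nearW => k.
  rewrite -log_denominator -hermite_count_birkhoff -[RHS]/(L k.+1) /L.
  have h1 : 0 < k.+1%:R :> R by [].
  have h2 : 0 < (hermite_count k.+1)%:R + 1 :> R by rewrite ltr_wpDl.
  move: (k.+1%:R : R) ((hermite_count k.+1)%:R : R) (ln _) h1 h2 => y z l y0 z0.
  by field; rewrite !gt_eqF.
have idx n : exists k, (n <= k.+1)%N /\ ((0 < n)%N ->
    n%:R^-1 * oapp (fun w : int * nat => ln (w.2%:R : R)) 0 (g n) = L k).
  case: n => [|n]; first by exists 0%N.
  have [w gw] := hermite_infinite gP n.+1; have [k kw nk] := hermite_index gP gw.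
  exists k; split; first by rewrite ltnS nk hermite_count_le.
  by move=> _; rewrite gw /= -kw /L -nk natr1 mulrC.
have [kap kapP] := choice idx.
have ckap : kap n @[n --> \oo] --> \oo.
  apply/cvgnyPge => A; near=> n; have [h _] := kapP n.
  by rewrite -ltnS (leq_trans _ h)//; near: n; exact: nbhs_infty_gt.
have := cvg_comp _ _ ckap cL; apply: cvg_trans; apply: near_eq_cvg.
near=> n; have [_ ->//] := kapP n; near: n; exact: nbhs_infty_gt.
Unshelve. all: by end_near. Qed.

End trajectory.

Section almost_everywhere.
Variable R : realType.
Local Notation mu := (@lebesgue_measure R).

Lemma nearest_distance01 (theta : R) : irrational theta -> 0 < nearest_distance theta < 1.
Proof.
move=> irr; have [_ h] := nearest_integer theta 0; apply/andP; split.
  have := irr (Num.floor (theta + 2^-1), 1%N) isT.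
  by rewrite /defect /= mul1r normr_gt0.
by apply: le_lt_trans h _; lra.
Qed.

Lemma ae_irrational : {ae mu, forall theta, irrational theta}.
Proof.
pose F n : set R := if unpickle n is Some w then [set (w : int * nat).1%:~R / w.2%:R] else set0.
change (mu.-negligible (~` [set theta | irrational theta])).
have nF : mu.-negligible (\bigcup_n F n).
  apply: negligible_bigcup => n; rewrite /F.
  case: (unpickle n) => [w|]; last exact: negligible_set0.
  exists [set w.1%:~R / w.2%:R]; split=> //.
  exact: lebesgue_measure_set1.
apply: negligibleS nF => theta /= /existsNP [w /not_implyP [w0 /negP]]; rewrite negbK => /eqP d0.
exists (pickle w); first exact: I.
rewrite /F pickleK /=.
by rewrite (subr0_eq d0) mulrAC mulfV ?mul1r// pnatr_eq0 -lt0n.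
Qed.

(** On the set of [theta] with nearest integer [a], the distance is one of the
    affine maps [a - theta] and [theta - a], whose preimages of null sets are null. *)
Lemma ae_nearest_distance (P : R -> Prop) : {ae mu, forall t, 0 < t < 1 -> P t} ->
  {ae mu, forall theta, irrational theta -> P (nearest_distance theta)}.
Proof.
move=> aeP; set N : set R := ~` [set t | 0 < t < 1 -> P t].
have nN : mu.-negligible N by exact: aeP.
pose F n : set R := if unpickle n is Some a then
  affine (a : int)%:~R (-1) @^-1` N `|` affine (- a%:~R) 1 @^-1` N else set0.
change (mu.-negligible (~` [set theta | irrational theta -> P (nearest_distance theta)])).
have nF : mu.-negligible (\bigcup_n F n).
  apply: negligible_bigcup => n; rewrite /F.
  case: (unpickle n) => [a|]; last exact: negligible_set0.
  by apply: negligibleU; apply: negligible_affine => //; rewrite oppr_eq0.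
apply: negligibleS nF => theta /= /not_implyP [irr nP].
exists (pickle (Num.floor (theta + 2^-1))); first exact: I.
rewrite /F pickleK /= /affine.
have d01 := nearest_distance01 irr.
have Nd : N (nearest_distance theta) by move=> /(_ d01).
move: Nd; rewrite /nearest_distance; set a := (Num.floor _)%:~R.
rewrite mulN1r mul1r [- a + _]addrC.
by case: (ger0P (a - theta)) => _ Nd; [left|right; rewrite -opprB].
Qed.

End almost_everywhere.

Theorem theorem1 (R : realType) :
  [/\ forall (theta : R) (u : nat -> option (int * nat)),
        lists (best_approx theta) u ->
        forall (n : nat) (v w : int * nat), u n = Some v -> u n.+1 = Some w ->
          hermite_best_approx theta v \/ hermite_best_approx theta w,
      {ae @lebesgue_measure R, forall theta : R,
        forall u : nat -> option (int * nat), lists (best_approx theta) u ->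
          n%:R^-1 * #|[pred k : 'I_n |
              `[< exists v, u k = Some v /\ hermite_best_approx theta v >]]|%:R
            @[n --> \oo] --> (ln 3 / ln 4 : R)}
    & {ae @lebesgue_measure R, forall theta : R,
        forall u : nat -> option (int * nat),
          lists (hermite_best_approx theta) u ->
          n%:R^-1 * oapp (fun v : int * nat => ln (v.2%:R : R)) 0 (u n)
            @[n --> \oo] --> (pi ^+ 2 / (6 * ln 3) : R)}].
Proof.
have filt := ae_filter_ringOfSetsType (@lebesgue_measure R).
have ae_irr := @ae_irrational R.
have ae_hermite := ae_nearest_distance (@hermite_test_average R).
have ae_levy := ae_nearest_distance (@levy_average R).
have ln2 : 0 < ln 2 :> R by rewrite ln_gt0// ltr1n.
have ln3 : 0 < ln 3 :> R by rewrite ln_gt0// ltr1n.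
have ln4 : ln 4 = 2 * ln 2 :> R.
  by rewrite (_ : 4 = 2 ^+ 2 :> R) ?lnXn// ?mulr_natl//; ring.
split.
- by move=> theta u uP n v w; exact: hermite_alternative uP.
- apply: (filterS2 filt _ ae_irr ae_hermite) => theta irr /(_ irr) h u uP.
  have [v uv] := best_approx_infinite irr uP.
  move: h; apply: cvg_trans; apply: near_eq_cvg; apply: nearW => n.
  by rewrite (@card_hermite R theta u v uv) (hermite_count_birkhoff uP uv irr).
- apply: (filterS3 filt _ ae_irr ae_hermite ae_levy) => theta irr /(_ irr) h1 /(_ irr) h2 g gP.
  have [u uP] := exists_lists (best_approx theta).
  have [v uv] := best_approx_infinite irr uP.
  have -> : pi ^+ 2 / (6 * ln 3) = (pi ^+ 2 / (12 * ln 2)) / (ln 3 / ln 4) :> R.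
    rewrite ln4; move: (pi ^+ 2) (ln 2) (ln 3) ln2 ln3 => p a b a0 b0.
    by field; rewrite !gt_eqF.
  apply: (hermite_growth uP uv irr) => //.
  by rewrite divr_gt0// ln4 mulr_gt0.
Qed.
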